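(* Let $P\xrightarrow{\pi}X$ be a principal $G$-bundle trivialized over a finite ordered open cover $\mathcal U=\{U_\alpha\}$ with trivializations $\varphi_\alpha$ and transition functions $g_{\alpha\beta}$, let $\phi_P(\omega)=\{\epsilon(\omega)1_{\alpha\beta}-g_{\alpha\beta}^*\omega\}_{\alpha\prec\beta}$, and let $d_P$ be the differential on $\Omega_G\otimes\check C^*(\mathcal U,\Omega_{DR}(U))$ induced via the isomorphism $\nabla$ from the Čech–de Rham differential of $P$ with respect to the cover $\mathcal V=\{\pi^{-1}(U_\alpha)\}$. Then $$d_P=d_{\phi_P},$$ i.e. $d_P=d-\phi_P\cap1$, where $d$ is the usual differential of the tensor product $\Omega_G\otimes\check C^*(\mathcal U,\Omega_{DR}(U))$ and $(\phi_P\cap1)(\omega\otimes h)=(-1)^{|\omega|}\sum\omega^{(1)}\otimes\phi_P(\omega^{(2)})\cup h$.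
   Context: $G$ is a compact algebraic Lie group acting on $P$ from the left, $X$ a closed smooth manifold, $\varphi_\alpha:\pi^{-1}(U_\alpha)\cong G\times U_\alpha$ equivariant trivializations, $\varphi_\beta\varphi_\alpha^{-1}(g,x)=(g\,g_{\alpha\beta}(x),x)$. $\Omega_G$ is the differential graded Hopf algebra of polynomial differential forms on $G$, coproduct $\omega\mapsto\omega^{(1)}\otimes\omega^{(2)}$ induced by the group product, counit $\epsilon$ = value at the unit of the degree-$0$ part. $\check C^n(\mathcal U,\Omega_{DR}(U))=\bigoplus_{p+q=n}\prod_{\alpha_0\prec\dots\prec\alpha_p}\Omega^q_{DR}(U_{\alpha_0\dots\alpha_p})$ with $(\delta h)_{\alpha_0\dots\alpha_{p+1}}=\sum_i(-1)^ih_{\alpha_0\dots\widehat{\alpha_i}\dots\alpha_{p+1}}$, total differential $Dh=dh+(-1)^q\delta h$ in bidegree $(p,q)$, and product $(h'\cup h'')_{\alpha_0\dots\alpha_{p+p''}}=(-1)^{pq''}h'_{\alpha_0\dots\alpha_p}\wedge h''_{\alpha_p\dots\alpha_{p+p''}}$ ($p$ the Čech degree of $h'$; $p'',q''$ the Čech and form degrees of $h''$). The usual tensor product differential is $d(\omega\otimes h)=d\omega\otimes h+(-1)^{|\omega|}\omega\otimes Dh$. $\check C^*(\mathcal V,\Omega(V))$ is the analogous Čech–de Rham complex of $P$ for the cover $V_\alpha=\pi^{-1}(U_\alpha)$, with forms that are polynomial along the fibres in the trivializations, and with total differential given by the same formula. The isomorphism of graded spaces $\nabla:\check C^*(\mathcal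 V,\Omega(V))\cong\Omega_G\otimes\check C^*(\mathcal U,\Omega_{DR}(U))$ is obtained by using on each $V_{\alpha_0\dots\alpha_p}$, $\alpha_0\prec\dots\prec\alpha_p$, the trivialization $\varphi_{\alpha_0}$: $\nabla^{-1}(\omega\otimes h)_{\alpha_0\dots\alpha_p}=\varphi_{\alpha_0}^*(\omega\otimes h_{\alpha_0\dots\alpha_p})$. Then $d_P=\nabla\circ D\circ\nabla^{-1}$. *)

(* Defs.v *)
From HB Require Import structures.
From mathcomp Require Import all_boot all_order all_algebra.
From mathcomp Require Import all_classical all_reals all_analysis.
From mathcomp Require Import generic_quotient.
From mathcomp Require mpoly.

Set Implicit Arguments.
Unset Strict Implicit.
Unset Printing Implicit Defensive.

Import Order.TTheory GRing.Theory Num.Theory.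
Import numFieldNormedType.Exports.

Local Open Scope classical_set_scope.
Local Open Scope quotient_scope.
Local Open Scope ring_scope.

Section Tensor.
Variables (R : comNzRingType) (V W : lmodType R).

Definition bilin (Z : lmodType R) (b : V -> W -> Z) : Prop :=
  (forall w, linear (fun v => b v w)) /\ (forall v, linear (b v)).

(* A formal sum of pairs stands for a sum of pure tensors; two of them are
   identified when no bilinear map distinguishes them. *)
Definition tens_eq (s t : seq (V * W)) : bool :=
  `[< forall (Z : lmodType R) (b : V -> W -> Z), bilin b ->
        \sum_(x <- s) b x.1 x.2 = \sum_(x <- t) b x.1 x.2 >].

Lemma tens_eq_refl : reflexive tens_eq.
Proof. by move=> s; apply/asboolP. Qed.
Lemma tens_eq_sym : symmetric tens_eq.
Proof.
by move=> s t; apply/asboolP/asboolP => h Z b hb; rewrite (h Z b hb).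
Qed.
Lemma tens_eq_trans : transitive tens_eq.
Proof.
move=> t s u /asboolP h1 /asboolP h2; apply/asboolP => Z b hb.
by rewrite (h1 Z b hb) (h2 Z b hb).
Qed.

Canonical tens_equiv :=
  EquivRel tens_eq tens_eq_refl tens_eq_sym tens_eq_trans.

Definition tensor := {eq_quot tens_equiv}.
HB.instance Definition _ := Choice.on tensor.
HB.instance Definition _ : EqQuotient _ tens_equiv tensor :=
  EqQuotient.on tensor.

Implicit Types t : tensor.

Definition tlift (Z : lmodType R) (b : V -> W -> Z) t : Z :=
  \sum_(x <- repr t) b x.1 x.2.

Lemma tlift_pi (Z : lmodType R) (b : V -> W -> Z) (s : seq (V * W)) :
  bilin b -> tlift b (\pi_tensor s) = \sum_(x <- s) b x.1 x.2.
Proof.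
move=> hb; rewrite /tlift.
have /eqmodP/asboolP h : repr (\pi_tensor s) = s %[mod tensor] by rewrite reprK.
exact: h.
Qed.

Lemma tens_ext t t' :
  (forall (Z : lmodType R) (b : V -> W -> Z), bilin b ->
     tlift b t = tlift b t') -> t = t'.
Proof.
move=> h; rewrite -[t]reprK -[t']reprK; apply/eqmodP/asboolP => Z b hb.
exact: h.
Qed.

Definition tens0 : tensor := \pi_tensor [::].
Definition tens_add t t' : tensor := \pi_tensor (repr t ++ repr t').
Definition tens_scale (a : R) t : tensor :=
  \pi_tensor [seq (a *: x.1, x.2) | x <- repr t].
Definition tens_opp t := tens_scale (- 1) t.

Lemma tlift0 (Z : lmodType R) (b : V -> W -> Z) : bilin b -> tlift b tens0 = 0.
Proof. by move=> hb; rewrite tlift_pi // big_nil. Qed.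
Lemma tliftD (Z : lmodType R) (b : V -> W -> Z) t t' : bilin b ->
  tlift b (tens_add t t') = tlift b t + tlift b t'.
Proof. by move=> hb; rewrite tlift_pi // big_cat. Qed.
Lemma tliftZ (Z : lmodType R) (b : V -> W -> Z) a t : bilin b ->
  tlift b (tens_scale a t) = a *: tlift b t.
Proof.
move=> hb; rewrite tlift_pi // big_map scaler_sumr; apply: eq_bigr => x _ /=.
have b0 : b 0 x.2 = 0.
  by have := hb.1 x.2 (- 1) 0 0; rewrite scaler0 addr0 scaleN1r addNr.
by have := hb.1 x.2 a x.1 0; rewrite b0 !addr0.
Qed.

Lemma tens_addA : associative tens_add.
Proof. by move=> x y z; apply: tens_ext => Z b hb; rewrite !tliftD // addrA. Qed.
Lemma tens_addC : commutative tens_add.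
Proof. by move=> x y; apply: tens_ext => Z b hb; rewrite !tliftD // addrC. Qed.
Lemma tens_add0 : left_id tens0 tens_add.
Proof. by move=> x; apply: tens_ext => Z b hb; rewrite tliftD // tlift0 // add0r. Qed.
Lemma tens_addN : left_inverse tens0 tens_opp tens_add.
Proof.
by move=> x; apply: tens_ext => Z b hb; rewrite tliftD // tliftZ // tlift0 // scaleN1r addNr.
Qed.
HB.instance Definition _ :=
  GRing.isZmodule.Build tensor tens_addA tens_addC tens_add0 tens_addN.

Lemma tens_scaleA a b t : tens_scale a (tens_scale b t) = tens_scale (a * b) t.
Proof. by apply: tens_ext => Z f hf; rewrite !tliftZ // scalerA. Qed.
Lemma tens_scale1 : left_id 1 tens_scale.
Proof. by move=> t; apply: tens_ext => Z f hf; rewrite !tliftZ // scale1r. Qed.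
Lemma tens_scaleDr : right_distributive tens_scale +%R.
Proof.
by move=> a t u; apply: tens_ext => Z f hf; rewrite !(tliftZ,tliftD) // scalerDr.
Qed.
Lemma tens_scaleDl t : {morph tens_scale^~ t : a b / a + b}.
Proof.
by move=> a b; apply: tens_ext => Z f hf; rewrite !(tliftZ,tliftD) // scalerDl.
Qed.
HB.instance Definition _ := GRing.Zmodule_isLmodule.Build R tensor
  tens_scaleA tens_scale1 tens_scaleDr tens_scaleDl.

Definition tens (v : V) (w : W) : tensor := \pi_tensor [:: (v, w)].

Lemma tlift_tens (Z : lmodType R) (b : V -> W -> Z) v w :
  bilin b -> tlift b (tens v w) = b v w.
Proof. by move=> hb; rewrite tlift_pi // big_seq1. Qed.

Lemma bilin_tens : bilin tens.
Proof.
split=> [w a v v'|v a w w']; apply: tens_ext => Z f hf;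
  rewrite tliftD // tliftZ // !tlift_tens //; [exact: hf.1 | exact: hf.2].
Qed.

(* A (x) B for subspaces A and B; over a field this is a subspace of V (x) W. *)
Definition tens_span (A : set V) (B : set W) : set tensor :=
  [set t | exists s : seq (V * W),
     (forall x, x \in s -> A x.1 /\ B x.2) /\ t = \sum_(x <- s) tens x.1 x.2].

End Tensor.

Notation "v \ot w" := (tens v w) (at level 40, left associativity) : ring_scope.

Section Smooth.
Variable R : realType.

(* f is of class C^k; O is meant to be open. *)
Fixpoint Ck (k : nat) (V W : normedModType R) (O : set V) (f : V -> W) : Prop :=
  match k with
  | 0 => forall x, O x -> {for x, continuous f}
  | k'.+1 => (forall x, O x -> differentiable f x) /\
             (forall v : V, Ck k' O (fun x => 'D_v f x))
  end.

Definition smooth_on (V W : normedModType R) (O : set V) (f : V -> W) : Prop :=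
  forall k, Ck k O f.

(* A chart is given by total functions; [cmap] and [cinv] are meaningful on
   [cdom] and on [cmap @` cdom] only. *)
Record chart (T : Type) (n : nat) := Chart {
  cdom : set T;
  cmap : T -> 'rV[R]_n;
  cinv : 'rV[R]_n -> T }.

(* A space with an atlas and a preferred chart around each point. The tangent
   space at p is 'rV_n, through the preferred chart at p. *)
Record charted (n : nat) := Charted {
  carrier :> topologicalType;
  atlas : set (chart carrier n);
  chart_at : carrier -> chart carrier n }.

Arguments cdom {T n} c.
Arguments cmap {T n} c _.
Arguments cinv {T n} c _.
Arguments atlas {n} c _.
Arguments chart_at {n M} p : rename.

Record is_manifold n (M : charted n) : Prop := IsManifold {
  mfd_hausdorff : hausdorff_space M;
  mfd_countable : @second_countable M;
  mfd_at : forall p : M, atlas M (chart_at p) /\ cdom (chart_at p) p;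
  mfd_open : forall c, atlas M c -> open (cdom c) /\ open (cmap c @` cdom c);
  mfd_cancel : forall c, atlas M c -> {in cdom c, cancel (cmap c) (cinv c)};
  mfd_homeo : forall c, atlas M c ->
    (forall p, cdom c p -> {for p, continuous (cmap c)}) /\
    (forall x, (cmap c @` cdom c) x -> {for x, continuous (cinv c)});
  mfd_smooth : forall c c', atlas M c -> atlas M c' ->
    smooth_on (cmap c @` (cdom c `&` cdom c')) (cmap c' \o cinv c) }.

Definition is_closed_manifold n (M : charted n) : Prop :=
  is_manifold M /\ compact [set: M].

Definition smooth_map m n (M : charted m) (N : charted n) (W : set M)
    (f : M -> N) : Prop :=
  (forall p, W p -> {for p, continuous f}) /\
  (forall c c', atlas M c -> atlas N c' ->
     smooth_on (cmap c @` (W `&` cdom c `&` f @^-1` cdom c'))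
               (cmap c' \o f \o cinv c)).

Definition smooth_vec m (M : charted m) (V : normedModType R) (f : M -> V) :=
  forall c, atlas M c -> smooth_on (cmap c @` cdom c) (f \o cinv c).

Definition euclid (n : nat) : charted n :=
  let c := Chart setT id id in @Charted n 'rV[R]_n [set c] (fun=> c).

Definition prod_chart m n (S T : Type) (c : chart S m) (c' : chart T n) :
    chart (S * T) (m + n) :=
  Chart (cdom c `*` cdom c') (fun p => row_mx (cmap c p.1) (cmap c' p.2))
        (fun x => (cinv c (lsubmx x), cinv c' (rsubmx x))).

Definition prod_charted m n (M : charted m) (N : charted n) : charted (m + n) :=
  @Charted (m + n) (M * N)%type
    [set cc | exists c c', [/\ atlas M c, atlas N c' & cc = prod_chart c c']]
    (fun p => prod_chart (chart_at p.1) (chart_at p.2)).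

Definition tmap m n (M : charted m) (N : charted n) (f : M -> N) (p : M) :
    'rV[R]_m -> 'rV[R]_n :=
  'd (cmap (chart_at (f p)) \o f \o cinv (chart_at p)) (cmap (chart_at p) p).

(* [w p [:: v1; ...; vq]] is the value of the degree q component of w at p on
   the tangent vectors v1, ..., vq; forms are thus not assumed homogeneous.
   This type contains arbitrary families; the forms are singled out by
   [is_form]. A form on an open subset W is extended by zero outside W. *)
Definition dform n (M : charted n) := M -> seq 'rV[R]_n -> R^o.
HB.instance Definition _ n (M : charted n) := GRing.Lmodule.on (dform M).

Definition restr n (M : charted n) (W : set M) (w : dform M) : dform M :=
  fun p vs => if p \in W then w p vs else 0.

Definition pull m n (M : charted m) (N : charted n) (f : M -> N) (w : dform N) :
    dform M :=
  fun p vs => w (f p) [seq tmap f p v | v <- vs].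

Definition alternating_multilinear n (f : seq 'rV[R]_n -> R^o) : Prop :=
  (forall a b (k : R) u v,
     f (a ++ (k *: u + v) :: b) = k * f (a ++ u :: b) + f (a ++ v :: b)) /\
  (forall a b c u, f (a ++ u :: b ++ u :: c) = 0).

(* [pull (cinv c) w] is the expression of w in the chart c. *)
Record is_form n (M : charted n) (W : set M) (w : dform M) : Prop := IsForm {
  form_support : forall p, ~ W p -> w p = 0;
  form_alternating : forall p, alternating_multilinear (w p);
  form_smooth : forall c vs, atlas M c ->
    smooth_on (cmap c @` (W `&` cdom c))
      (fun x => pull (M := euclid n) (cinv c) w x vs : R^o) }.

Definition del (T : Type) (i : nat) (s : seq T) := take i s ++ drop i.+1 s.

(* Exterior derivative on W:
   dw(v_0, ..., v_q) = \sum_i (-1)^i D_(v_i) w(v_0, .., ^v_i, .., v_q) *)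
Definition extd n (M : charted n) (W : set M) (w : dform M) : dform M :=
  restr W (fun p vs => \sum_(i < size vs) (-1) ^+ i *
    'D_(nth 0 vs i)
       (fun x => pull (M := euclid n) (cinv (chart_at p)) w x (del i vs) : R^o)
       (cmap (chart_at p) p)).

(* Number of inversions of the shuffle that moves the selected positions of
   [b] to the front. *)
Definition shuffle_inv k (b : k.-tuple bool) : nat :=
  #|[set ij : 'I_k * 'I_k | [&& (ij.1 < ij.2)%N, ~~ tnth b ij.1 & tnth b ij.2]]|.

(* (w /\ w')(v_1, ..., v_k) is the sum over (q, k - q)-shuffles, encoded by the
   positions fed to w. *)
Definition wedge n (M : charted n) (w w' : dform M) : dform M :=
  fun p vs => \sum_(b : (size vs).-tuple bool)
    (-1) ^+ shuffle_inv b * w p (mask b vs) * w' p (mask (map negb b) vs).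

Definition fun_form n (M : charted n) (f : M -> R) : dform M :=
  fun p vs => if nilp vs then f p else 0.

(* w |-> (-1)^(k q) w on forms of degree q. *)
Definition gsgn n (M : charted n) (k : nat) (w : dform M) : dform M :=
  fun p vs => (-1) ^+ (k * size vs) * w p vs.

(* w (x) h as a form on M x N: the exterior product of the pullbacks of w and h
   along the projections. *)
Definition cross m n (M : charted m) (N : charted n) :
    tensor (dform M) (dform N) -> dform (prod_charted M N) :=
  tlift (fun w h => wedge (pull (M := prod_charted M N) fst w)
                          (pull (M := prod_charted M N) snd h)).

(* The real algebraic structure is given by an embedding [rho] of G onto a
   Zariski closed set of matrices. As G is compact, det^2 = 1 on G, so that
   Zariski closed subsets of 'M_N and of GL_N amount to the same and the
   inverse of det is polynomial. *)
Record alg_group (m : nat) := AlgGroup {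
  gspace :> charted m;
  gmul : gspace -> gspace -> gspace;
  ginv : gspace -> gspace;
  gone : gspace;
  gspace_manifold : is_manifold gspace;
  gspace_compact : compact [set: gspace];
  gmulA : associative gmul;
  gmul1g : left_id gone gmul;
  gmulVg : left_inverse gone ginv gmul;
  gmul_smooth : smooth_map (M := prod_charted gspace gspace) setT
                  (fun p => gmul p.1 p.2);
  ginv_smooth : smooth_map setT ginv;
  gdim : nat;
  rho : gspace -> 'M[R]_gdim;
  rho_smooth : smooth_vec rho;
  rho_inj : injective rho;
  rho1 : rho gone = 1%:M;
  rhoM : forall g h, rho (gmul g h) = rho g *m rho h;
  rho_algebraic : exists S : set (mpoly.mpoly (gdim * gdim) R),
    range rho =
    [set a | forall f, S f -> mpoly.meval (fun i => mxvec a 0 i) f = 0] }.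

(* Omega_G: the differential graded subalgebra of the de Rham algebra of G
   generated by the coordinate functions. *)
Inductive Omega m (G : alg_group m) : dform G -> Prop :=
| Omega_coord i j : Omega (fun_form (fun g => rho g i j))
| Omega_one : Omega (fun_form (fun=> 1))
| Omega_lin (a : R) w w' : Omega w -> Omega w' -> Omega (a *: w + w')
| Omega_wedge w w' : Omega w -> Omega w' -> Omega (wedge w w')
| Omega_d w : Omega w -> Omega (extd setT w).

Section Hopf.
Variables (m : nat) (G : alg_group m).

Definition counit (w : dform G) : R := w (gone G) [::].

(* The coproduct of w is the element of Omega_G (x) Omega_G which represents
   the pullback of w by the product of G. *)
Definition coprod (w : dform G) : tensor (dform G) (dform G) :=
  'pinv_(fun=> 0) (tens_span (@Omega m G) (@Omega m G)) (@cross m m G G)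
    (pull (M := prod_charted G G) (fun p => gmul p.1 p.2) w).

End Hopf.

Section Cech.
Variables (n : nat) (M : charted n) (d : Order.disp_t) (A : finOrderType d).
Variable U : A -> set M.

Definition chain (s : seq A) : bool := (s != [::]) && sorted <%O s.

Definition inter (s : seq A) : set M := [set p | forall a, a \in s -> U a p].

(* [h [:: a0; ...; ap]] is the component h_(a0 ... ap), which is 0 unless
   a0 < ... < ap. All bidegrees are considered at once. *)
Definition cochain := seq A -> dform M.
HB.instance Definition _ := GRing.Lmodule.on cochain.

Definition cech (h : cochain) : Prop :=
  forall s, if chain s then is_form (inter s) (h s) else h s = 0.

Definition cech_delta (h : cochain) : cochain := fun s =>
  if chain s
  then \sum_(i < size s) (-1) ^+ i *: restr (inter s) (h (del i s)) else 0.

Definition cech_D (h : cochain) : cochain := fun s =>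
  extd (inter s) (h s) + cech_delta (fun t => gsgn 1 (h t)) s.

Definition cup (h' h'' : cochain) : cochain := fun s =>
  if chain s
  then \sum_(p < size s)
         restr (inter s) (wedge (h' (take p.+1 s)) (gsgn p (h'' (drop p s))))
  else 0.

End Cech.

Record principal_bundle m n k (G : alg_group m) (X : charted n) := PrincipalBundle {
  total :> charted k;
  bproj : total -> X;
  bact : G -> total -> total;
  total_manifold : is_manifold total;
  bproj_smooth : smooth_map setT bproj;
  bact_smooth : smooth_map (M := prod_charted G total) setT
                  (fun p => bact p.1 p.2);
  bact1 : forall p, bact (gone G) p = p;
  bactM : forall g h p, bact (gmul g h) p = bact g (bact h p);
  bproj_act : forall g p, bproj (bact g p) = bproj p }.

(* Trivializations over the members of a cover U of X: [triv a] is an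
   equivariant diffeomorphism over U a from V a, the preimage of U a in P, to
   G x U a, with inverse [trivV a]. *)
Record trivialization m n k (G : alg_group m) (X : charted n)
    (P : principal_bundle k G X) (A : Type) (U : A -> set X) := Trivialization {
  triv : A -> P -> prod_charted G X;
  trivV : A -> prod_charted G X -> P;
  trans : A -> A -> X -> G;
  triv_smooth : forall a, smooth_map [set p : P | U a (bproj p)] (triv a);
  trivV_smooth : forall a, smooth_map [set x : prod_charted G X | U a x.2] (trivV a);
  trivK : forall a p, U a (bproj p) -> trivV a (triv a p) = p;
  trivV_proj : forall a x, U a x.2 -> bproj (trivV a x) = x.2;
  trivVK : forall a x, U a x.2 -> triv a (trivV a x) = x;
  triv_proj : forall a p, U a (bproj p) -> (triv a p).2 = bproj p;
  triv_equiv : forall a g p, U a (bproj p) ->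
    (triv a (bact g p)).1 = gmul g (triv a p).1;
  transE : forall a b g x, U a x -> U b x ->
    triv b (trivV a (g, x)) = (gmul g (trans a b x), x) }.

Definition is_open_cover n (X : charted n) (A : Type) (U : A -> set X) : Prop :=
  (forall a, open (U a)) /\ forall x, exists a, U a x.

Section Twisting.
Variables (m n k : nat) (G : alg_group m) (X : charted n).
Variables (P : principal_bundle k G X) (d : Order.disp_t) (A : finOrderType d).
Variables (U : A -> set X) (T : trivialization P U).

Definition pcover (a : A) : set P := [set p | U a (bproj p)].

Definition twisted : set (tensor (dform G) (cochain X A)) :=
  tens_span (@Omega m G) (cech U).

Definition nablaV : tensor (dform G) (cochain X A) -> cochain P A :=
  tlift (fun w h s =>
    if chain s then
      if s is a :: _
      then restr (inter pcover s) (pull (triv T a) (cross (w \ot h s)))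
      else 0
    else 0).

(* The Cech cochains of P with values in the forms that are polynomial along
   the fibres in the trivializations form the image of [twisted] by [nablaV];
   [nabla] is the inverse of [nablaV] on this image. *)
Definition nabla : cochain P A -> tensor (dform G) (cochain X A) :=
  'pinv_(fun=> 0) twisted nablaV.

Definition d_P (t : tensor (dform G) (cochain X A)) :
    tensor (dform G) (cochain X A) :=
  nabla (cech_D pcover (nablaV t)).

Definition phi_P (w : dform G) : cochain X A := fun s =>
  if s is [:: a; b] then
    if (a < b)%O then
      restr (inter U s) (counit w *: fun_form (fun=> 1) - pull (trans T a b) w)
    else 0
  else 0.

(* The maps below are given on pure tensors w (x) h; [gsgn 1 w] is
   (-1)^|w| w for w homogeneous. *)
Definition d_tens (w : dform G) (h : cochain X A) :
    tensor (dform G) (cochain X A) :=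
  extd setT w \ot h + gsgn 1 w \ot cech_D U h.

Definition cap (phi : dform G -> cochain X A) (w : dform G) (h : cochain X A) :
    tensor (dform G) (cochain X A) :=
  tlift (fun w1 w2 => w1 \ot cup U (phi w2) h) (coprod (gsgn 1 w)).

Definition d_twist (phi : dform G -> cochain X A) (w : dform G) (h : cochain X A) :
    tensor (dform G) (cochain X A) :=
  d_tens w h - cap phi w h.

End Twisting.

End Smooth.

(* Main.v *)
Require Import Defs.
From HB Require Import structures.
From mathcomp Require Import all_boot all_order all_algebra.
From mathcomp Require Import all_classical all_reals all_analysis.
From mathcomp Require Import ring lra.
Set Implicit Arguments.
Unset Strict Implicit.
Unset Printing Implicit Defensive.
Import Order.TTheory GRing.Theory Num.Theory.
Import numFieldNormedType.Exports.
Local Open Scope classical_set_scope.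
Local Open Scope ring_scope.

(** On a simplex a0 < ... < ap the isomorphism nabla uses the trivialization of
    index a0, so that everything can be compared on G x U for the intersection U
    of the U_ai. The exterior derivative and the faces that keep a0 do not change
    the trivialization: exterior derivatives commute with pullbacks
    ([extd_pull]), and they satisfy the Leibniz rule ([extd_cross]). They give the
    terms of the tensor product differential. The face that omits a0 uses the
    trivialization of index a1 instead. The two trivializations differ by
    psi (g, x) = (g g_01(x), x), and since psi is the product of G composed with
    (id, g_01), the coproduct computes its pullback ([pull_translate]):
    psi^*(w x h) = sum w1 x (g_01^* w2 /\ h).
    On the side of the twist, phi_P(w2) = e(w2) - g_01^* w2 contributes two terms.
    The one with e(w2) is the face of the tensor product differential by the
    counit axiom ([cross_counit]), and cancels it; the other one is the actual
    face ([nablaV_pure_first_face]).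

    This identity becomes one between tensors because nabla and the coproduct are
    inverses of maps that are injective on the relevant tensors. Injectivity is
    detected by evaluation on tangent vectors: if sum a_i(v) b_i vanishes for all
    v, then sum a_i (x) b_i = 0 ([tens_sum_eq0]). That the coproduct of a
    polynomial form exists is shown by induction on the form: the coordinate
    functions are multiplied as matrices, and the forms on G x G that come from
    polynomial tensors are stable under exterior product and derivative
    ([pull_mul_poly2]).

    The calculus of forms is developed pointwise, on functions of lists of tangent
    vectors. Contraction with the first vector turns the exterior product and the
    exterior derivative into recursions, Cartan's formula being the one for the
    derivative; the algebraic identities are then inductions on the list of
    vectors. Analysis enters in the naturality of the exterior derivative, where
    the second derivatives of the map cancel by their symmetry ([schwarz]). *)

(** * Alternating forms on a vector space *)

Section Exterior.
Variables (R : realType) (n : nat).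
Local Notation V := 'rV[R]_n.
Local Notation cov := (seq V -> R^o).
Implicit Types (f g h : cov) (v : V) (vs : seq V).

(** Interior product with v. *)
Definition iprod v f : cov := fun vs => f (v :: vs).

Definition grade f : cov := fun vs => (-1) ^+ size vs * f vs.

(** Shuffles are sorted by the factor that receives the first vector: v goes to f,
    or it goes to g after passing all the arguments of f. *)
Fixpoint cov_wedge f g vs : R^o :=
  if vs is v :: vs' then
    cov_wedge (iprod v f) g vs' + cov_wedge (grade f) (iprod v g) vs'
  else f [::] * g [::].

Lemma grade_iprod v f : grade (iprod v f) = - iprod v (grade f).
Proof.
by apply/funext => vs; rewrite /grade /iprod fctE /= exprS -!mulrA mulN1r opprK.
Qed.

Lemma iprod_grade v f : iprod v (grade f) = - grade (iprod v f).
Proof. by rewrite grade_iprod opprK. Qed.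

Lemma gradeK : involutive grade.
Proof.
by move=> f; apply/funext => vs; rewrite /grade mulrA -exprMn mulrNN mulr1 expr1n mul1r.
Qed.

Lemma grade_linear : linear grade.
Proof.
by move=> a f g; apply/funext => vs; rewrite /grade !fctE mulrDr /GRing.scale/= mulrCA.
Qed.

Lemma iprod_linear v : linear (iprod v).
Proof. by []. Qed.

Lemma cov_wedge_linearl g : linear (cov_wedge^~ g).
Proof.
move=> a f f'; apply/funext => vs; elim: vs f f' g => [|v vs IH] f f' g /=.
  by rewrite !fctE mulrDl scalerAl.
rewrite iprod_linear grade_linear !IH !fctE /= scalerDr.
by rewrite addrACA.
Qed.

Lemma cov_wedge_linearr f : linear (cov_wedge f).
Proof.
move=> a g g'; apply/funext => vs; elim: vs f g g' => [|v vs IH] f g g' /=.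
  by rewrite !fctE mulrDr scalerAr.
rewrite iprod_linear !IH !fctE /= scalerDr.
by rewrite addrACA.
Qed.

Lemma cov_wedgeDl f f' g : cov_wedge (f + f') g = cov_wedge f g + cov_wedge f' g.
Proof. by have := cov_wedge_linearl g 1 f f'; rewrite !scale1r. Qed.

Lemma cov_wedgeDr f g g' : cov_wedge f (g + g') = cov_wedge f g + cov_wedge f g'.
Proof. by have := cov_wedge_linearr f 1 g g'; rewrite !scale1r. Qed.

Lemma cov_wedge0l g : cov_wedge 0 g = 0.
Proof. by have := cov_wedge_linearl g (-1) 0 0; rewrite !scaleN1r !addNr. Qed.

Lemma cov_wedge0r f : cov_wedge f 0 = 0.
Proof. by have := cov_wedge_linearr f (-1) 0 0; rewrite !scaleN1r !addNr. Qed.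

Lemma cov_wedgeNl f g : cov_wedge (- f) g = - cov_wedge f g.
Proof. by apply/eqP; rewrite -addr_eq0 -cov_wedgeDl addNr cov_wedge0l. Qed.

Lemma cov_wedgeNr f g : cov_wedge f (- g) = - cov_wedge f g.
Proof. by apply/eqP; rewrite -addr_eq0 -cov_wedgeDr addNr cov_wedge0r. Qed.

Lemma gradeD f g : grade (f + g) = grade f + grade g.
Proof. by have := grade_linear 1 f g; rewrite !scale1r. Qed.

Lemma gradeN f : grade (- f) = - grade f.
Proof. by apply/funext => vs; rewrite /grade !fctE mulrN. Qed.

Lemma iprod_wedge v f g : iprod v (cov_wedge f g) =
  cov_wedge (iprod v f) g + cov_wedge (grade f) (iprod v g).
Proof. by []. Qed.

Lemma cov_wedge_cons f g v vs : cov_wedge f g (v :: vs) =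
  (cov_wedge (iprod v f) g + cov_wedge (grade f) (iprod v g)) vs.
Proof. by []. Qed.

Lemma grade_wedge f g : grade (cov_wedge f g) = cov_wedge (grade f) (grade g).
Proof.
apply/funext => vs; elim: vs f g => [|v vs IH] f g.
  by rewrite /grade /= !expr0 !mul1r.
rewrite cov_wedge_cons iprod_grade cov_wedgeNl iprod_grade cov_wedgeNr.
rewrite -opprD !fctE -!IH -[LHS]/(iprod v (grade (cov_wedge f g)) vs).
by rewrite iprod_grade iprod_wedge gradeD.
Qed.

Lemma cov_wedgeA f g h :
  cov_wedge (cov_wedge f g) h = cov_wedge f (cov_wedge g h).
Proof.
apply/funext => vs; elim: vs f g h => [|v vs IH] f g h.
  by rewrite /= mulrA.
rewrite !cov_wedge_cons !iprod_wedge grade_wedge cov_wedgeDl cov_wedgeDr.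
by rewrite !fctE !IH -addrA.
Qed.

(** Covectors of all degrees are treated at once, so that the sign rule
    f g = (-1)^(pq) g f is stated through the even part f + grade f and the odd
    part f - grade f of f. *)
Lemma cov_wedgeC f g : 2 *: cov_wedge f g =
  cov_wedge g (f + grade f) + cov_wedge (grade g) (f - grade f).
Proof.
apply/funext => vs; elim: vs f g => [|v vs IH] f g.
  rewrite !fctE /= /grade !expr0 !mul1r /GRing.scale /=.
  ring.
have IH' a b : 2 * cov_wedge a b vs =
    (cov_wedge b (a + grade a) + cov_wedge (grade b) (a - grade a)) vs.
  by rewrite -IH.
rewrite [LHS]/(2 *: _) fctE /= /GRing.scale /= mulrDr !IH' !fctE /=.
have cD a b : iprod v (a + b) = iprod v a + iprod v b by [].
have cN a : iprod v (- a) = - iprod v a by [].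
rewrite !gradeK !cD !cN !iprod_grade !grade_iprod.
rewrite ?iprod_grade ?opprK ?cov_wedgeDr ?cov_wedgeDl ?cov_wedgeNr ?cov_wedgeNl.
rewrite !fctE.
ring.
Qed.

(** Transpositions of neighbours change the sign, which brings two equal arguments
    side by side. *)
Lemma alternating_of_adjacent f :
  (forall a b (k : R) u v,
     f (a ++ (k *: u + v) :: b) = k * f (a ++ u :: b) + f (a ++ v :: b)) ->
  (forall a c u, f (a ++ u :: u :: c) = 0) -> alternating_multilinear f.
Proof.
move=> lin adj; split=> // a b c u.
have swap a' x y c' : f (a' ++ x :: y :: c') = - f (a' ++ y :: x :: c').
  apply/eqP; rewrite -addr_eq0; apply/eqP.
  have := adj a' c' (x + y).
  have lin1 a1 b1 u1 v1 : f (a1 ++ (u1 + v1) :: b1) =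
      f (a1 ++ u1 :: b1) + f (a1 ++ v1 :: b1).
    by have := lin a1 b1 1 u1 v1; rewrite scale1r mul1r.
  have lin2 z u1 v1 : f (a' ++ z :: (u1 + v1) :: c') =
      f (a' ++ z :: u1 :: c') + f (a' ++ z :: v1 :: c').
    by rewrite -!(cat_rcons z); exact: lin1.
  by rewrite lin1 !lin2 !adj add0r addr0.
elim: b a => [|x b IH] a; first exact: adj.
by rewrite /= swap -cat_rcons IH oppr0.
Qed.

Lemma alternating0 f a b : alternating_multilinear f -> f (a ++ 0 :: b) = 0.
Proof.
by move=> [lin _]; have := lin a b (-1) 0 0; rewrite scaler0 addr0 mulN1r addNr.
Qed.

Lemma alternating_swap f x y c : alternating_multilinear f ->
  f (x :: y :: c) = - f (y :: x :: c).
Proof.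
move=> [lin alt]; apply/eqP; rewrite -addr_eq0; apply/eqP.
have l1 a b u v : f (a ++ (u + v) :: b) = f (a ++ u :: b) + f (a ++ v :: b).
  by have := lin a b 1 u v; rewrite scale1r mul1r.
have := alt [::] [::] c (x + y).
rewrite l1 /= -[_ :: _]/([:: x] ++ _) l1 -[y :: _ :: _]/([:: y] ++ _) l1 /=.
by rewrite (alt [::] [::] c x) (alt [::] [::] c y) add0r addr0.
Qed.

Lemma iprod_alternating v f :
  alternating_multilinear f -> alternating_multilinear (iprod v f).
Proof.
move=> [lin alt]; split=> [a b k u w|a b c u]; rewrite /iprod.
  exact: lin (v :: a) b k u w.
exact: alt (v :: a) b c u.
Qed.

Lemma alternating_linear (k : R) f g : alternating_multilinear f ->
  alternating_multilinear g -> alternating_multilinear (k *: f + g).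
Proof.
move=> [lin alt] [lin' alt']; split=> [a b l u w|a b c u].
  rewrite !fctE lin lin' /GRing.scale /=; ring.
by rewrite !fctE alt alt' scaler0 addr0.
Qed.

Lemma alternating_zero : alternating_multilinear (0 : cov).
Proof. by split=> // a b l u w; rewrite mulr0 addr0. Qed.

Lemma grade_alternating f :
  alternating_multilinear f -> alternating_multilinear (grade f).
Proof.
move=> [lin alt]; split=> [a b k u w|a b c u]; rewrite /grade.
  rewrite lin !size_cat /=; ring.
by rewrite alt mulr0.
Qed.

Lemma wedge_alternating f g : alternating_multilinear f ->
  alternating_multilinear g -> alternating_multilinear (cov_wedge f g).
Proof.
move=> hf hg; apply: alternating_of_adjacent => [a b k u w|a c u].
  elim: a f g hf hg => [|x a IH] f g hf hg; last first.
    rewrite !cat_cons !cov_wedge_cons !fctE !IH;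
      try by [|apply: iprod_alternating|apply: grade_alternating].
    ring.
  have cl h : alternating_multilinear h ->
      iprod (k *: u + w) h = k *: iprod u h + iprod w h.
    by move=> [lin _]; apply/funext => vs; exact: (lin [::] vs k u w).
  rewrite !cat0s !cov_wedge_cons !cl // cov_wedge_linearl cov_wedge_linearr.
  rewrite !fctE /GRing.scale /=; ring.
elim: a f g hf hg => [|x a IH] f g hf hg; last first.
  rewrite !cat_cons !cov_wedge_cons !fctE !IH ?addr0 //;
    try by [|apply: iprod_alternating|apply: grade_alternating].
have c0 h : alternating_multilinear h -> iprod u (iprod u h) = 0.
  by move=> [_ alt]; apply/funext => vs; exact: (alt [::] [::] vs u).
rewrite cat0s cov_wedge_cons fctE !cov_wedge_cons iprod_grade cov_wedgeNl.
by rewrite !c0 // cov_wedge0r cov_wedge0l add0r addr0 fctE subrr.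
Qed.

(** Shape of the exterior derivative: F u us stands for the derivative in the
    direction u of the value on us. *)
Definition altsum (F : V -> seq V -> R^o) (vs : seq V) : R^o :=
  \sum_(i < size vs) (-1) ^+ i * F (nth 0 vs i) (del i vs).

Lemma altsum_nil F : altsum F [::] = 0.
Proof. by rewrite /altsum big_ord0. Qed.

Lemma altsum_cons F v vs :
  altsum F (v :: vs) = F v vs - altsum (fun u us => F u (v :: us)) vs.
Proof.
rewrite /altsum big_ord_recl /= expr0 mul1r /del take0 drop1 /= -sumrN.
by congr (_ + _); apply: eq_bigr => i _; rewrite /bump /= add1n exprS mulN1r mulNr.
Qed.

Lemma eq_altsum F F' vs : (forall u us, F u us = F' u us) ->
  altsum F vs = altsum F' vs.
Proof. by move=> e; apply: eq_bigr => i _; rewrite e. Qed.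

Lemma altsumD F F' vs :
  altsum (fun u us => F u us + F' u us) vs = altsum F vs + altsum F' vs.
Proof. by rewrite /altsum -big_split; apply: eq_bigr => i _; rewrite mulrDr. Qed.

Lemma altsumZ (k : R) F vs :
  altsum (fun u us => k * F u us) vs = k * altsum F vs.
Proof. by rewrite /altsum mulr_sumr; apply: eq_bigr => i _; rewrite mulrCA. Qed.

(** Two equal neighbours v, v give two terms that differ by their sign; the other
    terms vanish since F u is alternating. *)
Lemma altsum_alternating F :
  (forall (k : R) u v vs, F (k *: u + v) vs = k * F u vs + F v vs) ->
  (forall u, alternating_multilinear (F u)) -> alternating_multilinear (altsum F).
Proof.
move=> lin alt; apply: alternating_of_adjacent => [a b k u v|a c u].
  elim: a F lin alt => [|x a IH] F lin alt.
    rewrite !cat0s !altsum_cons lin.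
    rewrite (@eq_altsum _ (fun w us => k * F w (u :: us) + F w (v :: us))).
      by rewrite altsumD altsumZ; ring.
    by move=> w us; exact: ((alt w).1 [::]).
  rewrite !cat_cons !altsum_cons IH; last 2 first.
  - by move=> *; exact: lin.
  - by move=> w; exact: iprod_alternating.
  by rewrite (alt x).1; ring.
elim: a F lin alt => [|x a IH] F lin alt.
  rewrite cat0s !altsum_cons opprB addrCA subrr addr0 /altsum big1 // => i _.
  by rewrite ((alt _).2 [::] [::]) mulr0.
rewrite !cat_cons altsum_cons ((alt x).2 a [::]) IH ?subrr //.
by move=> w; exact: iprod_alternating.
Qed.

(** Derivative of f at zs in the directions dzs, one argument at a time. *)
Fixpoint vary f (zs dzs : seq V) : R^o :=
  match zs, dzs with
  | z :: zs', dz :: dzs' => f (dz :: zs') + vary (iprod z f) zs' dzs'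
  | _, _ => 0
  end.

End Exterior.

Section SecondOrder.
Variables (R : realType) (m n : nat).
Local Notation V := 'rV[R]_m.
Local Notation W := 'rV[R]_n.
Variables (A : V -> W) (B : V -> V -> W).

(** The varied argument in position i comes to the front through i transpositions,
    whence the sign. *)
Lemma vary_altsum (f : seq W -> R^o) v vs : alternating_multilinear f ->
  vary f (map A vs) (map (B v) vs) = altsum (fun u us => f (B v u :: map A us)) vs.
Proof.
elim: vs f => [|u vs IH] f hf; first by rewrite altsum_nil.
rewrite /= IH; last exact: iprod_alternating.
rewrite altsum_cons; congr (_ + _); rewrite -mulN1r -altsumZ.
by apply: eq_altsum => w us; rewrite mulN1r /iprod [LHS]alternating_swap.
Qed.

Hypothesis Bsym : forall u v, B u v = B v u.

(** With A and B the first and second derivatives of a map, these are the terms of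
    the exterior derivative of a pullback that contain B. The pairs (u, v) and
    (v, u) of directions have opposite signs. *)
Lemma altsum_vary0 (f : seq W -> R^o) vs : alternating_multilinear f ->
  altsum (fun u us => vary f (map A us) (map (B u) us)) vs = 0.
Proof.
elim: vs f => [|v vs IH] f hf; first by rewrite altsum_nil.
rewrite altsum_cons vary_altsum //= altsumD IH; last exact: iprod_alternating.
by rewrite addr0; apply/eqP; rewrite subr_eq0; apply/eqP/eq_altsum => w us; rewrite Bsym.
Qed.

End SecondOrder.

Section Precompose.
Variables (R : realType) (m n : nat).
Local Notation V := 'rV[R]_m.
Local Notation W := 'rV[R]_n.

Definition precomp (A : V -> W) (f : seq W -> R^o) : seq V -> R^o :=
  fun vs => f (map A vs).

Lemma precomp_wedge A f g :
  precomp A (cov_wedge f g) = cov_wedge (precomp A f) (precomp A g).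
Proof.
apply/funext => vs; elim: vs f g => [|v vs IH] f g; first by [].
rewrite /precomp /= -!/(precomp _ _ _) !IH; congr (_ + _).
congr (cov_wedge _ _ _); apply/funext => us.
by rewrite /precomp /grade size_map.
Qed.

Lemma precomp_alternating (A : V -> W) f : linear A ->
  alternating_multilinear f -> alternating_multilinear (precomp A f).
Proof.
move=> linA [lin alt]; split=> [a b k u v|a b c u]; rewrite /precomp !map_cat /=.
  by rewrite linA lin.
by rewrite map_cat alt.
Qed.

Lemma grade_precomp (A : V -> W) f : grade (precomp A f) = precomp A (grade f).
Proof. by apply/funext => vs; rewrite /grade /precomp size_map. Qed.

End Precompose.

(** Any shuffle that does not send vs to f and us to g feeds a zero vector to one
    of them, so that a single shuffle survives. *)
Lemma wedge_split (R : realType) (m n k : nat) (A : 'rV[R]_k -> 'rV[R]_m)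
    (B : 'rV[R]_k -> 'rV[R]_n) f g vs us :
  alternating_multilinear f -> alternating_multilinear g ->
  (forall v, v \in vs -> B v = 0) -> (forall u, u \in us -> A u = 0) ->
  cov_wedge (precomp A f) (precomp B g) (vs ++ us) = f (map A vs) * g (map B us).
Proof.
move=> hf hg hB hA; elim: vs f hf hB => [|v vs IH] f hf hB /=; last first.
  have -> : iprod v (precomp B g) = 0.
    apply/funext => ws; rewrite /iprod /precomp /= hB ?mem_head //.
    exact: (alternating0 [::]).
  rewrite cov_wedge0r addr0.
  have -> : iprod v (precomp A f) = precomp A (iprod (A v) f) by [].
  rewrite IH //; first exact: iprod_alternating.
  by move=> w hw; rewrite hB // in_cons hw orbT.
elim: us f hf g hg {hB} hA => [|u us IH] f hf g hg hA //=.
have -> : iprod u (precomp A f) = 0.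
  apply/funext => ws; rewrite /iprod /precomp /= hA ?mem_head //.
  exact: (alternating0 [::]).
rewrite cov_wedge0l add0r.
have -> : iprod u (precomp B g) = precomp B (iprod (B u) g) by [].
rewrite grade_precomp IH.
- by rewrite {1}/grade expr0 mul1r.
- exact: grade_alternating.
- exact: iprod_alternating.
- by move=> w hw; rewrite hA // in_cons hw orbT.
Qed.

(** A first position that is not selected makes an inversion with every selected
    one. *)
Lemma shuffle_inv_cons k (x : bool) (b : k.-tuple bool) :
  shuffle_inv [tuple of x :: b] = ((~~ x) * count id b + shuffle_inv b)%N.
Proof.
have E l (c : l.-tuple bool) : shuffle_inv c =
    (\sum_(i < l) \sum_(j < l) [&& (i < j)%N, ~~ tnth c i & tnth c j])%N.
  rewrite /shuffle_inv -sum1_card pair_bigA /= big_mkcond /=.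
  by apply: eq_bigr => p _; rewrite unfold_in asboolb; case: ifP.
rewrite !E big_ord_recl big_ord_recl /= add0n; congr (_ + _)%N.
  rewrite -sum1_count big_mkcond big_tuple big_distrr /= [RHS]big_mkcond /=.
  by apply: eq_bigr => j _; rewrite tnth0 tnthS; case: x; case: (tnth b j).
apply: eq_bigr => i _; rewrite big_ord_recl /= add0n; apply: eq_bigr => j _.
by rewrite !tnthS.
Qed.

Lemma big_tuple_recl (R : nmodType) k (F : k.+1.-tuple bool -> R) :
  \sum_b F b = \sum_(b : k.-tuple bool) F [tuple of true :: b] +
               \sum_(b : k.-tuple bool) F [tuple of false :: b].
Proof.
pose h (xb : bool * k.-tuple bool) := [tuple of xb.1 :: xb.2].
rewrite (reindex h) /=; last first.
  exists (fun t => (thead t, [tuple of behead t])) => [[x b] _|t _].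
    by congr pair; apply: val_inj.
  by rewrite /h /= -tuple_eta.
by rewrite -(pair_bigA _ (fun (x : bool) (b : k.-tuple bool) => F [tuple of x :: b])) big_bool.
Qed.

Lemma wedgeE (R : realType) n (M : charted R n) (w w' : dform M) p :
  wedge w w' p = cov_wedge (w p) (w' p).
Proof.
apply/funext => vs; rewrite /wedge.
elim: vs (w p) (w' p) => [|v vs IH] f g /=.
  rewrite (big_pred1 [tuple]) => [|b]; last exact/esym/eqP/tuple0.
  rewrite /shuffle_inv eq_card0 ?expr0 ?mul1r // => -[[]] //.
rewrite big_tuple_recl; congr (_ + _); rewrite -IH; apply: eq_bigr => b _.
  by rewrite shuffle_inv_cons.
rewrite shuffle_inv_cons mul1n /iprod /= exprD.
by rewrite /grade /iprod size_mask ?size_tuple // [X in X * _ * _]mulrC -!mulrA.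
Qed.

(** * Maps of class C^k *)

Section Germs.
Variables (R : realType) (V W : normedModType R).
Implicit Types (f g : V -> W) (x v : V) (O : set V).

Lemma near_eq_diff f g x : (\forall y \near x, f y = g y) ->
  differentiable f x -> 'd g x = 'd f x :> (V -> W) /\ differentiable g x.
Proof.
move=> fg df.
have fgx : f x = g x := nbhs_singleton fg.
have e : g \o shift x = cst (g x) + 'd f x +o_ 0 id.
  apply/eqaddoP => eps eps0.
  have /eqaddoP/(_ eps eps0) := diff_locally df.
  have fg0 : \forall y \near (0 : V), f (y + x) = g (y + x).
    by move: fg; rewrite [in X in X -> _](near_shift 0 x) /= subr0; apply.
  move=> H; near=> y.
  have <- : (f \o shift x - (cst (f x) + 'd f x)) y =
            (g \o shift x - (cst (g x) + 'd f x)) y.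
    rewrite !fctE /= fgx; congr (_ - _); near: y; exact: fg0.
  by near: y; exact: H.
have dge : ('d g x : V -> W) = 'd f x.
  by apply: diff_unique e; exact: diff_continuous.
split => //; apply/diff_locallyP; rewrite dge; split => //.
exact: diff_continuous.
Unshelve. all: by end_near. Qed.

Lemma open_near O (P : V -> Prop) x : open O -> O x ->
  (forall y, O y -> P y) -> \forall y \near x, P y.
Proof. by move=> oO Ox H; apply: filterS (open_nbhs_nbhs (conj oO Ox)). Qed.

Lemma open_eq_diff O f g x : open O -> O x -> (forall y, O y -> f y = g y) ->
  differentiable f x -> 'd g x = 'd f x :> (V -> W) /\ differentiable g x.
Proof. by move=> oO Ox e; apply/near_eq_diff/(open_near oO Ox). Qed.

Lemma open_eq_diffv O f g x v : open O -> O x -> (forall y, O y -> f y = g y) ->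
  differentiable f x -> 'd g x v = 'd f x v.
Proof. by move=> oO Ox e df; have [-> _] := open_eq_diff oO Ox e df. Qed.

Lemma open_eq_derive O f g x v : open O -> O x ->
  (forall y, O y -> f y = g y) -> 'D_v f x = 'D_v g x.
Proof. by move=> oO Ox e; apply/near_eq_derive/(open_near oO Ox). Qed.

Lemma Ck_local k O f : (forall x, O x -> exists Q,
  [/\ Q x, open Q & Ck k Q f]) -> Ck k O f.
Proof.
elim: k f => [|k IH] f H /=.
  by move=> x /H [Q [Qx _ h]]; exact: h.
split=> [x Ox|v]; first by have [Q [Qx _ [h _]]] := H x Ox; exact: h.
apply: IH => x Ox; have [Q [Qx oQ [_ h]]] := H x Ox; by exists Q; split=> //; exact: h.
Qed.

Lemma Ck_sub k O Q f : Q `<=` O -> Ck k O f -> Ck k Q f.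
Proof.
move=> s; elim: k f => [|k IH] f /=; first by move=> h x /s; exact: h.
by move=> [h1 h2]; split=> [x /s|v]; [exact: h1|exact: IH].
Qed.

Lemma Ck_continuous k O f x : Ck k O f -> O x -> {for x, continuous f}.
Proof.
by case: k => [|k] /=; [exact|move=> [h _] /h /differentiable_continuous].
Qed.

Lemma CkS k O f : Ck k.+1 O f -> Ck k O f.
Proof.
elim: k f => [|k IH] f; first by move=> h x; exact: Ck_continuous h.
by move=> [h1 h2]; split=> // v; exact: IH.
Qed.

Lemma Ck_congr k O f g : open O -> (forall x, O x -> f x = g x) ->
  Ck k O f -> Ck k O g.
Proof.
move=> oO; elim: k f g => [|k IH] f g e /=.
  move=> h x Ox; have := h x Ox; rewrite /prop_for /continuous_at -(e x Ox) => hx.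
  by apply: cvg_trans hx; apply: near_eq_cvg; exact: (open_near oO Ox).
move=> [h1 h2]; split=> [x Ox|v].
  by have [] := open_eq_diff oO Ox e (h1 x Ox).
by apply: IH (h2 v) => x Ox; exact: open_eq_derive e.
Qed.

Lemma Ck_cst k O (c : W) : Ck k O (fun=> c).
Proof.
elim: k c => [|k IH] c /=; first by move=> x _; exact: cst_continuous.
split=> [x _|v]; first exact: differentiable_cst.
have -> : (fun x => 'D_v (fun=> c) x) = (fun=> 0 : W) by apply/funext=> x; exact: derive_cst.
exact: IH.
Qed.

Lemma CkD k O f g : open O -> Ck k O f -> Ck k O g -> Ck k O (f + g).
Proof.
move=> oO; elim: k f g => [|k IH] f g /=.
  by move=> hf hg x Ox; apply: continuousD; [exact: hf|exact: hg].
move=> [hf1 hf2] [hg1 hg2]; split=> [x Ox|v].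
  by apply: differentiableD; [exact: hf1|exact: hg1].
apply: Ck_congr (IH _ _ (hf2 v) (hg2 v)) => // x Ox.
by rewrite deriveD //; apply: diff_derivable; [exact: hf1|exact: hg1].
Qed.

Lemma Ck_sum k O (I : finType) (f : I -> V -> W) : open O ->
  (forall i, Ck k O (f i)) -> Ck k O (fun x => \sum_i f i x).
Proof.
move=> oO h; have -> : (fun x => \sum_i f i x) = \sum_i f i.
  by apply/funext => x; rewrite fct_sumE.
elim/big_ind: _ => //; first exact: Ck_cst.
by move=> a b; exact: CkD.
Qed.

Lemma Ck_lin k O (f : {linear V -> W}) : continuous f -> Ck k O f.
Proof.
move=> cf; case: k => [|k]; first by move=> x _; exact: cf.
split=> [x _|v]; first exact: linear_differentiable.
have -> : (fun x => 'D_v f x) = (fun=> f v); last exact: Ck_cst.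
apply/funext => x; rewrite deriveE ?diff_lin //.
exact: linear_differentiable.
Qed.

Lemma smooth_onP O f : smooth_on O f -> forall v, smooth_on O (fun x => 'D_v f x).
Proof. by move=> h v k; case: (h k.+1) => _; exact. Qed.

Lemma smooth_diff O f x : smooth_on O f -> O x -> differentiable f x.
Proof. by move=> h Ox; case: (h 1%N) => + _; exact. Qed.

End Germs.

Section Products.
Variables (R : realType) (V W : normedModType R).
Implicit Types (x v : V) (O : set V).

Lemma derive_mul (u w : V -> R^o) x v : differentiable u x -> differentiable w x ->
  differentiable (fun y => u y * w y : R^o) x /\
  'D_v (fun y => u y * w y : R^o) x = 'D_v u x * w x + u x * 'D_v w x.
Proof.
move=> du dw; split; first exact: (@differentiableM _ _ u w).
rewrite (@deriveM _ _ u w); [|exact: diff_derivable..].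
by rewrite addrC; congr (_ + _); exact: mulrC.
Qed.

Lemma CkM k O (u w : V -> R^o) : open O -> Ck k O u -> Ck k O w ->
  Ck k O (fun x => u x * w x : R^o).
Proof.
move=> oO; elim: k u w => [|k IH] u w.
  by move=> hu hw x Ox; apply: (@continuousM R V u w); [exact: hu|exact: hw].
move=> hu hw; have [hu1 hu2] := hu; have [hw1 hw2] := hw; split=> [x Ox|v].
  by apply: (@differentiableM _ _ u w); [exact: hu1|exact: hw1].
apply: Ck_congr (CkD oO (IH _ _ (CkS hu) (hw2 v)) (IH _ _ (CkS hw) (hu2 v))) => // x Ox.
rewrite (@deriveM _ _ u w) //; apply: diff_derivable; [exact: hu1|exact: hw1].
Qed.

Lemma Ck_scalev k O (u : V -> R^o) (w : W) : open O -> Ck k O u ->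
  Ck k O (fun x => u x *: w).
Proof.
move=> oO; elim: k u => [|k IH] u.
  by move=> hu x Ox; apply: continuousZr_tmp; exact: hu.
move=> [hu1 hu2]; split=> [x Ox|v].
  exact/differentiableZl/hu1.
apply: Ck_congr (IH _ (hu2 v)) => // x Ox.
rewrite !deriveE; [|exact/differentiableZl/hu1|exact: hu1].
by rewrite diffZl //; exact: hu1.
Qed.

End Products.

Section Composition.
Variable R : realType.

Lemma Ck_linl (V W Z : normedModType R) k (O : set V) (L : {linear W -> Z}) (f : V -> W) :
  continuous L -> open O -> Ck k O f -> Ck k O (fun x => L (f x)).
Proof.
move=> cL oO; elim: k f => [|k IH] f.
  by move=> hf x Ox; apply: continuous_comp; [exact: hf|exact: cL].
move=> [hf1 hf2]; have dL y : differentiable L y by exact: linear_differentiable.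
split=> [x Ox|v].
  by apply: (@differentiable_comp _ _ _ _ f L) => //; exact: hf1.
apply: Ck_congr (IH _ (hf2 v)) => // x Ox.
have df := hf1 x Ox.
have dLf : differentiable (L \o f) x by exact: differentiable_comp.
by rewrite -[fun _ => L _]/(L \o f) !deriveE // (diff_comp df (dL _)) /= diff_lin.
Qed.

Definition entry a b (i : 'I_a) (j : 'I_b) (M : 'M[R]_(a, b)) : R^o := M i j.

Lemma entry_linear a b i j : linear (@entry a b i j).
Proof. by move=> k M N; rewrite /entry !mxE. Qed.
HB.instance Definition _ a b i j :=
  GRing.isLinear.Build R _ _ _ _ (@entry_linear a b i j).

Lemma Ck_mxP (V : normedModType R) k (O : set V) a b (f : V -> 'M[R]_(a, b)) :
  open O -> Ck k O f <-> forall i j, Ck k O (fun x => f x i j : R^o).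
Proof.
move=> oO; split=> [hf i j|hf].
  exact: (Ck_linl (L := entry i j) (@coord_continuous _ _ _ i j) oO hf).
have -> : f = fun x => \sum_ij entry ij.1 ij.2 (f x) *: delta_mx ij.1 ij.2.
  by apply/funext => x; rewrite [LHS]matrix_sum_delta pair_bigA.
apply: Ck_sum => // ij.
apply: (Ck_scalev (u := fun x => f x ij.1 ij.2) _ oO); exact: hf.
Qed.

Lemma smooth_mxP (V : normedModType R) (O : set V) a b (f : V -> 'M[R]_(a, b)) :
  open O -> smooth_on O f <-> forall i j, smooth_on O (fun x => f x i j : R^o).
Proof.
move=> oO; split=> [h i j k|h k]; first exact: ((Ck_mxP _ _ oO).1 (h k) i j).
by apply: (Ck_mxP _ _ oO).2 => i j; exact: h.
Qed.

Lemma rV_linear_continuous m (W : normedModType R) (f : {linear 'rV[R]_m -> W}) :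
  continuous f.
Proof.
have -> : (f : _ -> _) = fun x => \sum_j entry 0 j x *: f (delta_mx 0 j).
  apply/funext => x; rewrite {1}(row_sum_delta x) linear_sum.
  by apply: eq_bigr => j _; rewrite linearZ.
have : Ck 0 setT (fun x : 'rV[R]_m => \sum_j entry 0 j x *: f (delta_mx 0 j)).
  apply: Ck_sum => [|j]; first exact: openT.
  by apply: (Ck_scalev _ openT) => x _; exact: coord_continuous.
by move=> h x; exact: h.
Qed.

Lemma diff_rV_sum m (W : normedModType R) (f : 'rV[R]_m -> W) x v :
  'd f x v = \sum_j v 0 j *: 'd f x (delta_mx 0 j).
Proof.
rewrite {1}(row_sum_delta v) linear_sum.
by apply: eq_bigr => j _; rewrite linearZ.
Qed.

Lemma derive_rV_comp (V : normedModType R) n (W : normedModType R)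
    (g : V -> 'rV[R]_n) (f : 'rV[R]_n -> W) x v :
  differentiable g x -> differentiable f (g x) ->
  'D_v (f \o g) x = \sum_j ('D_v g x) 0 j *: 'D_(delta_mx 0 j) f (g x).
Proof.
move=> dg df; rewrite !deriveE //; last exact: differentiable_comp.
rewrite diff_comp //= diff_rV_sum; apply: eq_bigr => j _.
by rewrite deriveE.
Qed.

(** The chain rule is written along a basis of the target of g, so that the
    derivatives of f are taken in fixed directions and the induction hypothesis
    applies to them. *)
Lemma Ck_comp (V : normedModType R) n k (O : set V)
    (Q : set 'rV[R]_n) (g : V -> 'rV[R]_n) (f : 'rV[R]_n -> R^o) :
  open O -> open Q -> (forall x, O x -> Q (g x)) ->
  Ck k O g -> Ck k Q f -> Ck k O (f \o g).
Proof.
move=> oO oQ OQ; elim: k g f OQ => [|k IH] g f OQ.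
  by move=> hg hf x Ox; apply: continuous_comp; [exact: hg|apply/hf/OQ].
move=> hg hf; have [hg1 hg2] := hg; have [hf1 hf2] := hf; split=> [x Ox|v].
  by apply: differentiable_comp; [exact: hg1|apply/hf1/OQ].
apply: (@Ck_congr _ _ _ _ _
  (fun x => \sum_j ('D_v g x) 0 j * 'D_(delta_mx 0 j) f (g x))) => //.
  by move=> x Ox; rewrite derive_rV_comp //; [exact: hg1|apply/hf1/OQ].
apply: Ck_sum => // j; apply: CkM => //.
  exact: ((Ck_mxP _ _ oO).1 (hg2 v)).
exact: (IH g ('D_(delta_mx 0 j) f) OQ (CkS hg) (hf2 _)).
Qed.

Lemma smooth_comp (V : normedModType R) n (O : set V) a b
    (Q : set 'rV[R]_n) (g : V -> 'rV[R]_n) (f : 'rV[R]_n -> 'M[R]_(a, b)) :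
  open O -> open Q -> (forall x, O x -> Q (g x)) ->
  smooth_on O g -> smooth_on Q f -> smooth_on O (f \o g).
Proof.
move=> oO oQ OQ hg hf; apply/smooth_mxP => // i j k.
exact: (Ck_comp oO oQ OQ (hg k) ((smooth_mxP _ oQ).1 hf i j k)).
Qed.

Lemma smooth_comp1 (V : normedModType R) n (O : set V)
    (Q : set 'rV[R]_n) (g : V -> 'rV[R]_n) (f : 'rV[R]_n -> R^o) :
  open O -> open Q -> (forall x, O x -> Q (g x)) ->
  smooth_on O g -> smooth_on Q f -> smooth_on O (f \o g).
Proof. by move=> oO oQ OQ hg hf k; exact: (Ck_comp oO oQ OQ (hg k) (hf k)). Qed.

End Composition.

(** * Symmetry of second derivatives *)

Section Schwarz.
Variables (R : realType) (V : normedModType R).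
Implicit Types (f g F G : V -> R^o) (x y u v w : V) (O : set V).

Lemma mean_value_line g y w (h : R) : 0 < h ->
  (forall c, 0 <= c <= h -> differentiable g (y + c *: w)) ->
  exists2 c, 0 <= c <= h & g (y + h *: w) - g y = h * 'D_w g (y + c *: w).
Proof.
move=> h0 dg; pose a (c : R^o) : V := y + c *: w.
have da (c : R^o) : is_diff c a (fun t : R^o => t *: w).
  have -> : (fun t : R^o => t *: w) = 0 + (fun t : R^o => t *: w) by rewrite add0r.
  by apply: is_diffD.
have dga (c : R) : 0 <= c <= h -> is_derive (c : R^o) 1 (g \o a) ('D_w g (a c)).
  move=> /dg dgc; have da' := @ex_diff _ _ _ _ _ _ _ (da c).
  have dc : differentiable (g \o a) (c : R^o) by exact: differentiable_comp.
  apply: DeriveDef; first exact: diff_derivable.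
  rewrite deriveE // (diff_comp da' dgc) /= (@diff_val _ _ _ _ _ _ _ (da c)).
  by rewrite scale1r deriveE.
have [c||c hc e] := @MVT R (g \o a) (fun c => 'D_w g (a c)) 0 h h0.
- by rewrite in_itv /= => /andP[c0 ch]; apply: dga; rewrite !ltW.
- apply: derivable_within_continuous => c; rewrite in_itv /= => hc.
  by have [] := dga c hc.
- exists c; first by move: hc; rewrite in_itv /= => /andP[c0 ch]; rewrite !ltW.
  by move: e; rewrite /= /a scale0r addr0 subr0 mulrC.
Qed.

Lemma derive_translate f c u y : 'D_u (fun z => f (z + c)) y = 'D_u f (y + c).
Proof.
rewrite /derive; set p := fun h : R => _; set q := fun h : R => _.
suff -> : p = q by [].
by apply/funext => h; rewrite /p /q /= addrA.
Qed.

(** The mean value theorem is applied twice: to the difference of f in the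
    direction v along u, then to D_u f along v. *)
Lemma second_difference O f x u v (h : R) : 0 < h -> Ck 2 O f ->
  (forall a b, 0 <= a <= h -> 0 <= b <= h -> O (x + a *: u + b *: v)) ->
  exists a b, [/\ 0 <= a <= h, 0 <= b <= h &
    f (x + h *: u + h *: v) - f (x + h *: u) - f (x + h *: v) + f x =
    h * (h * 'D_v (fun z => 'D_u f z) (x + a *: u + b *: v))].
Proof.
move=> h0 [df1 df2] hO.
have hh : 0 <= h <= h by rewrite ltW //=.
have h00 : 0 <= (0 : R) <= h by rewrite lexx ltW.
pose g z := f (z + h *: v) - f z.
have dO a : 0 <= a <= h -> O (x + a *: u) /\ O (x + a *: u + h *: v).
  by move=> ha; split; [have := hO a 0 ha h00; rewrite scale0r addr0|exact: hO].
have dsh z : O (z + h *: v) -> differentiable (fun z => f (z + h *: v)) z.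
  move=> Oz; apply: (@differentiable_comp _ _ _ _ (fun z => z + h *: v) f).
    exact: differentiableD.
  exact: df1.
have [|a ha e] := @mean_value_line g x u h h0.
  move=> c /dO[Oc Och]; apply: (@differentiableB _ _ _ (fun z => f (z + h *: v)) f).
    exact: dsh.
  exact: df1.
have [Oa Oah] := dO a ha.
have [|b hb e'] := @mean_value_line (fun z => 'D_u f z) (x + a *: u) v h h0.
  by move=> c hc; apply: (df2 u).1; exact: hO.
exists a, b; split=> //; rewrite -e' -derive_translate.
have -> : 'D_u (fun z => f (z + h *: v)) (x + a *: u) - 'D_u f (x + a *: u) =
    'D_u g (x + a *: u).
  rewrite -[RHS]/('D_u ((fun z => f (z + h *: v)) - f) _) deriveB //.
    exact/diff_derivable/dsh.
  exact/diff_derivable/df1.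
rewrite -e /g; ring.
Qed.

Lemma close_pair O F G x (e : R) : open O -> O x -> 0 < e ->
  {for x, continuous F} -> {for x, continuous G} ->
  exists2 r : R, 0 < r & forall y, `|x - y| < r ->
    [/\ O y, `|F x - F y| < e & `|G x - G y| < e].
Proof.
move=> oO Ox e0 cF cG.
have n1 : \forall y \near x, O y by exact: open_nbhs_nbhs.
have n2 : \forall y \near x, `|F x - F y| < e by move/cvgrPdist_lt: cF; exact.
have n3 : \forall y \near x, `|G x - G y| < e by move/cvgrPdist_lt: cG; exact.
have n123 : nbhs x (fun y => [/\ O y, `|F x - F y| < e & `|G x - G y| < e]).
  by apply: filterS3 n1 n2 n3 => y; split.
move/nbhs_normP: n123 => [r r0 hr].
by exists r => // y xy; exact: hr.
Qed.

Lemma dist_le_half (a b c e : R) :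
  `|a - c| < e / 2 -> `|b - c| < e / 2 -> `|a - b| <= e.
Proof.
move=> ac bc; apply: le_trans (ler_distD c _ _) _.
by rewrite (distrC c) (splitr e) lerD // ltW.
Qed.

(** Both mixed derivatives, at suitable points of a small square, equal the same
    second difference divided by h^2; they are continuous. *)
Theorem schwarz O f x u v : open O -> Ck 2 O f -> O x ->
  'D_v (fun z => 'D_u f z) x = 'D_u (fun z => 'D_v f z) x.
Proof.
move=> oO hf Ox; apply/eqP; rewrite -subr_eq0 -normr_le0; apply/ler_addgt0Pl => e e0.
rewrite addr0.
have e2 : 0 < e / 2 by rewrite divr_gt0.
set F := fun z => 'D_v (fun z => 'D_u f z) z.
set G := fun z => 'D_u (fun z => 'D_v f z) z.
have [r r0 hr] := close_pair oO Ox e2 ((hf.2 u).2 v x Ox) ((hf.2 v).2 u x Ox).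
(* The square with sides h u and h v at x lies in the ball of radius r. *)
pose h := r / (2 * (`|u| + `|v| + 1)).
have n0 : 0 < `|u| + `|v| + 1 by rewrite ltr_wpDl // addr_ge0.
have h0 : 0 < h by rewrite divr_gt0 // mulr_gt0.
have close a b : 0 <= a <= h -> 0 <= b <= h -> `|x - (x + a *: u + b *: v)| < r.
  move=> /andP[a0 ah] /andP[b0 bh]; rewrite -addrA opprD addNKr normrN.
  apply: (@le_lt_trans _ _ (h * (`|u| + `|v| + 1))).
    apply: le_trans (ler_normD _ _) _; rewrite !normrZ !ger0_norm //.
    rewrite !mulrDr mulr1 -[leLHS]addr0; apply: lerD; last exact: ltW.
    by apply: lerD; apply: ler_wpM2r.
  by rewrite /h; have -> : r / (2 * (`|u| + `|v| + 1)) * (`|u| + `|v| + 1) = r / 2;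
    [field; rewrite gt_eqF|lra].
have hO a b : 0 <= a <= h -> 0 <= b <= h -> O (x + a *: u + b *: v).
  by move=> ha hb; have [] := hr _ (close a b ha hb).
have hO' a b : 0 <= a <= h -> 0 <= b <= h -> O (x + a *: v + b *: u).
  by move=> ha hb; rewrite addrAC; exact: hO.
have [a [b [ha hb E]]] := second_difference h0 hf hO.
have [b' [a' [hb' ha' E']]] := second_difference h0 hf hO'.
have FG : F (x + a *: u + b *: v) = G (x + b' *: v + a' *: u).
  apply: (mulfI (lt0r_neq0 h0)); apply: (mulfI (lt0r_neq0 h0)).
  rewrite -[LHS]E -[RHS]E' (addrAC x (h *: v)); ring.
have [_ Fc _] := hr _ (close a b ha hb); rewrite -/(F _) -/(F x) in Fc.
have [_ _] := hr _ (close a' b' ha' hb'); rewrite -/(G x) -/(G _) => Gc.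
move: Gc; rewrite (addrAC x (a' *: u)) -FG => Gc.
exact (dist_le_half Fc Gc).
Qed.

End Schwarz.

(** * The exterior derivative on a vector space *)

Section FamiliesOfForms.
Variables (R : realType) (V : normedModType R) (n : nat).
Local Notation W := 'rV[R]_n.
Implicit Types (om : W -> seq W -> R^o) (F : V -> W) (x v : V).

Lemma multilinear_basis (f : seq W -> R^o) w ws : alternating_multilinear f ->
  f (w :: ws) = \sum_j w 0 j * f (delta_mx 0 j :: ws).
Proof.
move=> [lin alt].
have f0 : f (0 :: ws) = 0 by exact: (alternating0 [::] ws (conj lin alt)).
rewrite {1}(row_sum_delta w).
elim: (index_enum _) => [|j s IH]; first by rewrite !big_nil.
by rewrite !big_cons (lin [::]) /= IH.
Qed.

Lemma differentiable_entry a b (f : V -> 'M[R]_(a, b)) i j x :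
  differentiable f x -> differentiable (fun y => f y i j : R^o) x.
Proof.
move=> df; have -> : (fun y => f y i j : R^o) = entry i j \o f by [].
apply: differentiable_comp => //.
exact/linear_differentiable/coord_continuous.
Qed.

Lemma derive_sumM (Z : normedModType R) (I : finType) (c g : I -> Z -> R^o) (x v : Z) :
  (forall i, differentiable (c i) x) -> (forall i, differentiable (g i) x) ->
  differentiable (fun y => \sum_i c i y * g i y : R^o) x /\
  'D_v (fun y => \sum_i c i y * g i y : R^o) x =
  \sum_i ('D_v (c i) x * g i x + c i x * 'D_v (g i) x).
Proof.
move=> dc dg.
suff H (s : seq I) : differentiable (fun y => \sum_(i <- s) c i y * g i y : R^o) x /\
  'D_v (fun y => \sum_(i <- s) c i y * g i y : R^o) x =
  \sum_(i <- s) ('D_v (c i) x * g i x + c i x * 'D_v (g i) x) by exact: H.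
elim: s => [|i s [IH1 IH2]].
  under eq_fun do rewrite big_nil.
  by rewrite big_nil; split; [exact: differentiable_cst|exact: derive_cst].
under eq_fun do rewrite big_cons.
have [dm e] := derive_mul v (dc i) (dg i).
split; first exact: (differentiableD dm).
by rewrite big_cons -IH2 -e; apply: deriveD; exact: diff_derivable.
Qed.

Lemma vary_sum (I : finType) (c : I -> R) (f : I -> seq W -> R^o) zs dzs :
  vary (fun ws => \sum_i c i * f i ws) zs dzs = \sum_i c i * vary (f i) zs dzs.
Proof.
have z0 : 0 = \sum_i c i * (0 : R) by rewrite big1 // => i _; rewrite mulr0.
elim: zs dzs f => [|z zs IH] [|dz dzs] f //=.
under [RHS]eq_bigr do rewrite mulrDr.
by rewrite big_split /= -IH.
Qed.

(** A multilinear family is expanded along a basis in its first argument, which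
    turns the derivative of its value on moving vectors into that of a product. *)
Lemma derive_moving (U : Type) om F (L : U -> V -> W) x v us :
  (forall z, alternating_multilinear (om z)) ->
  (forall ws, differentiable (fun z => om z ws) (F x)) ->
  differentiable F x -> (forall u, differentiable (L u) x) ->
  differentiable (fun y => om (F y) [seq L u y | u <- us]) x /\
  'D_v (fun y => om (F y) [seq L u y | u <- us]) x =
  'D_('D_v F x) (fun z => om z [seq L u x | u <- us]) (F x) +
  vary (om (F x)) [seq L u x | u <- us] [seq 'D_v (L u) x | u <- us].
Proof.
move=> alt dom dF dL; elim: us om alt dom => [|u us IH] om alt dom /=.
  have dc : differentiable ((fun z => om z [::]) \o F) x by apply: differentiable_comp.
  split; first exact: dc.
  rewrite addr0 -[fun y => _]/((fun z => om z [::]) \o F).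
  rewrite deriveE // (diff_comp dF (dom [::])) /=.
  by rewrite -!deriveE.
pose om' j z := iprod (delta_mx 0 j) (om z).
have IHj j := IH (om' j) (fun z => iprod_alternating _ (alt z)) (fun ws => dom _).
have dLj j : differentiable (fun y => L u y 0 j : R^o) x.
  exact: differentiable_entry.
have -> : (fun y => om (F y) (L u y :: [seq L u y | u <- us])) =
    (fun y => \sum_j L u y 0 j * om' j (F y) [seq L u y | u <- us] : R^o).
  by apply/funext => y; rewrite multilinear_basis.
have [d1 d2] := derive_sumM v dLj (fun j => (IHj j).1).
split=> //; rewrite d2 big_split /=.
have -> : (fun z => om z (L u x :: [seq L u x | u <- us])) =
    (fun z => \sum_j L u x 0 j * om' j z [seq L u x | u <- us] : R^o).
  by apply/funext => z; rewrite multilinear_basis.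
have [_ ->] := derive_sumM ('D_v F x) (fun j => differentiable_cst (L u x 0 j : R^o) (F x))
  (fun j => dom (delta_mx 0 j :: [seq L u x | u <- us])).
have -> : iprod (L u x) (om (F x)) = (fun ws => \sum_j L u x 0 j * om' j (F x) ws).
  by apply/funext => ws; rewrite /iprod multilinear_basis.
rewrite vary_sum [RHS]addrCA multilinear_basis //; congr (_ + _).
  apply: eq_bigr => j _; congr (_ * _).
  by rewrite derive_mx ?mxE //; exact: diff_derivable.
rewrite -big_split; apply: eq_bigr => j _.
by rewrite (IHj j).2 derive_cst mul0r add0r mulrDr.
Qed.

Lemma smooth_moving (U : Type) om F (L : U -> V -> W) (O : set V) (Q : set W) us :
  (forall z, alternating_multilinear (om z)) ->
  open O -> open Q -> (forall x, O x -> Q (F x)) ->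
  (forall ws, smooth_on Q (fun z => om z ws)) ->
  smooth_on O F -> (forall u, smooth_on O (L u)) ->
  smooth_on O (fun y => om (F y) [seq L u y | u <- us]).
Proof.
move=> alt oO oQ OQ hom hF hL; elim: us om alt hom => [|u us IH] om alt hom /=.
  exact: (smooth_comp1 (f := fun z => om z [::]) oO oQ OQ hF (hom [::])).
have -> : (fun y => om (F y) (L u y :: [seq L u y | u <- us])) =
    (fun y => \sum_j L u y 0 j * iprod (delta_mx 0 j) (om (F y)) [seq L u y | u <- us] : R^o).
  by apply/funext => y; rewrite multilinear_basis.
move=> k; apply: Ck_sum => // j; apply: CkM => //.
  exact: ((Ck_mxP _ _ oO).1 (hL u k)).
apply: (IH (fun z => iprod (delta_mx 0 j) (om z))) => [z|ws].
  exact: iprod_alternating.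
exact: hom.
Qed.

End FamiliesOfForms.

Section EuclideanDerivative.
Variable R : realType.

(** Exterior derivative at x, by the formula with constant vector fields. *)
Definition euclid_d n (om : 'rV[R]_n -> seq 'rV[R]_n -> R^o) x : seq 'rV[R]_n -> R^o :=
  altsum (fun v vs => 'D_v (fun y => om y vs) x).

Lemma altsum_map m n (A : 'rV[R]_m -> 'rV[R]_n) (F : 'rV[R]_n -> seq 'rV[R]_n -> R^o) us :
  altsum F (map A us) = altsum (fun v vs => F (A v) (map A vs)) us.
Proof.
elim: us F => [|u us IH] F; first by rewrite !altsum_nil.
by rewrite /= !altsum_cons IH.
Qed.

(** The vectors to which om is applied move with the point, so that the chain rule
    gives, besides the derivative of om, terms with the second derivative of F.
    They cancel by its symmetry. *)
Lemma euclid_d_pull m n (om : 'rV[R]_n -> seq 'rV[R]_n -> R^o) (F : 'rV[R]_m -> 'rV[R]_n)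
    (O : set 'rV[R]_m) x us :
  (forall z, alternating_multilinear (om z)) ->
  (forall ws, differentiable (fun z => om z ws) (F x)) ->
  open O -> O x -> smooth_on O F ->
  euclid_d (fun y vs => om (F y) [seq 'd F y v | v <- vs]) x us =
  euclid_d om (F x) [seq 'd F x u | u <- us].
Proof.
move=> alt dom oO Ox hF.
have dF y : O y -> differentiable F y by exact: smooth_diff.
have [B BE] : exists B : 'rV[R]_m -> 'rV[R]_m -> 'rV[R]_n,
    forall v u, 'D_v (fun y => 'D_u F y) x = B v u.
  by exists (fun v u => 'D_v (fun y => 'D_u F y) x).
have Bsym u v : B u v = B v u.
  have h v' u' j : B v' u' 0 j = 'D_v' (fun y => 'D_u' (fun y => F y 0 j : R^o) y) x.
    rewrite -BE derive_mx; last first.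
      by apply/diff_derivable/(smooth_diff (smooth_onP hF u')).
    rewrite mxE; apply: (open_eq_derive _ oO Ox) => y Oy.
    by rewrite derive_mx ?mxE //; exact/diff_derivable/dF.
  apply/rowP => j; rewrite (h u v) (h v u).
  have hFj : Ck 2 O (fun y => F y 0 j : R^o) by exact: ((Ck_mxP _ _ oO).1 (hF 2%N)).
  exact: (schwarz _ _ oO hFj Ox).
rewrite /euclid_d altsum_map.
transitivity (altsum (fun v vs =>
  'D_('d F x v) (fun z => om z [seq 'd F x u | u <- vs]) (F x) +
  vary (om (F x)) [seq 'd F x u | u <- vs] [seq B v u | u <- vs]) us).
  apply: eq_altsum => v vs.
  rewrite (@open_eq_derive _ _ _ O _
    (fun y => om (F y) [seq (fun u y => 'D_u F y) u y | u <- vs])) //; last first.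
    move=> y Oy; congr (om _ _); apply: eq_map => u.
    by rewrite deriveE //; exact: dF.
  have dDF u : differentiable (fun y => 'D_u F y) x.
    exact: (smooth_diff (smooth_onP hF u)).
  rewrite (derive_moving v vs alt dom (dF x Ox) dDF).2.
  have -> : [seq 'D_u F x | u <- vs] = [seq 'd F x u | u <- vs].
    by apply: eq_map => u; rewrite deriveE //; exact: dF.
  have -> : [seq 'D_v (fun y => 'D_u F y) x | u <- vs] = [seq B v u | u <- vs].
    by apply: eq_map => u; exact: BE.
  by rewrite (deriveE _ (dF x Ox)).
rewrite altsumD altsum_vary0 ?addr0 //.
Qed.

Variable n : nat.
Local Notation V := 'rV[R]_n.
Implicit Types (a b : V -> seq V -> R^o) (O : set V) (x v : V) (vs : seq V).

Lemma smooth_wedge O a b : open O -> (forall vs, smooth_on O (fun y => a y vs)) ->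
  (forall vs, smooth_on O (fun y => b y vs)) ->
  forall vs, smooth_on O (fun y => cov_wedge (a y) (b y) vs).
Proof.
move=> oO ha hb vs; elim: vs a b ha hb => [|v vs IH] a b ha hb k /=.
  by apply: CkM => //; [exact: ha|exact: hb].
apply: (CkD oO); apply: IH => //.
- by move=> us; exact: ha.
- move=> us l; apply: (CkM oO); [exact: Ck_cst|exact: ha].
- by move=> us; exact: hb.
Qed.

Lemma derive_wedge a b x v vs : (forall vs, differentiable (fun y => a y vs) x) ->
  (forall vs, differentiable (fun y => b y vs) x) ->
  differentiable (fun y => cov_wedge (a y) (b y) vs) x /\
  'D_v (fun y => cov_wedge (a y) (b y) vs) x =
  cov_wedge (fun vs => 'D_v (fun y => a y vs) x) (b x) vs +
  cov_wedge (a x) (fun vs => 'D_v (fun y => b y vs) x) vs.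
Proof.
elim: vs a b => [|u vs IH] a b da db /=.
  exact: (derive_mul v (da [::]) (db [::])).
have dg us : differentiable (fun y => grade (a y) us) x.
  by apply: (@differentiableZ _ _ _ (fun y => a y us)).
have [d1 e1] := IH (fun y => iprod u (a y)) b (fun us => da _) db.
have [d2 e2] := IH (fun y => grade (a y)) (fun y => iprod u (b y)) dg (fun us => db _).
split; first by apply: (@differentiableD _ _ _ _ _ x d1 d2).
rewrite -[LHS]/('D_v ((fun y => cov_wedge (iprod u (a y)) (b y) vs) +
  (fun y => cov_wedge (grade (a y)) (iprod u (b y)) vs)) x).
rewrite deriveD; [|exact: diff_derivable..].
rewrite e1 e2 addrACA; congr (_ + _ + _).
congr (cov_wedge _ _ _); apply/funext => us.
by rewrite /grade (@deriveZ _ _ _ (fun y => a y us)) //; exact: diff_derivable.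
Qed.

Lemma euclid_d_cons a x v vs : euclid_d a x (v :: vs) =
  'D_v (fun y => a y vs) x - euclid_d (fun y => iprod v (a y)) x vs.
Proof. by rewrite /euclid_d altsum_cons. Qed.

(** Cartan's formula for a constant vector field. *)
Lemma iprod_euclid_d a x v : iprod v (euclid_d a x) =
  (fun vs => 'D_v (fun y => a y vs) x) - euclid_d (fun y => iprod v (a y)) x.
Proof. by apply/funext => vs; rewrite /iprod euclid_d_cons. Qed.

Lemma euclid_dD a b x : (forall vs, differentiable (fun y => a y vs) x) ->
  (forall vs, differentiable (fun y => b y vs) x) ->
  euclid_d (fun y => a y + b y) x = euclid_d a x + euclid_d b x.
Proof.
move=> da db; apply/funext => vs; rewrite /euclid_d fctE -altsumD; apply: eq_altsum => v us.
rewrite -[LHS]/('D_v ((fun y => a y us) + (fun y => b y us)) x).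
by rewrite deriveD //; exact: diff_derivable.
Qed.

Lemma euclid_d_grade a x : (forall vs, differentiable (fun y => a y vs) x) ->
  euclid_d (fun y => grade (a y)) x = - grade (euclid_d a x).
Proof.
move=> da; apply/funext => vs; elim: vs a da => [|v vs IH] a da.
  by rewrite fctE /grade /euclid_d !altsum_nil mulr0 oppr0.
rewrite euclid_d_cons fctE /grade /= -/(grade _ _) euclid_d_cons.
have -> : (fun y => iprod v (grade (a y))) = (fun y => - grade (iprod v (a y))).
  by apply/funext => y; rewrite iprod_grade.
have -> : euclid_d (fun y => - grade (iprod v (a y))) x vs = - euclid_d (fun y => grade (iprod v (a y))) x vs.
  rewrite /euclid_d -mulN1r -altsumZ; apply: eq_altsum => u us; rewrite mulN1r.
  rewrite -[LHS]/('D_u (- (fun y => grade (iprod v (a y)) us)) x) deriveN //.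
  apply/diff_derivable/(@differentiableZ _ _ _ (fun y => iprod v (a y) us)).
  exact: da.
rewrite IH; last by move=> us; exact: da.
rewrite (@deriveZ _ _ _ (fun y => a y vs)); last exact: diff_derivable.
rewrite fctE /grade exprS /GRing.scale /=.
ring.
Qed.

(** By Cartan's formula both sides have the same contractions. *)
Lemma euclid_d_wedge a b x : (forall vs, differentiable (fun y => a y vs) x) ->
  (forall vs, differentiable (fun y => b y vs) x) ->
  euclid_d (fun y => cov_wedge (a y) (b y)) x =
  cov_wedge (euclid_d a x) (b x) + cov_wedge (grade (a x)) (euclid_d b x).
Proof.
move=> da db; apply/funext => vs; elim: vs a b da db => [|v vs IH] a b da db.
  by rewrite !fctE /= /euclid_d !altsum_nil mul0r mulr0 addr0.
have dg us : differentiable (fun y => grade (a y) us) x.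
  by apply: (@differentiableZ _ _ _ (fun y => a y us)).
rewrite euclid_d_cons (derive_wedge v vs da db).2.
have -> : (fun y => iprod v (cov_wedge (a y) (b y))) =
  (fun y => cov_wedge (iprod v (a y)) (b y) + cov_wedge (grade (a y)) (iprod v (b y))) by [].
rewrite euclid_dD; last 2 first.
- by move=> us; apply: (derive_wedge 0 us _ db).1 => ws; exact: da.
- by move=> us; apply: (derive_wedge 0 us dg _).1 => ws; exact: db.
rewrite fctE !IH //; try by [move=> us; exact: da|move=> us; exact: db].
rewrite -[RHS]/(cov_wedge (euclid_d a x) (b x) (v :: vs) +
  cov_wedge (grade (a x)) (euclid_d b x) (v :: vs)) !cov_wedge_cons !iprod_euclid_d.
rewrite euclid_d_grade // !iprod_grade !gradeK.
rewrite !(cov_wedgeDl, cov_wedgeDr, cov_wedgeNl, cov_wedgeNr, gradeD, gradeN).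
rewrite !fctE. ring.
Qed.

Lemma euclid_d_alternating a x : (forall y, alternating_multilinear (a y)) ->
  (forall vs, differentiable (fun y => a y vs) x) -> alternating_multilinear (euclid_d a x).
Proof.
move=> alt da; apply: altsum_alternating => [k u v vs|u].
  by rewrite !deriveE // linearP.
split=> [s t k v w|s t r v].
  under eq_fun do rewrite (alt _).1.
  rewrite -[LHS]/('D_u (k *: (fun y => a y (s ++ v :: t)) + (fun y => a y (s ++ w :: t))) x).
  rewrite deriveD; first rewrite deriveZ //.
  - exact: diff_derivable.
  - exact/derivableZ/diff_derivable.
  - exact: diff_derivable.
under eq_fun do rewrite (alt _).2.
exact: derive_cst.
Qed.

End EuclideanDerivative.

(** * Charts and smooth maps *)

Section Charts.
Variable R : realType.

(** The conditions on an atlas that manifolds share with their products and with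
    Euclidean spaces. *)
Record smooth_atlas n (M : charted R n) : Prop := SmoothAtlas {
  sat_at : forall p : M, atlas (chart_at p) /\ cdom (chart_at p) p;
  sat_open : forall c : chart R M n, atlas c -> open (cdom c) /\ open (cmap c @` cdom c);
  sat_cancel : forall (c : chart R M n) p, atlas c -> cdom c p -> cinv c (cmap c p) = p;
  sat_cont : forall (c : chart R M n) p, atlas c -> cdom c p -> {for p, continuous (cmap c)};
  sat_inv_cont : forall (c : chart R M n) x, atlas c -> (cmap c @` cdom c) x ->
    {for x, continuous (cinv c)};
  sat_smooth : forall c c' : chart R M n, atlas c -> atlas c' ->
    smooth_on (cmap c @` (cdom c `&` cdom c')) (cmap c' \o cinv c) }.

Lemma manifold_atlas n (M : charted R n) : is_manifold M -> smooth_atlas M.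
Proof.
case=> _ _ h1 h2 h3 h4 h5; split=> //.
- by move=> c p ac cp; apply: h3 => //; rewrite inE.
- by move=> c p ac; case: (h4 c ac) => + _; exact.
- by move=> c x ac; case: (h4 c ac) => _; exact.
Qed.

Lemma open_preimage (S T : topologicalType) (W : set S) (f : S -> T) (B : set T) :
  open W -> (forall p, W p -> {for p, continuous f}) -> open B ->
  open (W `&` f @^-1` B).
Proof.
move=> oW cf oB; rewrite openE => p [Wp Bfp]; apply: filterI.
  exact: open_nbhs_nbhs.
exact: (cf p Wp _ (open_nbhs_nbhs (conj oB Bfp))).
Qed.

Section OneManifold.
Variables (n : nat) (M : charted R n).
Hypothesis sM : smooth_atlas M.
Implicit Types (c : chart R M n) (W : set M) (p : M).

Lemma chart_img c p : cdom c p -> (cmap c @` cdom c) (cmap c p).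
Proof. by exists p. Qed.

Lemma chart_inv c W x : atlas c -> (cmap c @` (W `&` cdom c)) x ->
  [/\ W (cinv c x), cdom c (cinv c x) & cmap c (cinv c x) = x].
Proof. by move=> ac [p [Wp cp] <-]; rewrite sat_cancel. Qed.

Lemma img_chartE c W : atlas c -> cmap c @` (W `&` cdom c) =
  (cmap c @` cdom c) `&` cinv c @^-1` W.
Proof.
move=> ac; apply/seteqP; split=> [x hx|x [[p cp <-]]].
  have [Wx cx e] := chart_inv ac hx; split=> //.
  by rewrite -e; exact: chart_img.
by rewrite /preimage /= sat_cancel // => Wp; exists p.
Qed.

Lemma open_img_chart c W : atlas c -> open W -> open (cmap c @` (W `&` cdom c)).
Proof.
move=> ac oW; rewrite img_chartE //; apply: open_preimage => //.
  by case: (sat_open sM ac).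
by move=> x hx; exact: sat_inv_cont.
Qed.

End OneManifold.

Section Maps.
Variables (m n : nat) (M : charted R m) (N : charted R n).
Hypotheses (sM : smooth_atlas M) (sN : smooth_atlas N).
Implicit Types (W : set M) (f : M -> N) (p : M).

Definition chart_expr (c : chart R M m) (c' : chart R N n) f := cmap c' \o f \o cinv c.

Definition expr_dom (c : chart R M m) (c' : chart R N n) W f : set 'rV[R]_m :=
  cmap c @` (W `&` cdom c `&` f @^-1` cdom c').

Lemma open_expr_dom c c' W f : open W -> (forall p, W p -> {for p, continuous f}) ->
  atlas c -> atlas c' -> open (expr_dom c c' W f).
Proof.
move=> oW cf ac ac'; rewrite /expr_dom setIAC; apply: open_img_chart => //.
by apply: open_preimage => //; case: (sat_open sN ac').
Qed.

Lemma expr_dom_inv c c' W f x : atlas c -> expr_dom c c' W f x ->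
  [/\ W (cinv c x), cdom c (cinv c x), cdom c' (f (cinv c x)) & cmap c (cinv c x) = x].
Proof.
rewrite /expr_dom setIAC => ac hx.
by have [[Wx fx] cx e] := chart_inv sM ac hx.
Qed.

(** Changes of charts on both sides are smooth, so that one pair of charts around
    each point suffices. *)
Lemma smooth_map_intro W f : open W -> (forall p, W p -> {for p, continuous f}) ->
  (forall p, W p -> exists c c' (Q : set 'rV[R]_m),
     [/\ atlas c /\ atlas c', cdom c p /\ cdom c' (f p), open Q, Q (cmap c p) &
         smooth_on Q (chart_expr c c' f)]) ->
  smooth_map W f.
Proof.
move=> oW cf H; split=> // c1 c1' ac1 ac1' k; apply: Ck_local => x.
move=> /(expr_dom_inv ac1) [Wp cp cfp ex].
set p := cinv c1 x in Wp cp cfp ex.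
have [c [c' [Q [[ac ac'] [dcp dcfp] oQ Qp hQ]]]] := H p Wp.
have [oc _] := sat_open sM ac; have [oc' _] := sat_open sN ac'.
have [oc1 _] := sat_open sM ac1; have [oc1' _] := sat_open sN ac1'.
(* On D the expression in the charts c1, c1' is the one in c, c' between two
   changes of charts. *)
pose D := ((W `&` f @^-1` (cdom c' `&` cdom c1')) `&` cdom c1) `&`
          (cdom c `&` cmap c @^-1` Q).
have oD : open D.
  apply: openI; first apply: openI => //.
    by apply: open_preimage => //; exact: openI.
  by apply: open_preimage => // q cq; exact: sat_cont.
have DW : D `<=` W `&` cdom c by move=> q [[[? _] _] [? _]].
have oE : open (cmap c1 @` (D `&` cdom c1)) by exact: open_img_chart.
exists (cmap c1 @` (D `&` cdom c1)); split=> //; first by exists p.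
set E := cmap c1 @` _ in oE *.
have hE y : E y -> [/\ D (cinv c1 y), cdom c1 (cinv c1 y) & cmap c1 (cinv c1 y) = y].
  by move=> hy; exact: chart_inv hy.
pose E' := cmap c @` (D `&` cdom c).
have oE' : open E' by exact: open_img_chart.
have oC' : open (cmap c' @` (cdom c1' `&` cdom c')) by exact: open_img_chart.
have s1 : smooth_on E (cmap c \o cinv c1).
  move=> l; apply: Ck_sub (sat_smooth sM ac1 ac l) => y [q [[_ [cq _]] c1q] <-].
  by exists q.
have s2 : smooth_on E' (chart_expr c c' f).
  by move=> l; apply: Ck_sub (hQ l) => y [q [[_ [_ Qq]] _] <-].
have s3 : smooth_on (cmap c' @` (cdom c1' `&` cdom c')) (cmap c1' \o cinv c').
  by move=> l; rewrite setIC; exact: (sat_smooth sN ac' ac1').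
have m1 y : E y -> E' ((cmap c \o cinv c1) y).
  move=> /hE [Dy c1y ey]; exists (cinv c1 y) => //; split=> //.
  by case: (DW _ Dy).
have s12 := smooth_comp oE oE' m1 s1 s2.
have m12 y : E y -> (cmap c' @` (cdom c1' `&` cdom c'))
    ((chart_expr c c' f \o (cmap c \o cinv c1)) y).
  move=> /hE [Dy c1y ey]; rewrite /chart_expr /= (sat_cancel sM) //; last by case: (DW _ Dy).
  by exists (f (cinv c1 y)) => //; case: Dy => [[[_ [? ?]] _] _].
have s := smooth_comp oE oC' m12 s12 s3.
apply: Ck_congr (s k) => // y /hE [Dy c1y ey].
rewrite /chart_expr /= (sat_cancel sM) //; last by case: (DW _ Dy).
by rewrite (sat_cancel sN) //; case: Dy => [[[_ [? ?]] _] _].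
Qed.

Lemma smooth_map_cont W f p : smooth_map W f -> W p -> {for p, continuous f}.
Proof. by case=> h _; exact: h. Qed.

Lemma smooth_map_expr W f c c' : smooth_map W f -> atlas c -> atlas c' ->
  smooth_on (expr_dom c c' W f) (chart_expr c c' f).
Proof. by case=> _; exact. Qed.

Lemma smooth_map_sub W W' f : W' `<=` W -> smooth_map W f -> smooth_map W' f.
Proof.
move=> s [h1 h2]; split=> [p /s|c c' ac ac' k]; first exact: h1.
by apply: Ck_sub (h2 c c' ac ac' k) => _ [q [[Wq ?] ?] <-]; exists q => //; split=> //; split=> //; exact: s.
Qed.

Lemma smooth_map_congr W f g : open W -> (forall p, W p -> f p = g p) ->
  smooth_map W f -> smooth_map W g.
Proof.
move=> oW e sf; apply: smooth_map_intro => // p Wp.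
  have := smooth_map_cont sf Wp; rewrite /prop_for /continuous_at -(e p Wp) => h.
  apply: cvg_trans h; apply: near_eq_cvg.
  by apply: filterS (open_nbhs_nbhs (conj oW Wp)) => q; exact: e.
have [ac cp] := sat_at sM p; have [ac' cp'] := sat_at sN (g p).
exists (chart_at p), (chart_at (g p)), (expr_dom (chart_at p) (chart_at (g p)) W f).
have oQ : open (expr_dom (chart_at p) (chart_at (g p)) W f).
  by apply: open_expr_dom => // q Wq; exact: smooth_map_cont sf Wq.
split=> //.
  by exists p => //; split=> //; rewrite /preimage /= e.
move=> k; apply: Ck_congr oQ _ (smooth_map_expr sf ac ac' k) => x.
by move=> /(expr_dom_inv ac) [Wx _ _ _]; rewrite /chart_expr /= e.
Qed.

End Maps.

End Charts.

Section MapConstructions.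
Variable R : realType.

Lemma smooth_map_comp m n l (M : charted R m) (N : charted R n) (K : charted R l)
    (W : set M) (W' : set N) (f : M -> N) (g : N -> K) :
  smooth_atlas M -> smooth_atlas N -> smooth_atlas K ->
  open W -> open W' -> (forall p, W p -> W' (f p)) ->
  smooth_map W f -> smooth_map W' g -> smooth_map W (g \o f).
Proof.
move=> sM sN sK oW oW' WW' sf sg.
have cf p : W p -> {for p, continuous f} by exact: smooth_map_cont.
have cg p : W' p -> {for p, continuous g} by exact: smooth_map_cont.
apply: smooth_map_intro => // p Wp.
  by apply: continuous_comp; [exact: cf|apply: cg; exact: WW'].
have [ac cp] := sat_at sM p; have [ac' cp'] := sat_at sN (f p).
have [ac2 cp2] := sat_at sK (g (f p)).
set c := chart_at p in ac cp *; set c' := chart_at (f p) in ac' cp' *.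
set c2 := chart_at (g (f p)) in ac2 cp2 *.
have [oc2 _] := sat_open sK ac2; have [oc' _] := sat_open sN ac'.
pose D := W `&` f @^-1` (cdom c' `&` (W' `&` g @^-1` cdom c2)).
have oD : open D.
  by apply: open_preimage => //; apply: openI => //; exact: open_preimage.
pose E := cmap c @` (D `&` cdom c).
have oE : open E by exact: open_img_chart.
have s1 : smooth_on E (chart_expr c c' f).
  move=> k; apply: Ck_sub (smooth_map_expr sf ac ac' k) => y [q [[Wq [fq _]] cq] <-].
  by exists q.
have s2 := smooth_map_expr sg ac' ac2.
have oE2 : open (expr_dom c' c2 W' g) by exact: open_expr_dom.
exists c, c2, E; split=> //.
  by exists p => //; split=> //; split=> //; split=> //; split=> //; exact: WW'.
have m1 y : E y -> expr_dom c' c2 W' g (chart_expr c c' f y).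
  move=> [q [[Wq [fq [W'q gq]]] cq] <-].
  by exists (f q) => //; rewrite /chart_expr /= (sat_cancel sM).
move=> k; apply: Ck_congr oE _ (smooth_comp oE oE2 m1 s1 s2 k).
move=> y [q [[Wq [fq [W'q gq]]] cq] <-].
by rewrite /chart_expr /= (sat_cancel sM) // (sat_cancel sN).
Qed.

Lemma smooth_id (V : normedModType R) (O : set V) : smooth_on O id.
Proof.
by move=> k; apply: (@Ck_lin R V V k O (idfun : {linear V -> V})) => x; exact: cvg_id.
Qed.

Lemma euclid_atlas n : smooth_atlas (euclid R n).
Proof.
split.
- by move=> p.
- move=> c ->; split; first exact: openT.
  by rewrite /= image_id; exact: openT.
- by move=> c p ->.
- by move=> c p -> _ /=; exact: cvg_id.
- by move=> c x -> _ /=; exact: cvg_id.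
- by move=> c c' -> ->; exact: smooth_id.
Qed.

Lemma smooth_cinv n (M : charted R n) (c : chart R M n) : smooth_atlas M -> atlas c ->
  smooth_map (M := euclid R n) (N := M) (cmap c @` cdom c) (cinv c).
Proof.
move=> sM ac; have [oc oi] := sat_open sM ac.
apply: smooth_map_intro => //; first exact: euclid_atlas.
  by move=> x hx; exact: (sat_inv_cont sM).
move=> x [p cp <-]; rewrite /= (sat_cancel sM) //.
have [ac' cp'] := sat_at sM p; have [oc' _] := sat_open sM ac'.
exists (Chart setT id id), (chart_at p), (cmap c @` (cdom (chart_at p) `&` cdom c)).
split=> //.
- exact: open_img_chart.
- by exists p.
- by rewrite setIC => k; exact: (sat_smooth sM ac ac' k).
Qed.

Lemma smooth_map_cst m n (M : charted R m) (N : charted R n) (W : set M) (q : N) :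
  smooth_atlas M -> smooth_atlas N -> open W -> smooth_map W (fun=> q).
Proof.
move=> sM sN oW; apply: smooth_map_intro => // p Wp; first exact: cvg_cst.
have [ac cp] := sat_at sM p; have [ac' cp'] := sat_at sN q.
exists (chart_at p), (chart_at q), setT; split=> //; first exact: openT.
by move=> k; exact: Ck_cst.
Qed.

Lemma smooth_map_id n (M : charted R n) (W : set M) : smooth_atlas M -> open W ->
  smooth_map W id.
Proof.
move=> sM oW; apply: smooth_map_intro => // p Wp; first exact: cvg_id.
have [ac cp] := sat_at sM p; have [oc oi] := sat_open sM ac.
exists (chart_at p), (chart_at p), (cmap (chart_at p) @` cdom (chart_at p)); split=> //.
move=> k; apply: Ck_congr oi _ (@smooth_id 'rV[R]_n _ k) => x [q cq <-].
by rewrite /chart_expr /= (sat_cancel sM).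
Qed.

Section ProductCharts.
Variables (m n : nat) (M : charted R m) (N : charted R n).
Hypotheses (sM : smooth_atlas M) (sN : smooth_atlas N).
Local Notation MN := (prod_charted M N).

Definition rowl (u : 'rV[R]_m) : 'rV[R]_(m + n) := row_mx u 0.
Definition rowr (u : 'rV[R]_n) : 'rV[R]_(m + n) := row_mx 0 u.

Lemma rowl_linear : linear rowl.
Proof. by move=> a u v; rewrite /rowl scale_row_mx add_row_mx scaler0 addr0. Qed.
Lemma rowr_linear : linear rowr.
Proof. by move=> a u v; rewrite /rowr scale_row_mx add_row_mx scaler0 addr0. Qed.
HB.instance Definition _ := GRing.isLinear.Build R _ _ _ rowl rowl_linear.
HB.instance Definition _ := GRing.isLinear.Build R _ _ _ rowr rowr_linear.

Lemma row_mxE u v : row_mx u v = rowl u + rowr v.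
Proof. by rewrite /rowl /rowr add_row_mx addr0 add0r. Qed.

Lemma smooth_row_mx (V : normedModType R) (O : set V) (f : V -> 'rV[R]_m)
    (g : V -> 'rV[R]_n) : open O ->
  smooth_on O f -> smooth_on O g -> smooth_on O (fun x => row_mx (f x) (g x)).
Proof.
move=> oO sf sg k; have -> : (fun x => row_mx (f x) (g x)) =
  (fun x => rowl (f x)) + (fun x => rowr (g x)).
  by apply/funext => x; rewrite row_mxE.
apply: (CkD oO).
  by apply: (@Ck_linl _ _ _ _ _ _ rowl) => //; exact: rV_linear_continuous.
by apply: (@Ck_linl _ _ _ _ _ _ rowr) => //; exact: rV_linear_continuous.
Qed.

Lemma row_mx_continuous (T : topologicalType) (f : T -> 'rV[R]_m) (g : T -> 'rV[R]_n) x :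
  {for x, continuous f} -> {for x, continuous g} ->
  {for x, continuous (fun y => row_mx (f y) (g y))}.
Proof.
move=> cf cg; have -> : (fun y => row_mx (f y) (g y)) =
  (fun y => rowl (f y)) + (fun y => rowr (g y)).
  by apply/funext => y; rewrite row_mxE.
apply: continuousD.
  by apply: continuous_comp cf _; exact: rV_linear_continuous.
by apply: continuous_comp cg _; exact: rV_linear_continuous.
Qed.

Lemma smooth_lsubmx : smooth_on setT (lsubmx : 'rV[R]_(m + n) -> 'rV[R]_m).
Proof. by move=> k; apply: Ck_lin; exact: continuous_lsubmx. Qed.

Lemma smooth_rsubmx : smooth_on setT (rsubmx : 'rV[R]_(m + n) -> 'rV[R]_n).
Proof. by move=> k; apply: Ck_lin; exact: continuous_rsubmx. Qed.

Lemma open_prod (A : set M) (B : set N) : open A -> open B -> open (A `*` B : set MN).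
Proof.
move=> oA oB; rewrite openE => -[p q] [Ap Bq].
by exists (A, B) => //; split; exact: open_nbhs_nbhs.
Qed.

Lemma fst_continuous (p : MN) : {for p, continuous (fst : MN -> M)}.
Proof. by move=> A h; exists (A, setT) => [|x [] //]; split=> //; exact: filterT. Qed.

Lemma snd_continuous (p : MN) : {for p, continuous (snd : MN -> N)}.
Proof. by move=> A h; exists (setT, A) => [|x [] //]; split=> //; exact: filterT. Qed.

Lemma pair_continuous (T : topologicalType) (f : T -> M) (g : T -> N) x :
  {for x, continuous f} -> {for x, continuous g} ->
  {for x, continuous (fun y => (f y, g y) : MN)}.
Proof.
move=> cf cg A [[B C] [/= hB hC] s].
have h1 : nbhs x (f @^-1` B) by exact: cf.
have h2 : nbhs x (g @^-1` C) by exact: cg.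
by apply: filterS (filterI h1 h2) => y [By Cy]; apply: s.
Qed.

Lemma prod_chart_img (c : chart R M m) (c' : chart R N n) (A : set M) (B : set N) :
  cmap (prod_chart c c') @` (A `*` B) =
  (lsubmx @^-1` (cmap c @` A)) `&` (rsubmx @^-1` (cmap c' @` B)).
Proof.
apply/seteqP; split=> [_ [[p q] [Ap Bq] <-]|x [[p Ap ep] [q Bq eq]]].
  by split; rewrite /preimage /= ?row_mxKl ?row_mxKr; [exists p|exists q].
by exists (p, q) => //=; rewrite ep eq hsubmxK.
Qed.

Lemma prod_atlas : smooth_atlas MN.
Proof.
have cl : continuous (lsubmx : 'rV[R]_(m + n) -> 'rV[R]_m) by exact: continuous_lsubmx.
have cr : continuous (rsubmx : 'rV[R]_(m + n) -> 'rV[R]_n) by exact: continuous_rsubmx.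
split.
- move=> [p q]; have [ac cp] := sat_at sM p; have [ac' cq] := sat_at sN q.
  by split=> //; exists (chart_at p), (chart_at q).
- move=> _ [c [c' [ac ac' ->]]].
  have [oc oi] := sat_open sM ac; have [oc' oi'] := sat_open sN ac'.
  split; first exact: open_prod.
  rewrite prod_chart_img; apply: openI.
    by apply: open_comp => // x _; exact: cl.
  by apply: open_comp => // x _; exact: cr.
- move=> _ [p q] [c [c' [ac ac' ->]]] [cp cq] /=.
  by rewrite row_mxKl row_mxKr (sat_cancel sM) // (sat_cancel sN).
- move=> _ [p q] [c [c' [ac ac' ->]]] [cp cq] /=.
  apply: row_mx_continuous.
    apply: (@continuous_comp _ _ _ (fst : MN -> M) (cmap c)); first exact: fst_continuous.
    exact: (sat_cont sM).
  apply: (@continuous_comp _ _ _ (snd : MN -> N) (cmap c')); first exact: snd_continuous.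
  exact: (sat_cont sN).
- move=> _ x [c [c' [ac ac' ->]]]; rewrite prod_chart_img => -[hl hr].
  have h1 := cvg_comp _ _ (cl x) (sat_inv_cont sM ac hl).
  have h2 := cvg_comp _ _ (cr x) (sat_inv_cont sN ac' hr).
  exact: pair_continuous h1 h2.
- move=> _ _ [c [c' [ac ac' ->]]] [b [b' [ab ab' ->]]].
  have -> : cdom (prod_chart c c') `&` cdom (prod_chart b b') =
      (cdom c `&` cdom b) `*` (cdom c' `&` cdom b').
    by apply/seteqP; split=> [[p q] [[? ?] [? ?]]|[p q] [[? ?] [? ?]]].
  rewrite prod_chart_img.
  set A := cmap c @` _; set B := cmap c' @` _.
  have [ob _] := sat_open sM ab; have [ob' _] := sat_open sN ab'.
  have oA : open A by rewrite /A setIC; exact: open_img_chart.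
  have oB : open B by rewrite /B setIC; exact: open_img_chart.
  have oAB : open (lsubmx @^-1` A `&` rsubmx @^-1` B : set 'rV[R]_(m + n)).
    by apply: openI; apply: open_comp => // x _.
  apply: smooth_row_mx => //.
    apply: (smooth_comp (Q := A) (f := cmap b \o cinv c)) => //.
    + by move=> x [].
    + by move=> k; apply: Ck_sub (smooth_lsubmx k).
    + exact: sat_smooth.
  apply: (smooth_comp (Q := B) (f := cmap b' \o cinv c')) => //.
  + by move=> x [].
  + by move=> k; apply: Ck_sub (smooth_rsubmx k).
  + exact: sat_smooth.
Qed.

Lemma smooth_fst (W : set MN) : open W -> smooth_map W (fst : MN -> M).
Proof.
move=> oW; apply: smooth_map_intro => //; first exact: prod_atlas.
  by move=> p _; exact: fst_continuous.
move=> p Wp; have [ac cp] := sat_at prod_atlas p.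
have [ac1 cp1] := sat_at sM p.1; have [oc oi] := sat_open prod_atlas ac.
exists (chart_at p), (chart_at p.1), (cmap (chart_at p) @` cdom (chart_at p)); split=> //.
move=> k; apply: Ck_congr oi _ (Ck_sub (@subsetT _ _) (smooth_lsubmx k)).
move=> x [q cq <-]; rewrite /chart_expr /= row_mxKl (sat_cancel sM) //.
by case: cq.
Qed.

Lemma smooth_snd (W : set MN) : open W -> smooth_map W (snd : MN -> N).
Proof.
move=> oW; apply: smooth_map_intro => //; first exact: prod_atlas.
  by move=> p _; exact: snd_continuous.
move=> p Wp; have [ac cp] := sat_at prod_atlas p.
have [ac1 cp1] := sat_at sN p.2; have [oc oi] := sat_open prod_atlas ac.
exists (chart_at p), (chart_at p.2), (cmap (chart_at p) @` cdom (chart_at p)); split=> //.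
move=> k; apply: Ck_congr oi _ (Ck_sub (@subsetT _ _) (smooth_rsubmx k)).
move=> x [q cq <-]; rewrite /chart_expr /= row_mxKr (sat_cancel sN) //.
by case: cq.
Qed.

Lemma smooth_pair l (K : charted R l) (W : set K) (f : K -> M) (g : K -> N) :
  smooth_atlas K -> open W -> smooth_map W f -> smooth_map W g ->
  smooth_map (N := MN) W (fun x => (f x, g x)).
Proof.
move=> sK oW sf sg; have sMN := prod_atlas.
have cf p : W p -> {for p, continuous f} by exact: smooth_map_cont.
have cg p : W p -> {for p, continuous g} by exact: smooth_map_cont.
apply: smooth_map_intro => // p Wp.
  by apply: pair_continuous; [exact: cf|exact: cg].
have [ac cp] := sat_at sK p.
have [acf cpf] := sat_at sM (f p); have [acg cpg] := sat_at sN (g p).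
have [ac' cp'] := sat_at sMN (f p, g p).
have oQf : open (expr_dom (chart_at p) (chart_at (f p)) W f) by exact: open_expr_dom.
have oQg : open (expr_dom (chart_at p) (chart_at (g p)) W g) by exact: open_expr_dom.
have oQ := openI oQf oQg.
exists (chart_at p), (chart_at ((f p, g p) : MN)).
exists (expr_dom (chart_at p) (chart_at (f p)) W f `&`
        expr_dom (chart_at p) (chart_at (g p)) W g); split=> //.
- by split; exists p.
apply: smooth_row_mx => // k.
  exact: Ck_sub (@subIsetl _ _ _) (smooth_map_expr sf ac acf k).
exact: Ck_sub (@subIsetr _ _ _) (smooth_map_expr sg ac acg k).
Qed.

End ProductCharts.

End MapConstructions.

(** * Tangent maps *)

Section TangentMaps.
Variable R : realType.

Section Basic.
Variables (m n : nat) (M : charted R m) (N : charted R n).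
Hypotheses (sM : smooth_atlas M) (sN : smooth_atlas N).
Implicit Types (W : set M) (f g : M -> N) (p : M).

Lemma expr_dom_at W f p : W p ->
  expr_dom (chart_at p) (chart_at (f p)) W f (cmap (chart_at p) p).
Proof.
move=> Wp; exists p => //; split; first split=> //.
  by case: (sat_at sM p).
by case: (sat_at sN (f p)).
Qed.

Lemma smooth_expr_at W f p : open W -> smooth_map W f -> W p ->
  open (expr_dom (chart_at p) (chart_at (f p)) W f) /\
  smooth_on (expr_dom (chart_at p) (chart_at (f p)) W f)
    (chart_expr (chart_at p) (chart_at (f p)) f).
Proof.
move=> oW sf Wp; have [ac cp] := sat_at sM p; have [ac' cp'] := sat_at sN (f p).
split; last exact: smooth_map_expr sf ac ac'.
by apply: open_expr_dom => // q; exact: smooth_map_cont.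
Qed.

Lemma diff_expr_at W f p : open W -> smooth_map W f -> W p ->
  differentiable (chart_expr (chart_at p) (chart_at (f p)) f) (cmap (chart_at p) p).
Proof.
move=> oW sf Wp; have [_ h] := smooth_expr_at oW sf Wp.
exact: (smooth_diff h (expr_dom_at f Wp)).
Qed.

Lemma tmap_linear f p : linear (tmap f p).
Proof. by move=> a u v; rewrite /tmap linearP. Qed.

Lemma tmap_local W f g p : open W -> smooth_map W f -> W p ->
  (forall q, W q -> f q = g q) -> tmap f p = tmap g p.
Proof.
move=> oW sf Wp e; apply/funext => v; rewrite /tmap.
have [oE _] := smooth_expr_at oW sf Wp.
have [ac _] := sat_at sM p.
have eE y : expr_dom (chart_at p) (chart_at (f p)) W f y ->
    chart_expr (chart_at p) (chart_at (f p)) f y =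
    chart_expr (chart_at p) (chart_at (g p)) g y.
  move=> /(expr_dom_inv sM ac) [Wy _ _ _].
  by rewrite /chart_expr /= (e _ Wp) (e _ Wy).
exact/esym/(open_eq_diffv v oE (expr_dom_at f Wp) eE (diff_expr_at oW sf Wp)).
Qed.

Lemma tmap_cst (q : N) p v : tmap (fun=> q) p v = 0 :> 'rV[R]_n.
Proof.
rewrite /tmap -[X in 'd X _ _]/(cst (cmap (chart_at q) q)).
by rewrite diff_cst.
Qed.

End Basic.

Lemma tmap_id n (M : charted R n) (p : M) v : smooth_atlas M -> tmap id p v = v.
Proof.
move=> sM; rewrite /tmap; have [ac cp] := sat_at sM p; have [oc oi] := sat_open sM ac.
set x := cmap _ p; set F := _ \o _.
have did : differentiable (id : 'rV[R]_n -> 'rV[R]_n) x by exact: ex_diff.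
have eF y : (cmap (chart_at p) @` cdom (chart_at p)) y -> id y = F y.
  by move=> [q cq <-]; rewrite /F /= (sat_cancel sM).
have [-> _] := open_eq_diff oi (chart_img cp) eF did.
by rewrite diff_val.
Qed.

(** Tangent spaces are identified with the model space through preferred charts,
    and near p the expression of g o f is the composite of those of g and f. *)
Lemma tmap_comp m n l (M : charted R m) (N : charted R n) (K : charted R l)
    (W : set M) (W' : set N) (f : M -> N) (g : N -> K) p v :
  smooth_atlas M -> smooth_atlas N -> smooth_atlas K ->
  open W -> open W' -> smooth_map W f -> smooth_map W' g -> W p -> W' (f p) ->
  tmap (g \o f) p v = tmap g (f p) (tmap f p v).
Proof.
move=> sM sN sK oW oW' sf sg Wp Wfp.
have [ac cp] := sat_at sM p; have [ac' cp'] := sat_at sN (f p).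
have df := diff_expr_at sM sN oW sf Wp.
have dg := diff_expr_at sN sK oW' sg Wfp.
have oE : open (expr_dom (chart_at p) (chart_at (f p)) W f).
  by apply: open_expr_dom => // q; exact: smooth_map_cont.
set F := chart_expr _ _ f in df; set G := chart_expr _ _ g in dg.
have eF : F (cmap (chart_at p) p) = cmap (chart_at (f p)) (f p).
  by rewrite /F /chart_expr /= (sat_cancel sM).
rewrite -eF in dg.
have dGF : differentiable (G \o F) (cmap (chart_at p) p) by exact: differentiable_comp.
rewrite /tmap -/(chart_expr _ _ f) -/F -/(chart_expr _ _ g) -/G -eF.
rewrite -[RHS]/(('d G (F (cmap (chart_at p) p)) \o 'd F (cmap (chart_at p) p)) v).
rewrite -(diff_comp df dg).
have eE y : expr_dom (chart_at p) (chart_at (f p)) W f y -> (G \o F) y =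
    (cmap (chart_at (g (f p))) \o (g \o f) \o cinv (chart_at p)) y.
  move=> /(expr_dom_inv sM ac) [Wy cy fy ey].
  by rewrite /G /F /chart_expr /= (sat_cancel sN).
exact: (open_eq_diffv v oE (expr_dom_at sM sN f Wp) eE dGF).
Qed.

Section Projections.
Variables (m n : nat) (M : charted R m) (N : charted R n).
Hypotheses (sM : smooth_atlas M) (sN : smooth_atlas N).
Local Notation MN := (prod_charted M N).

Lemma tmap_fst (p : MN) v : tmap (fst : MN -> M) p v = lsubmx v.
Proof.
have sMN := prod_atlas sM sN.
rewrite /tmap; have [ac cp] := sat_at sMN p; have [oc oi] := sat_open sMN ac.
set F := _ \o _.
have dl := @differentiable_lsubmx R 1 m n (cmap (chart_at p) p).
have eF y : (cmap (chart_at p) @` cdom (chart_at p)) y -> lsubmx y = F y.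
  by move=> [q [cq _] <-]; rewrite /F /= row_mxKl (sat_cancel sM) //; case: (sat_at sM p.1).
have [-> _] := open_eq_diff oi (chart_img cp) eF dl.
by rewrite diff_lin //; exact: continuous_lsubmx.
Qed.

Lemma tmap_snd (p : MN) v : tmap (snd : MN -> N) p v = rsubmx v.
Proof.
have sMN := prod_atlas sM sN.
rewrite /tmap; have [ac cp] := sat_at sMN p; have [oc oi] := sat_open sMN ac.
set F := _ \o _.
have dl := @differentiable_rsubmx R 1 m n (cmap (chart_at p) p).
have eF y : (cmap (chart_at p) @` cdom (chart_at p)) y -> rsubmx y = F y.
  by move=> [q [_ cq] <-]; rewrite /F /= row_mxKr (sat_cancel sN) //; case: (sat_at sN p.2).
have [-> _] := open_eq_diff oi (chart_img cp) eF dl.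
by rewrite diff_lin //; exact: continuous_rsubmx.
Qed.

End Projections.

Lemma smooth_map_euclid m n (O : set 'rV[R]_m) (F : 'rV[R]_m -> 'rV[R]_n) :
  open O -> smooth_on O F -> smooth_map (M := euclid R m) (N := euclid R n) O F.
Proof.
move=> oO sF; split=> [p Op|c c' -> ->].
  by have h := smooth_diff sF Op; apply: differentiable_continuous h.
by move=> k; apply: Ck_sub (sF k) => _ [p [[? _] _] <-].
Qed.

End TangentMaps.

(** * Differential forms on manifolds *)

Section Forms.
Variable R : realType.

Definition chart_form n (M : charted R n) (c : chart R M n) (w : dform M) :
    'rV[R]_n -> seq 'rV[R]_n -> R^o :=
  pull (M := euclid R n) (cinv c) w.

(** Contrary to [is_form], nothing is asked outside W except alternation, so that
    the condition passes to smaller sets. *)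
Definition smooth_form n (M : charted R n) (W : set M) (w : dform M) : Prop :=
  (forall p, alternating_multilinear (w p)) /\
  (forall (c : chart R M n) vs, atlas c ->
     smooth_on (cmap c @` (W `&` cdom c)) (fun x => chart_form c w x vs)).

Section OneManifold.
Variables (n : nat) (M : charted R n).
Hypothesis sM : smooth_atlas M.
Implicit Types (W : set M) (w : dform M) (p : M) (c : chart R M n).

Lemma is_formP W w :
  is_form W w <-> (forall p, ~ W p -> w p = 0) /\ smooth_form W w.
Proof.
split=> [[h1 h2 h3]|[h1 [h2 h3]]]; first by split=> //; split=> // c vs; exact: h3.
by split=> // c vs; exact: h3.
Qed.

Lemma smooth_form_sub W W' w : W' `<=` W -> smooth_form W w -> smooth_form W' w.
Proof.
move=> s [h1 h2]; split=> // c vs ac k; apply: Ck_sub (h2 c vs ac k) => _ [q [Wq cq] <-].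
by exists q => //; split=> //; exact: s.
Qed.

Lemma chart_form_eq W c w w' x vs : atlas c -> (cmap c @` (W `&` cdom c)) x ->
  (forall p, W p -> w p = w' p) -> chart_form c w x vs = chart_form c w' x vs.
Proof. by move=> ac /(chart_inv sM ac) [Wx _ _] e; rewrite /chart_form /pull e. Qed.

Lemma smooth_form_congr W w w' : open W -> (forall p, alternating_multilinear (w' p)) ->
  (forall p, W p -> w p = w' p) -> smooth_form W w -> smooth_form W w'.
Proof.
move=> oW alt e [_ h]; split=> // c vs ac k.
by apply: Ck_congr (h c vs ac k) => [|x hx]; [exact: open_img_chart|exact: chart_form_eq e].
Qed.

Lemma restr_in W w p : W p -> restr W w p = w p.
Proof. by move=> Wp; apply/funext => vs; rewrite /restr mem_set. Qed.

Lemma restr_out W w p : ~ W p -> restr W w p = 0.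
Proof. by move=> Wp; apply/funext => vs; rewrite /restr memNset. Qed.

Lemma restr_is_form W W' w : open W -> W `<=` W' -> smooth_form W' w ->
  is_form W (restr W w).
Proof.
move=> oW s sw; apply/is_formP; split; first by move=> p; exact: restr_out.
apply: (smooth_form_congr oW _ _ (smooth_form_sub s sw)) => p.
  have [Wp|nWp] := pselect (W p); first by rewrite restr_in //; case: sw.
  by rewrite restr_out //; exact: alternating_zero.
by move=> Wp; rewrite restr_in.
Qed.

Lemma smooth_form_linear W (k : R) w w' : open W -> smooth_form W w -> smooth_form W w' ->
  smooth_form W (k *: w + w').
Proof.
move=> oW [a1 h1] [a2 h2]; split=> [p|c vs ac l].
  exact: (alternating_linear k (a1 p) (a2 p)).
have oE := open_img_chart sM ac oW.
apply: (CkD oE (f := fun x => k * chart_form c w x vs : R^o)); last exact: h2.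
by apply: (CkM oE (u := fun=> k)); [exact: Ck_cst|exact: h1].
Qed.

Lemma smooth_form0 W : smooth_form W (0 : dform M).
Proof.
by split=> [p|c vs ac k]; [exact: alternating_zero|exact: Ck_cst].
Qed.

Lemma smooth_form_gsgn W k w : open W -> smooth_form W w -> smooth_form W (gsgn k w).
Proof.
move=> oW [a h]; split=> [p|c vs ac l]; last first.
  have oE := open_img_chart sM ac oW.
  have -> : (fun x => chart_form c (gsgn k w) x vs) =
      (fun x => (-1) ^+ (k * size vs) * chart_form c w x vs : R^o).
    by apply/funext => x; rewrite /chart_form /pull /gsgn size_map.
  by apply: (CkM oE); [exact: Ck_cst|exact: h].
split=> [s t r u v|s t r u]; rewrite /gsgn; last by rewrite (a p).2 mulr0.
rewrite (a p).1 !size_cat /=; ring.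
Qed.

Lemma fun_form_alternating (f : M -> R) p : alternating_multilinear (fun_form f p).
Proof.
have e (s t : seq 'rV[R]_n) u : fun_form f p (s ++ u :: t) = 0.
  by rewrite /fun_form /nilp size_cat addnS.
by split=> [s t k u v|s t r u]; rewrite !e ?mulr0 ?addr0.
Qed.

Lemma smooth_fun_form W (f : M -> R) : open W ->
  (forall c, atlas c -> smooth_on (cmap c @` (W `&` cdom c)) (f \o cinv c : _ -> R^o)) ->
  smooth_form W (fun_form f).
Proof.
move=> oW h; split=> [p|c [|v vs] ac]; first exact: fun_form_alternating.
  exact: h.
by move=> k; exact: Ck_cst.
Qed.

Lemma chart_form_wedge c w w' x : chart_form c (wedge w w') x = cov_wedge (chart_form c w x) (chart_form c w' x).
Proof. by rewrite /chart_form /pull wedgeE [LHS]precomp_wedge. Qed.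

Lemma smooth_form_wedge W w w' : open W -> smooth_form W w -> smooth_form W w' ->
  smooth_form W (wedge w w').
Proof.
move=> oW [a h] [a' h']; split=> [p|c vs ac].
  by rewrite wedgeE; exact: wedge_alternating.
have -> : (fun x => chart_form c (wedge w w') x vs) =
    (fun x => cov_wedge (chart_form c w x) (chart_form c w' x) vs).
  by apply/funext => x; rewrite chart_form_wedge.
apply: smooth_wedge; first exact: open_img_chart.
  by move=> us; exact: h.
by move=> us; exact: h'.
Qed.

Lemma extdE w p : extd setT w p = euclid_d (chart_form (chart_at p) w) (cmap (chart_at p) p).
Proof. by apply/funext => vs; rewrite /extd /restr in_setT. Qed.

Lemma extd_restr W w : extd W w = restr W (extd setT w).
Proof. by apply/funext => p; apply/funext => vs; rewrite /extd /restr in_setT. Qed.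

(** The preferred chart at p identifies the tangent space at p with the model
    space by definition, so that a form is its own expression there. *)
Lemma chart_form_center w p : chart_form (chart_at p) w (cmap (chart_at p) p) = w p.
Proof.
have [ac cp] := sat_at sM p.
have ep : cinv (chart_at p) (cmap (chart_at p) p) = p by exact: sat_cancel.
apply/funext => vs; rewrite /chart_form /pull ep; congr (w p _).
rewrite -[RHS]map_id; apply: eq_map => v.
rewrite -[RHS](tmap_id p v sM) /tmap ep /=.
by [].
Qed.

End OneManifold.

Lemma euclid_d_local n (om om' : 'rV[R]_n -> seq 'rV[R]_n -> R^o) O x vs :
  open O -> O x -> (forall y us, O y -> om y us = om' y us) ->
  euclid_d om x vs = euclid_d om' x vs.
Proof.
by move=> oO Ox e; apply: eq_altsum => v us; apply: (open_eq_derive _ oO Ox) => y; exact: e.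
Qed.

Lemma smooth_euclid_d n (om : 'rV[R]_n -> seq 'rV[R]_n -> R^o) O vs : open O ->
  (forall us, smooth_on O (fun y => om y us)) -> smooth_on O (fun y => euclid_d om y vs).
Proof.
move=> oO h; elim: vs om h => [|v vs IH] om h.
  have -> : (fun y => euclid_d om y [::]) = (fun=> 0) by apply/funext => y; exact: altsum_nil.
  by move=> k; exact: Ck_cst.
have -> : (fun y => euclid_d om y (v :: vs)) =
   (fun y => 'D_v (fun z => om z vs) y) +
   (fun y => -1 * euclid_d (fun z => iprod v (om z)) y vs : R^o).
  by apply/funext => y; rewrite euclid_d_cons fctE mulN1r.
move=> k; apply: (CkD oO); first exact: (smooth_onP (h vs)).
apply: (CkM oO (u := fun=> -1)); first exact: Ck_cst.
by apply: IH => us; exact: h.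
Qed.

Section Pullback.
Variables (m n : nat) (M : charted R m) (N : charted R n).
Hypotheses (sM : smooth_atlas M) (sN : smooth_atlas N).
Variables (W : set M) (W' : set N) (f : M -> N).
Hypotheses (oW : open W) (oW' : open W') (sf : smooth_map W f).
Hypothesis fW : forall p, W p -> W' (f p).

(** With F the expression of f in the charts, f o cinv c and cinv c' o F agree near
    y, and the chain rule applies to both. *)
Lemma chart_form_pull c c' w y vs : atlas c -> atlas c' -> expr_dom c c' W f y ->
  chart_form c (pull f w) y vs =
  chart_form c' w (chart_expr c c' f y) [seq 'd (chart_expr c c' f) y v | v <- vs].
Proof.
move=> ac ac' Ey; have [Wy cy fy ey] := expr_dom_inv sM ac Ey.
set F := chart_expr c c' f.
have eF : cinv c' (F y) = f (cinv c y) by rewrite /F /chart_expr /= (sat_cancel sN).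
have [oc oi] := sat_open sM ac; have [oc' oi'] := sat_open sN ac'.
have sE : smooth_on (expr_dom c c' W f) F by exact: smooth_map_expr.
have oE : open (expr_dom c c' W f).
  by apply: open_expr_dom => // q; exact: smooth_map_cont.
have ce := smooth_cinv sM ac; have ce' := smooth_cinv sN ac'.
have FE z : expr_dom c c' W f z -> (cmap c' @` cdom c') (F z).
  by move=> /(expr_dom_inv sM ac) [_ _ fz _]; exact: chart_img.
have sF := smooth_map_euclid oE sE.
have sE2 : expr_dom c c' W f `<=` cmap c @` cdom c.
  by move=> _ [q [[_ cq] _] <-]; exists q.
have h v : tmap f (cinv c y) (tmap (M := euclid R m) (cinv c) y v) =
           tmap (M := euclid R n) (cinv c') (F y) ('d F y v).
  have ce2 := smooth_map_sub (M := euclid R m) sE2 ce.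
  have em := euclid_atlas R m; have en := euclid_atlas R n.
  rewrite -(tmap_comp (M := euclid R m) v em sM sN oE oW ce2 sf Ey Wy).
  have -> : 'd F y v = tmap (M := euclid R m) (N := euclid R n) F y v by [].
  rewrite -(tmap_comp (M := euclid R m) (N := euclid R n) v em en sN oE oi' sF ce' Ey (FE _ Ey)).
  have sfc : smooth_map (M := euclid R m) (expr_dom c c' W f) (f \o cinv c).
    apply: (smooth_map_comp (M := euclid R m) em sM sN oE oW _ ce2 sf) => z.
    by move=> /(expr_dom_inv sM ac) [].
  rewrite (tmap_local (M := euclid R m) (g := cinv c' \o F) em sN oE sfc Ey) //.
  by move=> z /(expr_dom_inv sM ac) [_ _ fz _]; rewrite /F /chart_expr /= (sat_cancel sN).
have e : [seq tmap f (cinv c y) u | u <- [seq tmap (M := euclid R m) (cinv c) y v | v <- vs]] =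
    [seq tmap (M := euclid R n) (cinv c') (F y) u | u <- [seq 'd F y v | v <- vs]].
  rewrite -[LHS]map_comp -[RHS]map_comp.
  apply: eq_map.
  exact: h.
rewrite /chart_form /pull.
rewrite eF.
by rewrite -e.
Qed.

Lemma smooth_pull w : smooth_form W' w -> smooth_form W (pull f w).
Proof.
move=> [alt h]; split=> [p|c vs ac k].
  apply: (precomp_alternating (A := tmap f p)) => //; exact: tmap_linear.
apply: Ck_local => x /(chart_inv sM ac) [Wx cx ex].
have [ac' cp'] := sat_at sN (f (cinv c x)).
set c' := chart_at _ in ac' cp'.
have oE : open (expr_dom c c' W f).
  by apply: open_expr_dom => // q; exact: smooth_map_cont.
have sE : smooth_on (expr_dom c c' W f) (chart_expr c c' f) by exact: smooth_map_expr.
exists (expr_dom c c' W f); split=> //; first by exists (cinv c x).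
pose L v y := 'D_v (chart_expr c c' f) y.
apply: (Ck_congr (f := fun y => chart_form c' w (chart_expr c c' f y) [seq L v y | v <- vs])) => //.
  move=> y Ey; rewrite (chart_form_pull w vs ac ac' Ey).
  have -> : [seq L v y | v <- vs] = [seq 'd (chart_expr c c' f) y v | v <- vs].
    by apply: eq_map => v; rewrite /L deriveE //; exact: (smooth_diff sE).
  by [].
have oQ : open (cmap c' @` (W' `&` cdom c')) by exact: open_img_chart.
apply: (smooth_moving (Q := cmap c' @` (W' `&` cdom c'))) => //.
- move=> z; apply: (precomp_alternating (A := tmap (M := euclid R n) (cinv c') z)) => //.
  exact: tmap_linear.
- move=> y /(expr_dom_inv sM ac) [Wy _ fy _]; exists (f (cinv c y)) => //.
  by split=> //; exact: fW.
- by move=> us; exact: h.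
- by move=> v; exact: smooth_onP.
Qed.

(** In the preferred charts at p and f p this is [euclid_d_pull]. *)
Lemma extd_pull w p : smooth_form W' w -> W p ->
  extd setT (pull f w) p = pull f (extd setT w) p.
Proof.
move=> [alt h] Wp; apply/funext => vs; rewrite /pull !extdE.
have [ac cp] := sat_at sM p; have [ac' cp'] := sat_at sN (f p).
have [oE sE] := smooth_expr_at sM sN oW sf Wp.
have Ex := expr_dom_at sM sN f Wp.
have eF : chart_expr (chart_at p) (chart_at (f p)) f (cmap (chart_at p) p) =
    cmap (chart_at (f p)) (f p).
  by rewrite /chart_expr /= (sat_cancel sM).
rewrite (euclid_d_local vs oE Ex (fun y us => @chart_form_pull _ _ w y us ac ac')).
rewrite (euclid_d_pull vs _ _ oE Ex sE); first by rewrite eF.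
  move=> z; apply: (precomp_alternating (A := tmap (M := euclid R n) (cinv (chart_at (f p))) z)) => //.
  exact: tmap_linear.
move=> us; rewrite eF; apply: smooth_diff (h _ us ac') _.
by exists (f p) => //; split=> //; exact: fW.
Qed.

End Pullback.

Section ExteriorDerivative.
Variables (n : nat) (M : charted R n).
Hypothesis sM : smooth_atlas M.
Variable W : set M.
Hypothesis oW : open W.
Implicit Types (w : dform M) (p : M) (c : chart R M n).

Lemma chart_form_euclid (w : dform (euclid R n)) :
  chart_form (Chart setT id id : chart R (euclid R n) n) w = w.
Proof.
apply/funext => y; apply/funext => vs; rewrite /chart_form /pull /=; congr (w y _).
rewrite -[RHS]map_id; apply: eq_map => v.
exact: (tmap_id (M := euclid R n) y v (euclid_atlas R n)).
Qed.

(** The preferred chart, in which the derivative is defined, varies with the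
    point. Naturality under the inverse of c shows that c computes the same form
    at all points of its domain. *)
Lemma chart_form_extd c w y vs : smooth_form W w -> atlas c -> (cmap c @` (W `&` cdom c)) y ->
  chart_form c (extd setT w) y vs = euclid_d (chart_form c w) y vs.
Proof.
move=> sw ac Ey; have oE := open_img_chart sM ac oW.
have sc : smooth_map (M := euclid R n) (cmap c @` (W `&` cdom c)) (cinv c).
  apply: (smooth_map_sub (M := euclid R n) _ (smooth_cinv sM ac)).
  by move=> _ [q [_ cq] <-]; exists q.
have cW z : (cmap c @` (W `&` cdom c)) z -> W (cinv c z).
  by move=> /(chart_inv sM ac) [].
have := extd_pull (M := euclid R n) (euclid_atlas R n) sM oE sc cW sw Ey.
rewrite /chart_form => <-; rewrite extdE /=.
by rewrite chart_form_euclid.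
Qed.

Lemma extd_is_form w : smooth_form W w -> is_form W (extd W w).
Proof.
move=> sw; have [alt h] := sw; rewrite extd_restr; apply/is_formP; split.
  by move=> p; exact: restr_out.
split=> [p|c vs ac k].
  have [Wp|nWp] := pselect (W p); last by rewrite restr_out //; exact: alternating_zero.
  have [ac cp] := sat_at sM p.
  rewrite restr_in // extdE; apply: euclid_d_alternating => [y|us].
    apply: (precomp_alternating (A := tmap (M := euclid R n) (cinv (chart_at p)) y)) => //.
    exact: tmap_linear.
  by apply: smooth_diff (h _ us ac) _; exists p.
have oE := open_img_chart sM ac oW.
apply: Ck_congr oE _ (smooth_euclid_d vs oE (fun us => h c us ac) k) => x Ex.
rewrite -chart_form_extd //; apply/esym/(chart_form_eq sM vs ac Ex) => p Wp.
by rewrite restr_in.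
Qed.

Lemma chart_form_diff w p vs : smooth_form W w -> W p ->
  differentiable (fun x => chart_form (chart_at p) w x vs) (cmap (chart_at p) p).
Proof.
move=> [alt h] Wp; have [ac cp] := sat_at sM p.
by apply: smooth_diff (h _ vs ac) _; exists p.
Qed.

Lemma extd_wedge w w' p : smooth_form W w -> smooth_form W w' -> W p ->
  extd setT (wedge w w') p =
  (wedge (extd setT w) w' + wedge (gsgn 1 w) (extd setT w')) p.
Proof.
move=> sw sw' Wp; rewrite fctE !wedgeE !extdE.
have -> : gsgn 1 w p = grade (w p) by apply/funext => vs; rewrite /gsgn mul1n.
have -> : chart_form (chart_at p) (wedge w w') =
    (fun x => cov_wedge (chart_form (chart_at p) w x) (chart_form (chart_at p) w' x)).
  by apply/funext => x; rewrite chart_form_wedge.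
rewrite euclid_d_wedge ?chart_form_center // => vs; exact: chart_form_diff.
Qed.

Lemma extd_local w w' p : W p -> (forall q, W q -> w q = w' q) ->
  extd setT w p = extd setT w' p.
Proof.
move=> Wp e; apply/funext => vs; rewrite !extdE.
have [ac cp] := sat_at sM p.
apply: (euclid_d_local _ (open_img_chart sM ac oW)); first by exists p.
by move=> y us Ey; exact: chart_form_eq e.
Qed.

Lemma extd_linear (k : R) w w' p : smooth_form W w -> smooth_form W w' -> W p ->
  extd setT (k *: w + w') p = k *: extd setT w p + extd setT w' p.
Proof.
move=> sw sw' Wp; apply/funext => vs; rewrite !fctE !extdE.
rewrite /euclid_d /GRing.scale /= -altsumZ -altsumD; apply: eq_altsum => v us.
have d := chart_form_diff us sw Wp; have d' := chart_form_diff us sw' Wp.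
have [d1 e1] := derive_mul v (differentiable_cst (k : R^o) (cmap (chart_at p) p)) d.
rewrite -[LHS]/('D_v ((fun y => k * chart_form (chart_at p) w y us : R^o) +
  (fun y => chart_form (chart_at p) w' y us)) (cmap (chart_at p) p)).
rewrite deriveD; [|exact: diff_derivable..].
by rewrite e1 derive_cst mul0r add0r.
Qed.

Lemma extd0 p : extd setT (0 : dform M) p = 0.
Proof.
apply/funext => vs; rewrite extdE /euclid_d /altsum big1 // => i _.
by rewrite derive_cst mulr0.
Qed.

Lemma smooth_form_sum (I : eqType) (r : seq I) (F : I -> dform M) :
  (forall i, i \in r -> smooth_form W (F i)) -> smooth_form W (\sum_(i <- r) F i).
Proof.
move=> h; rewrite big_seq; elim/big_ind: _ => //; first exact: smooth_form0.
by move=> a b sa sb; rewrite -[a]scale1r; exact: smooth_form_linear.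
Qed.

Lemma extd_sum (I : eqType) (r : seq I) (F : I -> dform M) p :
  (forall i, i \in r -> smooth_form W (F i)) -> W p ->
  extd setT (\sum_(i <- r) F i) p = \sum_(i <- r) extd setT (F i) p.
Proof.
move=> h Wp; elim: r h => [|i r IH] h; first by rewrite !big_nil extd0.
have hr j : j \in r -> smooth_form W (F j).
  by move=> jr; apply: h; rewrite in_cons jr orbT.
rewrite !big_cons -(IH hr) -[F i]scale1r.
rewrite (extd_linear 1 (h i (mem_head _ _)) (smooth_form_sum hr) Wp).
by rewrite !scale1r.
Qed.

Lemma extd_gsgn w p : smooth_form W w -> W p ->
  extd setT (gsgn 1 w) p = - gsgn 1 (extd setT w) p.
Proof.
move=> sw Wp; have gE (v : dform M) q : gsgn 1 v q = grade (v q).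
  by apply/funext => vs; rewrite /gsgn mul1n.
rewrite gE !extdE.
have -> : chart_form (chart_at p) (gsgn 1 w) = (fun x => grade (chart_form (chart_at p) w x)).
  by apply/funext => x; rewrite [RHS]grade_precomp -gE.
by rewrite euclid_d_grade // => us; exact: chart_form_diff.
Qed.

End ExteriorDerivative.

End Forms.

(** * Tensor products *)

Section TensorFacts.
Variables (R : realType) (V W : lmodType R).
Implicit Types (t : tensor V W) (Z : lmodType R).

Lemma tlift_linear Z (b : V -> W -> Z) (k : R) t t' : bilin b ->
  tlift b (k *: t + t') = k *: tlift b t + tlift b t'.
Proof. by move=> hb; rewrite [LHS]tliftD // [X in X + _]tliftZ. Qed.

Lemma tlift_add Z (b : V -> W -> Z) t t' : bilin b ->
  tlift b (t + t') = tlift b t + tlift b t'.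
Proof. by move=> hb; rewrite [LHS]tliftD. Qed.

Lemma tlift_sum Z (b : V -> W -> Z) (s : seq (V * W)) : bilin b ->
  tlift b (\sum_(x <- s) x.1 \ot x.2) = \sum_(x <- s) b x.1 x.2.
Proof.
move=> hb; elim: s => [|x s IH]; first by rewrite !big_nil [LHS]tlift0.
by rewrite !big_cons tlift_add // IH tlift_tens.
Qed.

Lemma tensDl (v v' : V) (w : W) : (v + v') \ot w = v \ot w + v' \ot w.
Proof. by have := (bilin_tens V W).1 w 1 v v'; rewrite !scale1r. Qed.

Lemma tensZl (k : R) (v : V) (w : W) : (k *: v) \ot w = k *: (v \ot w).
Proof.
have t0 : (0 : V) \ot w = 0.
  by have := (bilin_tens V W).1 w (-1) 0 0; rewrite scaler0 addr0 scaleN1r addNr.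
by have := (bilin_tens V W).1 w k v 0; rewrite t0 !addr0.
Qed.

Lemma tensDr (v : V) (w w' : W) : v \ot (w + w') = v \ot w + v \ot w'.
Proof. by have := (bilin_tens V W).2 v 1 w w'; rewrite !scale1r. Qed.

Lemma tensZr (k : R) (v : V) (w : W) : v \ot (k *: w) = k *: (v \ot w).
Proof.
have t0 : v \ot (0 : W) = 0.
  by have := (bilin_tens V W).2 v (-1) 0 0; rewrite scaler0 addr0 scaleN1r addNr.
by have := (bilin_tens V W).2 v k w 0; rewrite t0 !addr0.
Qed.

Lemma tens_sumr (v : V) (I : Type) (r : seq I) (f : I -> W) :
  v \ot (\sum_(i <- r) f i) = \sum_(i <- r) v \ot f i.
Proof.
elim: r => [|i r IH]; last by rewrite !big_cons tensDr IH.
by rewrite !big_nil -[X in _ \ot X](scale0r 0) tensZr scale0r.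
Qed.

(** No basis is needed to detect that a tensor vanishes: if some scalar ev i
    does not kill the first left factor, the hypothesis expresses its right
    factor through the other ones and the number of terms drops. *)
Lemma tens_sum_eq0 (I : Type) (ev : I -> V -> R) (s : seq (V * W)) :
  (forall i (k : R) v v', ev i (k *: v + v') = k * ev i v + ev i v') ->
  (forall v, (forall i, ev i v = 0) -> v = 0) ->
  (forall i, \sum_(x <- s) ev i x.1 *: x.2 = 0) ->
  \sum_(x <- s) x.1 \ot x.2 = 0.
Proof.
move=> lin sep; have [k] := ubnP (size s); elim: k s => // k IH [|[a b] s] /= ks H.
  by rewrite big_nil.
rewrite big_cons /=.
have [a0|na0] := pselect (forall i, ev i a = 0).
  have -> : a = 0 by exact: sep.
  rewrite -[X in X \ot _](scale0r 0) tensZl scale0r add0r; apply: IH => // i.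
  by have := H i; rewrite big_cons /= a0 scale0r add0r.
have /existsNP[i /eqP ai] := na0.
pose c v := ev i v / ev i a.
have bE : b = - \sum_(x <- s) c x.1 *: x.2.
  have := H i; rewrite big_cons /= => /eqP; rewrite addr_eq0 => /eqP e.
  apply: (scalerI ai); rewrite e scalerN scaler_sumr; congr (- _).
  by apply: eq_bigr => x _; rewrite scalerA /c mulrC divfK.
have := IH [seq (x.1 - c x.1 *: a, x.2) | x <- s]; rewrite size_map !big_map /=.
have -> : \sum_(x <- s) (x.1 - c x.1 *: a) \ot x.2 =
    a \ot b + \sum_(x <- s) x.1 \ot x.2.
  rewrite bE -scaleN1r tensZr tens_sumr scaler_sumr -big_split /=.
  apply: eq_bigr => x _; rewrite addrC -scaleNr tensDl tensZl tensZr scalerA mulN1r.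
  by [].
apply=> // j; rewrite big_map /=.
have evB x : ev j (x - c x *: a) = ev j x - c x * ev j a.
  by rewrite addrC -scaleNr lin mulNr addrC.
under eq_bigr do rewrite evB scalerBl.
rewrite big_split /= sumrN.
have := H j; rewrite big_cons /= bE => e.
rewrite -[RHS]e [RHS]addrC; congr (_ + _).
rewrite scalerN scaler_sumr; congr (- _); apply: eq_bigr => x _.
by rewrite scalerA mulrC.
Qed.

Lemma tens_span_tens (A : set V) (B : set W) v w : A v -> B w -> tens_span A B (v \ot w).
Proof.
move=> Av Bw; exists [:: (v, w)]; split; last by rewrite big_seq1.
by move=> x; rewrite inE => /eqP ->.
Qed.

Lemma tens_spanD (A : set V) (B : set W) t t' :
  tens_span A B t -> tens_span A B t' -> tens_span A B (t + t').
Proof.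
move=> [s [hs ->]] [s' [hs' ->]]; exists (s ++ s'); split; last by rewrite big_cat.
by move=> x; rewrite mem_cat => /orP[/hs|/hs'].
Qed.

Lemma tens_span0 (A : set V) (B : set W) : tens_span A B 0.
Proof. by exists [::]; rewrite big_nil. Qed.

Lemma tens_spanZ (A : set V) (B : set W) (k : R) t :
  (forall v, A v -> A (k *: v)) -> tens_span A B t -> tens_span A B (k *: t).
Proof.
move=> hA [s [hs ->]]; exists [seq (k *: x.1, x.2) | x <- s]; split.
  by move=> _ /mapP[x /hs[Ax Bx] ->]; split=> //; exact: hA.
rewrite big_map scaler_sumr; apply: eq_bigr => x _.
by rewrite tensZl.
Qed.

Lemma tens_span_sum (A : set V) (B : set W) (I : eqType) (r : seq I) (F : I -> tensor V W) :
  (forall i, i \in r -> tens_span A B (F i)) -> tens_span A B (\sum_(i <- r) F i).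
Proof.
elim: r => [|i r IH] h; first by rewrite big_nil; exact: tens_span0.
rewrite big_cons; apply: tens_spanD; first by apply: h; rewrite mem_head.
by apply: IH => j hj; apply: h; rewrite in_cons hj orbT.
Qed.

End TensorFacts.

(** * Algebra of differential forms *)

Section FormAlgebra.
Variables (R : realType) (n : nat) (M : charted R n).
Implicit Types (a b c w : dform M).

Lemma sum_dformE (I : Type) (r : seq I) (F : I -> dform M) p :
  (\sum_(i <- r) F i) p = \sum_(i <- r) F i p.
Proof.
elim: r => [|i r IH]; first by rewrite !big_nil.
by rewrite !big_cons -IH.
Qed.

Lemma gsgn1E w p : gsgn 1 w p = grade (w p).
Proof. by apply/funext => vs; rewrite /gsgn mul1n. Qed.

Lemma wedgeA a b c : wedge (wedge a b) c = wedge a (wedge b c).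
Proof. by apply/funext => p; rewrite !wedgeE cov_wedgeA. Qed.

Lemma wedge_linearl (k : R) a b c : wedge (k *: a + b) c = k *: wedge a c + wedge b c.
Proof. by apply/funext => p; rewrite wedgeE [LHS]cov_wedge_linearl -!wedgeE. Qed.

Lemma wedge_linearr (k : R) a b c : wedge c (k *: a + b) = k *: wedge c a + wedge c b.
Proof. by apply/funext => p; rewrite wedgeE [LHS]cov_wedge_linearr -!wedgeE. Qed.

Lemma wedge0l c : wedge 0 c = 0.
Proof.
by have := wedge_linearl (-1) 0 0 c; rewrite scaler0 addr0 scaleN1r addNr.
Qed.

Lemma wedge0r c : wedge c 0 = 0.
Proof.
by have := wedge_linearr (-1) 0 0 c; rewrite scaler0 addr0 scaleN1r addNr.
Qed.

Lemma wedgeDl a b c : wedge (a + b) c = wedge a c + wedge b c.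
Proof. by have := wedge_linearl 1 a b c; rewrite !scale1r. Qed.

Lemma wedgeDr a b c : wedge c (a + b) = wedge c a + wedge c b.
Proof. by have := wedge_linearr 1 a b c; rewrite !scale1r. Qed.

Lemma wedgeZl (k : R) a c : wedge (k *: a) c = k *: wedge a c.
Proof. by have := wedge_linearl k a 0 c; rewrite wedge0l !addr0. Qed.

Lemma wedgeZr (k : R) a c : wedge c (k *: a) = k *: wedge c a.
Proof. by have := wedge_linearr k a 0 c; rewrite wedge0r !addr0. Qed.

Lemma wedge_suml (I : Type) (r : seq I) (F : I -> dform M) c :
  wedge (\sum_(i <- r) F i) c = \sum_(i <- r) wedge (F i) c.
Proof.
elim: r => [|i r IH]; first by rewrite !big_nil wedge0l.
by rewrite !big_cons wedgeDl IH.
Qed.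

Lemma wedge_sumr (I : Type) (r : seq I) (F : I -> dform M) c :
  wedge c (\sum_(i <- r) F i) = \sum_(i <- r) wedge c (F i).
Proof.
elim: r => [|i r IH]; first by rewrite !big_nil wedge0r.
by rewrite !big_cons wedgeDr IH.
Qed.

Lemma gsgn_wedge a b : gsgn 1 (wedge a b) = wedge (gsgn 1 a) (gsgn 1 b).
Proof. by apply/funext => p; rewrite gsgn1E !wedgeE !gsgn1E grade_wedge. Qed.

Lemma gsgn_linear (k : R) a b : gsgn 1 (k *: a + b) = k *: gsgn 1 a + gsgn 1 b.
Proof. by apply/funext => p; rewrite gsgn1E [LHS]grade_linear -!gsgn1E. Qed.

Lemma wedgeC2 a b : 2 *: wedge a b =
  wedge b (a + gsgn 1 a) + wedge (gsgn 1 b) (a - gsgn 1 a).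
Proof.
apply/funext => p.
transitivity (2 *: cov_wedge (a p) (b p)); first by rewrite -wedgeE.
by rewrite cov_wedgeC -!gsgn1E -[RHS]/(wedge _ _ p + wedge _ _ p) !wedgeE.
Qed.

Lemma wedge_fun_form (f g : M -> R) :
  wedge (fun_form f) (fun_form g) = fun_form (fun p => f p * g p) :> dform M.
Proof.
apply/funext => p; rewrite wedgeE; apply/funext => -[|v vs] //=.
have i0 (h : M -> R) : iprod v (fun_form h p) = 0 by [].
by rewrite !i0 cov_wedge0l cov_wedge0r; exact: addr0.
Qed.

Lemma wedge1form w : wedge (fun_form (fun=> 1)) w = w.
Proof.
apply/funext => p; rewrite wedgeE; apply/funext => vs.
have g1 : grade (fun_form (fun=> 1) p) = fun_form (fun=> 1) p :> (seq 'rV[R]_n -> R^o).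
  by apply/funext => -[|v us]; rewrite /grade /fun_form /= ?mulr0 ?expr0 ?mul1r.
elim: vs (w p) => [|v vs IH] f; first by rewrite /= /fun_form mul1r.
rewrite /= g1 IH; have -> : iprod v (fun_form (fun=> 1) p) = 0 by [].
by rewrite cov_wedge0l add0r.
Qed.

End FormAlgebra.

Section PullAlgebra.
Variables (R : realType) (m n : nat) (M : charted R m) (N : charted R n).
Implicit Types (f : M -> N) (a b : dform N).

Lemma pull_wedge f a b : pull f (wedge a b) = wedge (pull f a) (pull f b).
Proof.
apply/funext => p; rewrite wedgeE /pull wedgeE.
exact: (precomp_wedge (tmap f p)).
Qed.

Lemma pull_gsgn f a : pull f (gsgn 1 a) = gsgn 1 (pull f a).
Proof. by apply/funext => p; apply/funext => vs; rewrite /pull /gsgn size_map. Qed.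

Lemma pull_fun_form f (h : N -> R) : pull f (fun_form h) = fun_form (h \o f).
Proof. by apply/funext => p; apply/funext => -[|v vs]. Qed.

Lemma pull_local (W : set M) f g a p : smooth_atlas M -> smooth_atlas N ->
  open W -> smooth_map W f -> W p -> (forall q, W q -> f q = g q) ->
  pull f a p = pull g a p.
Proof.
move=> sM sN oW sf Wp e; apply/funext => vs.
by rewrite /pull (tmap_local sM sN oW sf Wp e) e.
Qed.

Lemma pull_comp l (K : charted R l) (W : set M) (W' : set N) f (g : N -> K) (a : dform K) p :
  smooth_atlas M -> smooth_atlas N -> smooth_atlas K ->
  open W -> open W' -> smooth_map W f -> smooth_map W' g -> W p -> W' (f p) ->
  pull (g \o f) a p = pull f (pull g a) p.
Proof.
move=> sM sN sK oW oW' sf sg Wp Wfp; apply/funext => vs; rewrite /pull -map_comp.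
congr (a _ _); apply: eq_map => v; exact: (tmap_comp v sM sN sK oW oW' sf sg Wp Wfp).
Qed.

Lemma pull_cst (q : N) a (p : M) : alternating_multilinear (a q) ->
  pull (fun=> q) a p = (a q [::] *: (fun_form (fun=> 1) : dform M)) p.
Proof.
move=> alt; apply/funext => -[|v vs]; rewrite /pull /=.
  exact/esym/mulr1.
rewrite tmap_cst (alternating0 [::] _ alt); exact/esym/mulr0.
Qed.

End PullAlgebra.

Lemma pull_id (R : realType) n (M : charted R n) (a : dform M) p : smooth_atlas M ->
  pull id a p = a p.
Proof.
move=> sM; apply/funext => vs; rewrite /pull; congr (a p _).
by rewrite -[RHS]map_id; apply: eq_map => v; exact: tmap_id.
Qed.

(** * Forms on a product *)

Section Cross.
Variables (R : realType) (m n : nat) (M : charted R m) (N : charted R n).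
Hypotheses (sM : smooth_atlas M) (sN : smooth_atlas N).
Local Notation MN := (prod_charted M N).
Let sMN := prod_atlas sM sN.

(** The exterior product of forms on two factors, on the level of the values at
    one point of the product. *)
Definition crossv (f : seq 'rV[R]_m -> R^o) (g : seq 'rV[R]_n -> R^o) :
    seq 'rV[R]_(m + n) -> R^o :=
  cov_wedge (precomp lsubmx f) (precomp rsubmx g).

Lemma cross_bilin : bilin (fun (w : dform M) (h : dform N) =>
  wedge (pull (M := MN) fst w) (pull (M := MN) snd h)).
Proof.
split=> [h k w w'|w k h h'] /=.
  by rewrite -wedge_linearl.
by rewrite -wedge_linearr.
Qed.

Lemma cross_tens (w : dform M) (h : dform N) :
  cross (w \ot h) = wedge (pull (M := MN) fst w) (pull (M := MN) snd h).
Proof. by rewrite /cross tlift_tens //; exact: cross_bilin. Qed.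

Lemma cross_linear (k : R) (t t' : tensor (dform M) (dform N)) :
  cross (k *: t + t') = k *: cross t + cross t'.
Proof. by rewrite /cross tlift_linear //; exact: cross_bilin. Qed.

Lemma crossD (t t' : tensor (dform M) (dform N)) : cross (t + t') = cross t + cross t'.
Proof. by have := cross_linear 1 t t'; rewrite !scale1r. Qed.

Lemma cross0 : cross (0 : tensor (dform M) (dform N)) = 0.
Proof. by have := cross_linear (-1) 0 0; rewrite scaler0 addr0 scaleN1r addNr. Qed.

Lemma crossZ (k : R) (t : tensor (dform M) (dform N)) : cross (k *: t) = k *: cross t.
Proof. by have := cross_linear k t 0; rewrite cross0 !addr0. Qed.

Lemma cross_sum (s : seq (dform M * dform N)) :
  cross (\sum_(x <- s) x.1 \ot x.2) = \sum_(x <- s) cross (x.1 \ot x.2).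
Proof.
rewrite /cross tlift_sum; last exact: cross_bilin.
by apply: eq_bigr => x _; rewrite tlift_tens //; exact: cross_bilin.
Qed.

Lemma crossE (w : dform M) (h : dform N) (q : MN) :
  cross (w \ot h) q = crossv (w q.1) (h q.2).
Proof.
rewrite cross_tens wedgeE; congr cov_wedge; apply/funext => vs; rewrite /pull /precomp.
  by have -> : tmap (fst : MN -> M) q = lsubmx by apply/funext => v; exact: tmap_fst.
by have -> : tmap (snd : MN -> N) q = rsubmx by apply/funext => v; exact: tmap_snd.
Qed.

Lemma crossv_split f g vs us : alternating_multilinear f -> alternating_multilinear g ->
  crossv f g ([seq rowl n v | v <- vs] ++ [seq rowr m u | u <- us]) = f vs * g us.
Proof.
move=> hf hg; rewrite /crossv wedge_split //.
- rewrite -!map_comp; congr (f _ * g _).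
    by rewrite -[RHS]map_id; apply: eq_map => v /=; rewrite row_mxKl.
  by rewrite -[RHS]map_id; apply: eq_map => v /=; rewrite row_mxKr.
- by move=> _ /mapP[v _ ->]; rewrite row_mxKr.
- by move=> _ /mapP[v _ ->]; rewrite row_mxKl.
Qed.

(** The value on vectors of the first factor followed by vectors of the second
    one is the product of the values of the two factors. *)
Lemma cross_inj (s : seq (dform M * dform N)) :
  (forall x, x \in s -> forall p, alternating_multilinear (x.1 p)) ->
  (forall x, x \in s -> forall p, alternating_multilinear (x.2 p)) ->
  \sum_(x <- s) cross (x.1 \ot x.2) = 0 -> \sum_(x <- s) x.1 \ot x.2 = 0.
Proof.
move=> a1 a2 H.
apply: (@tens_sum_eq0 R _ _ (M * seq 'rV[R]_m)%type (fun i w => w i.1 i.2)) => //.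
  by move=> v h; apply/funext => p; apply/funext => vs; exact: (h (p, vs)).
move=> [p vs]; apply/funext => q; apply/funext => us; rewrite !fct_sumE /=.
have /(congr1 (fun w : dform MN => w (p, q)
  ([seq rowl n v | v <- vs] ++ [seq rowr m u | u <- us]))) := H.
rewrite !fct_sumE => e; rewrite -[RHS]e; apply: eq_big_seq => x xs.
by rewrite crossE crossv_split //; [exact: a1|exact: a2].
Qed.

Lemma smooth_cross (W : set M) (W' : set N) (w : dform M) (h : dform N) :
  open W -> open W' -> smooth_form W w -> smooth_form W' h ->
  smooth_form (W `*` W' : set MN) (cross (w \ot h)).
Proof.
move=> oW oW' sw sh; have oWW := open_prod oW oW'.
rewrite cross_tens; apply: (smooth_form_wedge sMN) => //.
  apply: (smooth_pull sMN sM oWW oW _ _ sw); first exact: smooth_fst.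
  by move=> p [].
apply: (smooth_pull sMN sN oWW oW' _ _ sh); first exact: smooth_snd.
by move=> p [].
Qed.

Lemma extd_cross (W : set M) (W' : set N) (w : dform M) (h : dform N) (q : MN) :
  open W -> open W' -> smooth_form W w -> smooth_form W' h -> W q.1 -> W' q.2 ->
  extd setT (cross (w \ot h)) q =
  (cross (extd setT w \ot h) + cross (gsgn 1 w \ot extd setT h)) q.
Proof.
move=> oW oW' sw sh Wq Wq'; have oWW := open_prod oW oW'.
have fWW (p : MN) : (W `*` W') p -> W p.1 by case.
have sWW (p : MN) : (W `*` W') p -> W' p.2 by case.
have sf := smooth_fst sM sN oWW; have ss := smooth_snd sM sN oWW.
have s1 := smooth_pull sMN sM oWW oW sf fWW sw.
have s2 := smooth_pull sMN sN oWW oW' ss sWW sh.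
have WWq : (W `*` W') q by [].
rewrite !cross_tens (extd_wedge sMN s1 s2 WWq).
rewrite !fctE !wedgeE pull_gsgn.
rewrite (extd_pull sMN sM oWW sf fWW sw WWq).
by rewrite (extd_pull sMN sN oWW ss sWW sh WWq).
Qed.

Lemma gsgn_cross (w : dform M) (h : dform N) :
  gsgn 1 (cross (w \ot h)) = cross (gsgn 1 w \ot gsgn 1 h).
Proof. by rewrite !cross_tens gsgn_wedge -!pull_gsgn. Qed.

End Cross.

(** * The coproduct of polynomial forms *)

Section PolynomialForms.
Variables (R : realType) (m : nat) (G : alg_group R m).
Let sG : smooth_atlas G := manifold_atlas (gspace_manifold G).
Local Notation GG := (prod_charted G G).
Let sGG : smooth_atlas GG := prod_atlas sG sG.
Local Notation mu := (fun p : GG => gmul p.1 p.2).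

Lemma Omega0 : Omega (0 : dform G).
Proof.
have := Omega_lin (-1) (@Omega_one R m G) (@Omega_one R m G).
by rewrite scaleN1r addNr.
Qed.

Lemma OmegaZ (k : R) (w : dform G) : Omega w -> Omega (k *: w).
Proof. by move=> hw; rewrite -[_ *: _]addr0; apply: Omega_lin => //; exact: Omega0. Qed.

Lemma OmegaD (w w' : dform G) : Omega w -> Omega w' -> Omega (w + w').
Proof. by move=> hw hw'; rewrite -[w]scale1r; exact: Omega_lin. Qed.

Lemma Omega_smooth (w : dform G) : Omega w -> smooth_form setT w.
Proof.
elim=> {w} [i j||k w w' _ sw _ sw'|w w' _ sw _ sw'|w _ sw].
- apply: (smooth_fun_form openT) => c ac.
  have oE := open_img_chart sG ac (@openT G).
  rewrite setTI => k; have := (Ck_mxP k _ (sat_open sG ac).2).1 (rho_smooth ac k).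
  exact.
- by apply: (smooth_fun_form openT) => c ac k; exact: Ck_cst.
- exact: (smooth_form_linear sG k openT sw sw').
- exact: (smooth_form_wedge sG openT sw sw').
- by have /is_formP[] := extd_is_form sG openT sw.
Qed.

Lemma Omega_alternating (w : dform G) p : Omega w -> alternating_multilinear (w p).
Proof. by move=> /Omega_smooth[]. Qed.

Lemma Omega_gsgn (w : dform G) : Omega w -> Omega (gsgn 1 w).
Proof.
elim=> {w} [i j||k w w' _ sw _ sw'|w w' _ sw _ sw'|w hw sw].
- have -> : gsgn 1 (fun_form (fun g => rho g i j)) = fun_form (fun g => rho g i j) :> dform G.
    apply/funext => p; apply/funext => -[|v vs]; rewrite /gsgn /fun_form /= ?mulr0 //.
    by rewrite muln0 expr0 mul1r.
  exact: Omega_coord.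
- have -> : gsgn 1 (fun_form (fun=> 1)) = fun_form (fun=> 1) :> dform G.
    apply/funext => p; apply/funext => -[|v vs]; rewrite /gsgn /fun_form /= ?mulr0 //.
    by rewrite muln0 expr0 mul1r.
  exact: Omega_one.
- by rewrite gsgn_linear; exact: Omega_lin.
- by rewrite gsgn_wedge; exact: Omega_wedge.
- have -> : gsgn 1 (extd setT w) = -1 *: extd setT (gsgn 1 w).
    apply/funext => p; rewrite -[RHS]/(-1 *: extd setT (gsgn 1 w) p).
    rewrite (extd_gsgn sG (Omega_smooth hw)) //.
    by rewrite scaleN1r opprK.
  by apply: OmegaZ; exact: Omega_d.
Qed.

Local Notation OO := (tens_span (@Omega R m G) (@Omega R m G)).

Lemma OO_Z (k : R) t : OO t -> OO (k *: t).
Proof. by apply: tens_spanZ => v; exact: OmegaZ. Qed.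

Lemma cross_OO_inj : {in OO &, injective (@cross R m m G G)}.
Proof.
move=> t t'; rewrite !inE => ht ht' e; apply/eqP; rewrite -subr_eq0; apply/eqP.
have h : OO (t - t').
  by rewrite addrC -scaleN1r; apply: tens_spanD => //; exact: OO_Z.
have e0 : cross (t - t') = 0 by rewrite addrC -scaleN1r cross_linear e scaleN1r addNr.
case: h e0 => s [hs ->]; rewrite cross_sum; apply: (cross_inj sG sG) => x xs p.
  by apply: Omega_alternating; case: (hs x xs).
by apply: Omega_alternating; case: (hs x xs).
Qed.

(** The image of Omega_G (x) Omega_G in the forms on G x G. *)
Definition poly2 (w : dform GG) : Prop := exists2 t, OO t & cross t = w.

Lemma poly2_cross a b : Omega a -> Omega b -> poly2 (cross (a \ot b)).
Proof. by exists (a \ot b) => //; exact: tens_span_tens. Qed.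

Lemma poly2D w w' : poly2 w -> poly2 w' -> poly2 (w + w').
Proof.
move=> [t ht <-] [t' ht' <-]; exists (t + t'); first exact: tens_spanD.
by rewrite crossD.
Qed.

Lemma poly2Z (k : R) w : poly2 w -> poly2 (k *: w).
Proof. by move=> [t ht <-]; exists (k *: t); [exact: OO_Z|rewrite crossZ]. Qed.

Lemma poly2_sum (I : eqType) (r : seq I) (F : I -> dform GG) :
  (forall i, i \in r -> poly2 (F i)) -> poly2 (\sum_(i <- r) F i).
Proof.
move=> h; rewrite big_seq; elim/big_ind: _ => //; last exact: poly2D.
by exists 0; [exact: tens_span0|exact: cross0].
Qed.

(** Exchanging the two inner factors of (a x b) (c x d) takes the graded sign of
    b and c, which is written with the even and odd parts of b. *)
Lemma poly2_wedge_pure (a b c d : dform G) :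
  Omega a -> Omega b -> Omega c -> Omega d ->
  poly2 (wedge (cross (a \ot b)) (cross (c \ot d))).
Proof.
move=> ha hb hc hd; have hb' := Omega_gsgn hb; have hc' := Omega_gsgn hc.
have -> : wedge (cross (a \ot b)) (cross (c \ot d)) =
    2^-1 *: (cross (wedge a c \ot wedge (b + gsgn 1 b) d) +
             cross (wedge a (gsgn 1 c) \ot wedge (b - gsgn 1 b) d)).
  rewrite !cross_tens !pull_wedge.
  set a' := pull _ a; set b' := pull _ b; set c' := pull _ c; set d' := pull _ d.
  have -> : pull (M := GG) snd (b + gsgn 1 b) = b' + gsgn 1 b' by rewrite -pull_gsgn.
  have -> : pull (M := GG) snd (b - gsgn 1 b) = b' - gsgn 1 b' by rewrite -pull_gsgn.
  rewrite pull_gsgn -/c' -[wedge (wedge a' b') _]scale1r.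
  rewrite -[X in X *: _ = _](@mulVf R 2) // -scalerA; congr (_ *: _).
  rewrite !wedgeA -wedgeDr -wedgeZr; congr wedge.
  by rewrite -!(wedgeA _ _ d') -wedgeDl -wedgeC2 wedgeZl.
apply: poly2Z; apply: poly2D; apply: poly2_cross; apply: Omega_wedge => //.
  exact: OmegaD.
by rewrite addrC -scaleN1r; exact: Omega_lin.
Qed.

Lemma poly2_wedge w w' : poly2 w -> poly2 w' -> poly2 (wedge w w').
Proof.
move=> [_ [s [hs ->]] <-] [_ [s' [hs' ->]] <-].
rewrite !cross_sum wedge_suml; apply: poly2_sum => x /hs[hx1 hx2].
rewrite wedge_sumr; apply: poly2_sum => y /hs'[hy1 hy2].
exact: poly2_wedge_pure.
Qed.

Lemma poly2_extd w : poly2 w -> poly2 (extd setT w).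
Proof.
move=> [_ [s [hs ->]] <-]; rewrite cross_sum.
have oTT : open (setT `*` setT : set GG) by apply: open_prod; exact: openT.
have -> : extd setT (\sum_(x <- s) cross (x.1 \ot x.2)) =
    \sum_(x <- s) (cross (extd setT x.1 \ot x.2) + cross (gsgn 1 x.1 \ot extd setT x.2)).
  apply/funext => q; rewrite [RHS]sum_dformE (extd_sum sGG oTT) //; last first.
    move=> x /hs[h1 h2]; apply: (smooth_cross sG sG); try exact: openT.
      exact: Omega_smooth.
    exact: Omega_smooth.
  apply: eq_big_seq => x /hs[h1 h2].
  exact: (extd_cross sG sG (@openT G) (@openT G) (Omega_smooth h1) (Omega_smooth h2)).
apply: poly2_sum => x /hs[h1 h2]; apply: poly2D; apply: poly2_cross => //.
- exact: Omega_d.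
- exact: Omega_gsgn.
- exact: Omega_d.
Qed.

Lemma smooth_mul : smooth_map (setT : set GG) mu.
Proof. exact: gmul_smooth. Qed.

(** The pullback along the product commutes with sums, products and d, so that
    it suffices to look at the coordinate functions, whose pullbacks are given by
    matrix multiplication. *)
Lemma pull_mul_poly2 (w : dform G) : Omega w -> poly2 (pull (M := GG) mu w).
Proof.
elim=> {w} [i j||k w w' _ h _ h'|w w' _ h _ h'|w hw h].
- have -> : pull (M := GG) mu (fun_form (fun g => rho g i j)) =
      \sum_k cross ((fun_form (fun g => rho g i k) : dform G) \ot
                    (fun_form (fun g => rho g k j) : dform G)).
    rewrite pull_fun_form; apply/funext => p; rewrite fct_sumE.
    apply/funext => vs; rewrite fct_sumE /fun_form.
    case: vs => [|v vs] /=.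
      rewrite rhoM mxE; apply: eq_bigr => k _.
      by rewrite cross_tens !pull_fun_form wedge_fun_form.
    by rewrite big1 // => k _; rewrite cross_tens !pull_fun_form wedge_fun_form.
  by apply: poly2_sum => k _; apply: poly2_cross; exact: Omega_coord.
- have -> : pull (M := GG) mu (fun_form (fun=> 1)) =
      cross ((fun_form (fun=> 1) : dform G) \ot (fun_form (fun=> 1) : dform G)).
    rewrite cross_tens !pull_fun_form wedge_fun_form; congr fun_form.
    by apply/funext => p /=; rewrite mulr1.
  by apply: poly2_cross; exact: Omega_one.
- by apply: (poly2D _ h'); exact: poly2Z.
- by rewrite pull_wedge; exact: poly2_wedge.
- have -> : pull (M := GG) mu (extd setT w) = extd setT (pull (M := GG) mu w).
    apply/funext => p.
    exact/esym/(extd_pull sGG sG openT smooth_mul (fun _ _ => I) (Omega_smooth hw)).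
  exact: poly2_extd.
Qed.

Lemma coprodP (w : dform G) : Omega w ->
  OO (coprod w) /\ cross (coprod w) = pull (M := GG) mu w.
Proof.
move=> /pull_mul_poly2[t ht e]; rewrite /coprod -e.
by rewrite pinvKV //; [exact: cross_OO_inj|rewrite inE].
Qed.

End PolynomialForms.

(** * Translations in the fibres *)

Section Translation.
Variables (R : realType) (m n : nat) (G : alg_group R m) (X : charted R n).
Hypothesis sX : smooth_atlas X.
Let sG : smooth_atlas G := manifold_atlas (gspace_manifold G).
Local Notation GG := (prod_charted G G).
Local Notation GX := (prod_charted G X).
Let sGG : smooth_atlas GG := prod_atlas sG sG.
Let sGX : smooth_atlas GX := prod_atlas sG sX.

Lemma gmulg1 (g : G) : gmul g (gone G) = g.
Proof.
have mulgV (x : G) : gmul x (ginv x) = gone G.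
  rewrite -[LHS]gmul1g -{1}(gmulVg (ginv x)) -gmulA (gmulA (ginv x)) gmulVg.
  by rewrite gmul1g gmulVg.
by rewrite -(gmulVg g) gmulA mulgV gmul1g.
Qed.

Definition translate (f : X -> G) : GX -> GX := fun q => (gmul q.1 (f q.2), q.2).

Lemma smooth_translate (W : set X) (f : X -> G) : open W -> smooth_map W f ->
  smooth_map (setT `*` W : set GX) (translate f).
Proof.
move=> oW sf; have oT : open (setT `*` W : set GX) by apply: open_prod => //; exact: openT.
have s1 := smooth_fst sG sX oT; have s2 := smooth_snd sG sX oT.
have s3 : smooth_map (N := G) (setT `*` W : set GX) (f \o snd).
  by apply: (smooth_map_comp sGX sX sG oT oW _ s2 sf) => q [].
have s4 := smooth_pair sG sG sGX oT s1 s3.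
have s5 := smooth_map_comp sGX sGG sG oT openT (fun _ _ => I) s4 (gmul_smooth G).
exact: (smooth_pair sG sX sGX oT s5 s2).
Qed.

(** The translation by f in the fibres is, on the factor G, the product of G
    composed with (id, f); hence the coproduct computes the pullback. *)
Lemma pull_translate (W : set X) (f : X -> G) (w : dform G) (h : dform X)
    (s : seq (dform G * dform G)) (q : GX) :
  open W -> smooth_map W f -> W q.2 ->
  cross (\sum_(x <- s) x.1 \ot x.2) =
    pull (M := GG) (fun p : GG => gmul p.1 p.2) w ->
  pull (translate f) (cross (w \ot h)) q =
  \sum_(x <- s) cross (x.1 \ot wedge (pull f x.2) h) q.
Proof.
move=> oW sf Wq e.
have oT : open (setT `*` W : set GX) by apply: open_prod => //; exact: openT.
have Tq : (setT `*` W : set GX) q by [].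
have st := smooth_translate oW sf.
have s1 := smooth_fst sG sX oT; have s2 := smooth_snd sG sX oT.
have s3 : smooth_map (N := G) (setT `*` W : set GX) (f \o snd).
  by apply: (smooth_map_comp sGX sX sG oT oW _ s2 sf) => p [].
pose th : GX -> GG := fun q => (q.1, (f \o snd) q).
have s4 : smooth_map (setT `*` W : set GX) th by exact: smooth_pair.
have sfG := smooth_fst sG sG (@openT GG); have ssG := smooth_snd sG sG (@openT GG).
have sfX := smooth_fst sG sX (@openT GX); have ssX := smooth_snd sG sX (@openT GX).
rewrite cross_tens pull_wedge wedgeE.
rewrite -(pull_comp h sGX sGX sX oT openT st ssX Tq I).
rewrite -(pull_comp w sGX sGX sG oT openT st sfX Tq I).
have -> : pull ((fst : GX -> G) \o translate f) w q =
    pull ((fun p : GG => gmul p.1 p.2) \o th) w q by [].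
rewrite (pull_comp w sGX sGG sG oT openT s4 (gmul_smooth G) Tq I) -e cross_sum.
have -> : pull th (\sum_(x <- s) cross (x.1 \ot x.2)) q =
    \sum_(x <- s) pull th (cross (x.1 \ot x.2)) q.
  rewrite /pull sum_dformE; elim: (s) => [|x r IH]; first by rewrite !big_nil.
  by rewrite !big_cons -IH.
have wsum (r : seq (dform G * dform G)) (F : dform G * dform G -> seq 'rV[R]_(m + n) -> R^o) c :
    cov_wedge (\sum_(x <- r) F x) c = \sum_(x <- r) cov_wedge (F x) c.
  elim: r => [|x r IH]; first by rewrite !big_nil cov_wedge0l.
  by rewrite !big_cons cov_wedgeDl IH.
rewrite wsum; apply: eq_bigr => x _.
rewrite !cross_tens !pull_wedge !wedgeE.
have e1 : pull th (pull (M := GG) (N := G) fst x.1) q = pull (M := GX) fst x.1 q.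
  exact/esym/(pull_comp x.1 sGX sGG sG oT openT s4 sfG Tq I).
have e2 : pull th (pull (M := GG) (N := G) snd x.2) q =
    pull (M := GX) (N := G) (f \o snd) x.2 q.
  exact/esym/(pull_comp x.2 sGX sGG sG oT openT s4 ssG Tq I).
have e3 := pull_comp x.2 sGX sX sG oT oW s2 sf Tq Wq.
have e4 : pull (M := GX) (N := X) (snd \o translate f) h q = pull (M := GX) snd h q by [].
have assoc (a a' b b' c c' : seq 'rV[R]_(m + n) -> R^o) : a = a' -> b = b' -> c = c' ->
    cov_wedge (cov_wedge a b) c = cov_wedge a' (cov_wedge b' c').
  by move=> -> -> ->; exact: cov_wedgeA.
exact (assoc _ _ _ _ _ _ e1 (etrans e2 e3) e4).
Qed.

(** The counit axiom, read off from the translation by the unit. *)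
Lemma cross_counit (w : dform G) (h : dform X) (s : seq (dform G * dform G)) (q : GX) :
  (forall x, x \in s -> alternating_multilinear (x.2 (gone G))) ->
  cross (\sum_(x <- s) x.1 \ot x.2) =
    pull (M := GG) (fun p : GG => gmul p.1 p.2) w ->
  cross (w \ot h) q = \sum_(x <- s) cross (x.1 \ot (counit x.2 *: h)) q.
Proof.
move=> alt e.
have sc : smooth_map (N := G) (setT : set X) (fun=> gone G).
  exact: (smooth_map_cst _ sX sG openT).
have := pull_translate h openT sc (I : setT q.2) e.
have -> : translate (fun=> gone G) = id.
  by apply/funext => -[g x]; rewrite /translate /= gmulg1.
rewrite pull_id // => ->; apply: eq_big_seq => x xs.
rewrite !(crossE sG sX); congr crossv.
rewrite wedgeE (pull_cst _ (alt x xs)) -wedgeE.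
rewrite -[RHS]/(counit x.2 *: h q.2) -{2}(wedge1form h).
by rewrite -[LHS]/((wedge _ h) q.2) wedgeE -[LHS]wedgeE wedgeZl.
Qed.

End Translation.

(** * Cech cochains *)

Section CechCochains.
Variables (R : realType) (n : nat) (M : charted R n).
Variables (d : Order.disp_t) (A : finOrderType d) (U : A -> set M).
Hypotheses (sM : smooth_atlas M) (oU : forall a, open (U a)).
Implicit Types (s t : seq A) (h : cochain M A).

Lemma open_inter s : open (inter U s).
Proof.
elim: s => [|a s IH].
  by have -> : inter U [::] = setT; [apply/seteqP; split|exact: openT].
have -> : inter U (a :: s) = U a `&` inter U s; last exact: openI.
apply/seteqP; split=> [p h|p [ha hs] b].
  by split=> [|b bs]; apply: h; rewrite ?mem_head // in_cons bs orbT.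
by rewrite in_cons => /orP[/eqP->//|/hs].
Qed.

Lemma inter_sub s t : {subset t <= s} -> inter U s `<=` inter U t.
Proof. by move=> ts p h a /ts; exact: h. Qed.

Lemma del_subseq i s : subseq (del i s) s.
Proof.
rewrite /del -{3}(cat_take_drop i s); apply: cat_subseq => //.
by rewrite -addn1 addnC -drop_drop; exact: drop_subseq.
Qed.

Lemma inter_del i s : inter U s `<=` inter U (del i s).
Proof. by apply: inter_sub => a; exact: (mem_subseq (del_subseq i s)). Qed.

Lemma cech_nochain h s : cech U h -> ~~ chain s -> h s = 0.
Proof. by move=> /(_ s); case: (chain s). Qed.

Lemma cech_smooth h s : cech U h -> smooth_form (inter U s) (h s).
Proof.
move=> /(_ s); case: (chain s) => [/is_formP[]//|->].
exact: smooth_form0.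
Qed.

Lemma cech_out h s p : cech U h -> ~ inter U s p -> h s p = 0.
Proof.
by move=> /(_ s); case: (chain s) => [/is_formP[+ _]|-> //]; exact.
Qed.

Lemma is_form0 (W : set M) : is_form W (0 : dform M).
Proof. by apply/is_formP; split=> //; exact: smooth_form0. Qed.

Lemma is_formD (W : set M) w w' : open W -> is_form W w -> is_form W w' -> is_form W (w + w').
Proof.
move=> oW /is_formP[z s] /is_formP[z' s']; apply/is_formP; split.
  by move=> p np; rewrite -[LHS]/(w p + w' p) z // z' // addr0.
by rewrite -[w]scale1r; exact: smooth_form_linear.
Qed.

Lemma is_formZ (W : set M) (k : R) w : open W -> is_form W w -> is_form W (k *: w).
Proof.
move=> oW /is_formP[z s]; apply/is_formP; split.
  by move=> p np; rewrite -[LHS]/(k *: w p) z // scaler0.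
by rewrite -[_ *: _]addr0; apply: smooth_form_linear => //; exact: smooth_form0.
Qed.

Lemma is_form_sum (W : set M) (I : finType) (F : I -> dform M) : open W ->
  (forall i, is_form W (F i)) -> is_form W (\sum_i F i).
Proof.
move=> oW h; elim/big_ind: _ => //; first exact: is_form0.
by move=> a b; exact: is_formD.
Qed.

Lemma cech_D_nochain_at h s p : ~~ chain s -> inter U s p ->
  cech_D U h s p = extd setT (h s) p.
Proof.
move=> cs Up; rewrite /cech_D /cech_delta (negbTE cs) addr0 extd_restr.
exact: restr_in.
Qed.

Lemma cech_D_at h s p : chain s -> inter U s p ->
  cech_D U h s p = extd setT (h s) p + \sum_(i < size s) (-1) ^+ i *: grade (h (del i s) p).
Proof.
move=> cs Up; rewrite /cech_D /cech_delta cs.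
rewrite -[LHS]/(extd (inter U s) (h s) p + (\sum_(i < size s) _) p).
rewrite extd_restr restr_in // sum_dformE; congr (_ + _); apply: eq_bigr => i _.
by rewrite -gsgn1E -[LHS]/(_ *: restr _ _ p) restr_in.
Qed.

Lemma cech_D_out h s p : ~ inter U s p -> cech_D U h s p = 0.
Proof.
move=> Up; rewrite /cech_D /cech_delta.
rewrite -[LHS]/(extd (inter U s) (h s) p + (if chain s then \sum_(i < size s) _ else 0) p).
rewrite extd_restr restr_out // add0r; case: (chain s) => //.
rewrite sum_dformE big1 // => i _.
by rewrite -[LHS]/(_ *: restr _ _ p) restr_out // scaler0.
Qed.

Lemma cech_D_nochain h s : h s = 0 -> ~~ chain s -> cech_D U h s = 0.
Proof.
move=> h0 ns; apply/funext => p.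
have [Up|Up] := pselect (inter U s p); last by rewrite cech_D_out.
by rewrite cech_D_nochain_at // h0 extd0.
Qed.

Lemma cech_cech_D h : cech U h -> cech U (cech_D U h).
Proof.
move=> ch s; case: ifPn => [cs|ncs]; last first.
  by apply: cech_D_nochain => //; exact: cech_nochain.
have oI := open_inter s; rewrite /cech_D; apply: is_formD => //.
  exact: extd_is_form (cech_smooth s ch).
rewrite /cech_delta cs; apply: is_form_sum => // i; apply: is_formZ => //.
apply: (restr_is_form sM oI (@inter_del i s)).
by apply: smooth_form_gsgn; [|exact: open_inter|exact: cech_smooth].
Qed.

Lemma cech_cup h h' : cech U h -> cech U h' -> cech U (cup U h h').
Proof.
move=> ch ch' s; rewrite /cup; case: (chain s) => //; have oI := open_inter s.
apply: is_form_sum => // p; apply: (restr_is_form sM oI (@subset_refl _ _)).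
apply: (smooth_form_wedge sM oI).
  apply: smooth_form_sub (cech_smooth _ ch).
  by apply: inter_sub => a; exact: mem_take.
apply: (smooth_form_gsgn sM _ oI).
apply: smooth_form_sub (cech_smooth _ ch').
by apply: inter_sub => a; exact: mem_drop.
Qed.

Lemma cech_D_add h h' : (forall s, smooth_form (inter U s) (h s)) ->
  (forall s, smooth_form (inter U s) (h' s)) ->
  cech_D U (h + h') = cech_D U h + cech_D U h'.
Proof.
move=> sh sh'; apply/funext => s; apply/funext => p.
rewrite -[RHS]/(cech_D U h s p + cech_D U h' s p).
have [Up|Up] := pselect (inter U s p); last by rewrite !cech_D_out // addr0.
have e : extd setT ((h + h') s) p = extd setT (h s) p + extd setT (h' s) p.
  rewrite -[(h + h') s]/(h s + h' s) -[h s]scale1r.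
  by rewrite (extd_linear sM 1 (sh s) (sh' s) Up) !scale1r.
case: (boolP (chain s)) => cs; last by rewrite !cech_D_nochain_at.
rewrite !cech_D_at // e addrACA -big_split /=.
congr (_ + _); apply: eq_bigr => i _.
by rewrite -[(h + h') _ p]/(h (del i s) p + h' (del i s) p) gradeD scalerDr.
Qed.

End CechCochains.

(** * The twisted differential *)

Section CrossvLinear.
Variables (R : realType) (m n : nat).
Implicit Types (f : seq 'rV[R]_m -> R^o) (g : seq 'rV[R]_n -> R^o).

Lemma crossvPr (k : R) f g g' : crossv f (k *: g + g') = k *: crossv f g + crossv f g'.
Proof. by rewrite /crossv -cov_wedge_linearr. Qed.

Lemma crossv0r f : crossv f (0 : seq 'rV[R]_n -> R^o) = 0.
Proof. exact: cov_wedge0r. Qed.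

Lemma crossvDr f g g' : crossv f (g + g') = crossv f g + crossv f g'.
Proof. by have := crossvPr 1 f g g'; rewrite !scale1r. Qed.

Lemma crossvZr (k : R) f g : crossv f (k *: g) = k *: crossv f g.
Proof. by have := crossvPr k f g 0; rewrite crossv0r !addr0. Qed.

Lemma crossv_sumr (I : Type) (r : seq I) f (F : I -> seq 'rV[R]_n -> R^o) :
  crossv f (\sum_(i <- r) F i) = \sum_(i <- r) crossv f (F i).
Proof.
elim: r => [|i r IH]; first by rewrite !big_nil crossv0r.
by rewrite !big_cons crossvDr IH.
Qed.

Lemma precomp_sum (A : 'rV[R]_m -> 'rV[R]_n) (I : Type) (r : seq I)
    (F : I -> seq 'rV[R]_n -> R^o) :
  precomp A (\sum_(i <- r) F i) = \sum_(i <- r) precomp A (F i).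
Proof.
elim: r => [|i r IH]; first by rewrite !big_nil.
by rewrite !big_cons -IH.
Qed.

End CrossvLinear.

Section TwistedDifferential.
Variables (R : realType) (m n k : nat) (G : alg_group R m) (X : charted R n).
Hypothesis sX : smooth_atlas X.
Variables (P : principal_bundle k G X).
Variables (d : Order.disp_t) (A : finOrderType d) (U : A -> set X).
Hypothesis oU : forall a, open (U a).
Variable T : trivialization P U.
Local Notation GX := (prod_charted G X).
Local Notation V := (pcover (P := P) U).
Let sG : smooth_atlas G := manifold_atlas (gspace_manifold G).
Let sP : smooth_atlas P := manifold_atlas (total_manifold P).
Let sGX : smooth_atlas GX := prod_atlas sG sX.
Implicit Types (w : dform G) (h : cochain X A) (s : seq A) (a b : A) (p : P).

Lemma open_pcover a : open (V a).
Proof.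
have := open_preimage (W := (setT : set P)) (f := @bproj _ _ _ _ _ _ P) openT
  (fun p _ => smooth_map_cont (bproj_smooth P) I) (oU a).
by rewrite setTI.
Qed.

Let oV s : open (inter V s) := open_inter open_pcover s.

Lemma inter_triv s a p : inter V s p -> a \in s ->
  (triv T a p).2 = bproj p /\ inter U s (triv T a p).2.
Proof.
move=> Vp as_; have Va : U a (bproj p) by exact: Vp.
by rewrite triv_proj.
Qed.

(** The transition function at x is the G-component, in the trivialization b, of
    the point with coordinates (1, x) in the trivialization a. *)
Lemma smooth_trans a b : smooth_map (U a `&` U b) (trans T a b).
Proof.
have oW : open (U a `&` U b) by exact: openI.
have sc : smooth_map (N := G) (U a `&` U b) (fun=> gone G) by exact: smooth_map_cst.
have si := smooth_map_id sX oW.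
have s1 : smooth_map (N := GX) (U a `&` U b) (fun x => (gone G, x)) by exact: smooth_pair.
pose W : set GX := setT `*` (U a `&` U b).
have oW2 : open W by apply: open_prod => //; exact: openT.
have s2 : smooth_map W (trivV T a).
  by apply: smooth_map_sub (trivV_smooth T a) => q [_ []].
have m1 x : (U a `&` U b) x -> W (gone G, x) by [].
have s12 := smooth_map_comp sX sGX sP oW oW2 m1 s1 s2.
have s3 := triv_smooth T b.
have m12 x : (U a `&` U b) x -> U b (bproj ((trivV T a \o (fun x => (gone G, x))) x)).
  by move=> [ax bx]; rewrite /= trivV_proj.
have s123 := smooth_map_comp sX sP sGX oW (open_pcover b) m12 s12 s3.
have s4 := smooth_map_comp sX sGX sG oW openT (fun _ _ => I) s123
  (smooth_fst sG sX (@openT GX)).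
apply: (smooth_map_congr sX sG oW _ s4) => x [ax bx] /=.
by rewrite transE //= gmul1g.
Qed.

Lemma triv_translate a b p : V a p -> V b p ->
  triv T b p = translate (trans T a b) (triv T a p).
Proof.
move=> ap bp; rewrite -{1}(trivK T ap).
have h := triv_proj T ap.
rewrite [triv T a p]surjective_pairing transE ?h //.
Qed.

Definition nablaV_pure w h : cochain P A := fun s =>
  if chain s then
    if s is a :: _ then restr (inter V s) (pull (triv T a) (cross (w \ot h s))) else 0
  else 0.

Lemma restr_linear l (M : charted R l) (W : set M) (c : R) (w w' : dform M) :
  restr W (c *: w + w') = c *: restr W w + restr W w'.
Proof.
apply/funext => p; apply/funext => vs.
rewrite -[RHS]/(c * restr W w p vs + restr W w' p vs) /restr.
by case: (p \in W) => //; rewrite mulr0 addr0.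
Qed.

Lemma nablaV_pure_bilin : bilin nablaV_pure.
Proof.
split=> [h c w w'|w c h h']; apply/funext => s.
  rewrite -[RHS]/(c *: nablaV_pure w h s + nablaV_pure w' h s) /nablaV_pure.
  case: (chain s); last by rewrite scaler0 addr0.
  case: s => [|a s]; first by rewrite scaler0 addr0.
  by rewrite tensDl tensZl cross_linear -restr_linear.
rewrite -[RHS]/(c *: nablaV_pure w h s + nablaV_pure w h' s) /nablaV_pure.
case: (chain s); last by rewrite scaler0 addr0.
case: s => [|a s]; first by rewrite scaler0 addr0.
have -> : (c *: h + h') (a :: s) = c *: h (a :: s) + h' (a :: s) by [].
by rewrite tensDr tensZr cross_linear -restr_linear.
Qed.

Lemma nablaV_tens w h : nablaV T (w \ot h) = nablaV_pure w h.
Proof. by rewrite /nablaV tlift_tens //; exact: nablaV_pure_bilin. Qed.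

Lemma nablaV_linear (c : R) t t' : nablaV T (c *: t + t') = c *: nablaV T t + nablaV T t'.
Proof. by rewrite /nablaV tlift_linear //; exact: nablaV_pure_bilin. Qed.

Lemma nablaV_sum (r : seq (dform G * cochain X A)) :
  nablaV T (\sum_(x <- r) x.1 \ot x.2) = \sum_(x <- r) nablaV_pure x.1 x.2.
Proof. by rewrite /nablaV tlift_sum //; exact: nablaV_pure_bilin. Qed.

Lemma nablaV_pure_at w h a s p : chain (a :: s) -> inter V (a :: s) p ->
  nablaV_pure w h (a :: s) p =
  precomp (tmap (triv T a) p) (crossv (w (triv T a p).1) (h (a :: s) (triv T a p).2)).
Proof.
move=> cs Vp; rewrite /nablaV_pure cs restr_in //.
by rewrite -(crossE sG sX).
Qed.

Lemma nablaV_pure_out w h s p : ~ inter V s p -> nablaV_pure w h s p = 0.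
Proof.
by move=> Vp; rewrite /nablaV_pure; case: (chain s) => //; case: s Vp => // a s Vp; rewrite restr_out.
Qed.

Lemma nablaV_pure_nochain w h s : ~~ chain s -> nablaV_pure w h s = 0.
Proof. by rewrite /nablaV_pure => /negbTE ->. Qed.

Lemma smooth_trivialized w h a s : Omega w -> cech U h ->
  smooth_form (inter V (a :: s)) (pull (triv T a) (cross (w \ot h (a :: s)))).
Proof.
move=> hw ch; have oI := open_inter oU (a :: s).
have oTI : open (setT `*` inter U (a :: s) : set GX) by apply: open_prod => //; exact: openT.
apply: (smooth_pull sP sGX (oV (a :: s)) oTI).
- apply: smooth_map_sub (triv_smooth T a) => p; apply; exact: mem_head.
- by move=> p Vp; split=> //; case: (inter_triv Vp (mem_head a s)).
- apply: (smooth_cross sG sX) => //; first exact: openT.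
    exact: Omega_smooth.
  exact: (cech_smooth (a :: s) ch).
Qed.

Lemma smooth_nablaV_pure w h s : Omega w -> cech U h -> smooth_form (inter V s) (nablaV_pure w h s).
Proof.
move=> hw ch; rewrite /nablaV_pure; case: (chain s); last exact: smooth_form0.
case: s => [|a s]; first exact: smooth_form0.
have /is_formP[_] := restr_is_form sP (oV (a :: s)) (@subset_refl _ _)
  (smooth_trivialized a s hw ch).
exact.
Qed.

Lemma extd_nablaV_pure w h a s p : Omega w -> cech U h -> chain (a :: s) -> inter V (a :: s) p ->
  extd setT (nablaV_pure w h (a :: s)) p =
  precomp (tmap (triv T a) p)
    (crossv (extd setT w (triv T a p).1) (h (a :: s) (triv T a p).2) +
     crossv (grade (w (triv T a p).1)) (extd setT (h (a :: s)) (triv T a p).2)).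
Proof.
move=> hw ch cs Vp; have oI := open_inter oU (a :: s).
have oTI : open (setT `*` inter U (a :: s) : set GX) by apply: open_prod => //; exact: openT.
rewrite (extd_local sP (oV (a :: s)) (w' := pull (triv T a) (cross (w \ot h (a :: s)))) Vp);
  last by move=> q Vq; rewrite /nablaV_pure cs restr_in.
have st : smooth_map (inter V (a :: s)) (triv T a).
  by apply: smooth_map_sub (triv_smooth T a) => q; apply; exact: mem_head.
have fW q : inter V (a :: s) q -> (setT `*` inter U (a :: s) : set GX) (triv T a q).
  by move=> Vq; split=> //; case: (inter_triv Vq (mem_head a s)).
have sc : smooth_form (setT `*` inter U (a :: s) : set GX) (cross (w \ot h (a :: s))).
  apply: (smooth_cross sG sX) => //; first exact: openT.
    exact: Omega_smooth.
  exact: (cech_smooth (a :: s) ch).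
rewrite (extd_pull sP sGX (oV (a :: s)) st fW sc Vp).
have [_ Uq] := fW p Vp.
rewrite -gsgn1E -!(crossE sG sX).
have e := extd_cross sG sX (@openT G) oI (Omega_smooth hw) (cech_smooth (a :: s) ch)
  (I : setT (triv T a p).1) Uq.
by rewrite /precomp /pull; apply/funext => vs; rewrite e.
Qed.

Lemma chain_del i s : chain s -> del i s != [::] -> chain (del i s).
Proof.
move=> /andP[_ ss] n0; rewrite /chain n0 /=.
exact: (subseq_sorted lt_trans (del_subseq i s) ss).
Qed.

(** Without its first index a simplex uses the next trivialization, which is the
    first one followed by the translation by the transition function. *)
Lemma nablaV_pure_behead w h a b s p (r : seq (dform G * dform G)) :
  chain (a :: b :: s) -> inter V (a :: b :: s) p ->
  cross (\sum_(x <- r) x.1 \ot x.2) =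
    pull (fun q : prod_charted G G => gmul q.1 q.2) (gsgn 1 w) ->
  grade (nablaV_pure w h (b :: s) p) =
  precomp (tmap (triv T a) p)
    (\sum_(x <- r) crossv (x.1 (triv T a p).1)
      (cov_wedge (pull (trans T a b) x.2 (triv T a p).2)
                 (grade (h (b :: s) (triv T a p).2)))).
Proof.
move=> cs Vp e.
have cs' : chain (b :: s) by apply: (@chain_del 0 (a :: b :: s)).
have Vp' : inter V (b :: s) p by apply: inter_sub Vp => c cs2; rewrite in_cons cs2 orbT.
have Va : V a p by apply: Vp; exact: mem_head.
have Vb : V b p by apply: Vp'; exact: mem_head.
have oab : open (U a `&` U b) by exact: openI.
have oVab : open (V a `&` V b) by apply: openI; exact: open_pcover.
pose W : set GX := setT `*` (U a `&` U b).
have oW : open W by apply: open_prod => //; exact: openT.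
have st : smooth_map (V a `&` V b) (triv T a).
  by apply: smooth_map_sub (triv_smooth T a) => q [].
have str : smooth_map W (translate (trans T a b)).
  exact: (smooth_translate sX oab (smooth_trans a b)).
have Wt q : (V a `&` V b) q -> W (triv T a q).
  by move=> [qa qb]; split=> //; rewrite triv_proj.
have sft := smooth_map_comp sP sGX sGX oVab oW Wt st str.
have Wp := Wt p (conj Va Vb).
have e1 : nablaV_pure w h (b :: s) p = pull (triv T b) (cross (w \ot h (b :: s))) p.
  by rewrite /nablaV_pure cs' restr_in.
have e2 : pull (triv T b) (cross (w \ot h (b :: s))) p =
    pull (translate (trans T a b) \o triv T a) (cross (w \ot h (b :: s))) p.
  apply/esym/(pull_local _ sP sGX oVab sft (conj Va Vb)) => q [qa qb] /=.
  exact/esym/triv_translate.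
have e3 := pull_comp (cross (w \ot h (b :: s))) sP sGX sGX oVab oW st str (conj Va Vb) Wp.
rewrite e1 e2 e3 -gsgn1E -!pull_gsgn gsgn_cross.
have e4 := pull_translate sX (gsgn 1 (h (b :: s))) oab (smooth_trans a b) Wp.2 e.
rewrite -[LHS]/(precomp (tmap (triv T a) p)
  (pull (translate (trans T a b)) (cross (gsgn 1 w \ot gsgn 1 (h (b :: s)))) (triv T a p))).
rewrite e4; congr precomp; apply: eq_bigr => x _.
by rewrite (crossE sG sX) wedgeE gsgn1E.
Qed.

Lemma phi_P_out w s : size s != 2 -> phi_P T w s = 0.
Proof. by case: s => [|a [|b [|c s]]]. Qed.

Lemma cech_phi_P w : Omega w -> cech U (phi_P T w).
Proof.
move=> hw s.
have [s2|s2] := eqVneq (size s) 2; last first.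
  by rewrite phi_P_out //; case: ifP => // _; exact: is_form0.
case: s s2 => [|a [|b [|]]] // _; rewrite /chain /phi_P /= andbT.
case: (a < b)%O => //.
have oI := open_inter oU [:: a; b].
apply: (restr_is_form sX oI (@subset_refl _ _)).
apply: (smooth_form_linear sX _ oI).
  by apply: (smooth_fun_form oI) => c ac l; exact: Ck_cst.
have sub : inter U [:: a; b] `<=` U a `&` U b.
  by move=> x Ux; split; apply: Ux; rewrite !inE eqxx ?orbT.
have st := smooth_map_sub sub (@smooth_trans a b).
have sp := smooth_pull sX sG oI openT st (fun _ _ => I) (Omega_smooth hw).
rewrite -scaleN1r -[_ *: _]addr0; apply: (smooth_form_linear sX _ oI sp).
exact: smooth_form0.
Qed.

Lemma cup_phi_P1 w h a x : cup U (phi_P T w) h [:: a] x = 0.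
Proof.
rewrite /cup /chain /= big_ord_recl big_ord0 addr0 /=.
have [Ux|Ux] := pselect (inter U [:: a] x); last by rewrite restr_out.
by rewrite restr_in // wedgeE cov_wedge0l.
Qed.

Lemma cup_phi_P w h a b s x : chain (a :: b :: s) -> inter U (a :: b :: s) x ->
  cup U (phi_P T w) h (a :: b :: s) x =
  counit w *: grade (h (b :: s) x) -
  cov_wedge (pull (trans T a b) w x) (grade (h (b :: s) x)).
Proof.
move=> cs Ux; have ab : (a < b)%O by case/andP: cs => _ /= /andP[].
have Uab : inter U [:: a; b] x.
  by apply: inter_sub Ux => c; rewrite !inE => /orP[->//|->]; rewrite orbT.
rewrite /cup cs sum_dformE big_ord_recl big_ord_recl /= big1 ?addr0; last first.
  move=> i _; rewrite restr_in // wedgeE.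
  case: s cs Ux i => [|c s] cs Ux i; first by case: i.
  by rewrite /= /bump /= add1n add1n /= cov_wedge0l.
rewrite !restr_in // !wedgeE addn0 take0 ab cov_wedge0l add0r restr_in // gsgn1E.
rewrite -[X in cov_wedge X _]/(counit w *: fun_form (fun=> 1) x - pull (trans T a b) w x).
rewrite cov_wedge_linearl cov_wedgeNl; congr (_ *: _ - _).
by rewrite -gsgn1E -wedgeE wedge1form.
Qed.

Lemma cap_sum w h (r : seq (dform G * dform G)) :
  coprod (gsgn 1 w) = \sum_(x <- r) x.1 \ot x.2 ->
  cap U (phi_P T) w h = \sum_(x <- r) x.1 \ot cup U (phi_P T x.2) h.
Proof.
move=> e; rewrite /cap e tlift_sum //.
have phiL (c : R) v v' : phi_P T (c *: v + v') = c *: phi_P T v + phi_P T v'.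
  apply/funext => s; rewrite -[RHS]/(c *: phi_P T v s + phi_P T v' s).
  case: s => [|a [|b [|? ?]]] /=; rewrite ?scaler0 ?addr0 //.
  case: ifP => _; last by rewrite scaler0 addr0.
  rewrite -restr_linear; congr restr; apply/funext => x; apply/funext => vs.
  rewrite -[LHS]/((c * counit v + counit v') * _ - (c * _ + _)).
  rewrite -[RHS]/(c * (counit v * _ - _) + (counit v' * _ - _)).
  by rewrite mulrBr mulrDl mulrA opprD addrACA.
have cupL (c : R) (f f' : cochain X A) :
    cup U (c *: f + f') h = c *: cup U f h + cup U f' h.
  apply/funext => s; rewrite -[RHS]/(c *: cup U f h s + cup U f' h s) /cup.
  case: ifP => _; last by rewrite scaler0 addr0.
  rewrite scaler_sumr -big_split /=; apply: eq_bigr => i _.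
  by rewrite -restr_linear -wedge_linearl.
split=> [v' c v v2|v c v' v2].
  exact: (bilin_tens _ _).1.
by rewrite phiL cupL; exact: (bilin_tens _ _).2.
Qed.

Lemma grade_nablaV_pure w h a s p : chain (a :: s) -> inter V (a :: s) p ->
  grade (nablaV_pure w h (a :: s) p) =
  precomp (tmap (triv T a) p)
    (crossv (grade (w (triv T a p).1)) (grade (h (a :: s) (triv T a p).2))).
Proof.
move=> cs Vp; rewrite nablaV_pure_at // grade_precomp; congr precomp.
by rewrite /crossv grade_wedge !grade_precomp.
Qed.

(** The face that omits the first index is where the twist acts: the counit part
    of phi_P cancels the face of the tensor product differential, and the part
    with the transition function is the actual face. *)
Lemma nablaV_pure_first_face w h a s p (r : seq (dform G * dform G)) :
  cech U h -> (forall x, x \in r -> Omega x.1 /\ Omega x.2) ->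
  cross (\sum_(x <- r) x.1 \ot x.2) =
    pull (fun q : prod_charted G G => gmul q.1 q.2) (gsgn 1 w) ->
  chain (a :: s) -> inter V (a :: s) p ->
  grade (nablaV_pure w h s p) =
  precomp (tmap (triv T a) p)
    (crossv (grade (w (triv T a p).1)) (grade (h s (triv T a p).2)) -
     \sum_(x <- r) crossv (x.1 (triv T a p).1)
       (cup U (phi_P T x.2) h (a :: s) (triv T a p).2)).
Proof.
move=> ch hr ec cs Vp; have [_ Uq] := inter_triv Vp (mem_head a s).
case: s cs Vp Uq => [|b s] cs Vp Uq.
  rewrite big1 => [|x _]; last by rewrite cup_phi_P1 crossv0r.
  rewrite subr0 (cech_nochain ch) // nablaV_pure_nochain //.
  have -> : grade (0 : seq 'rV[R]_n -> R^o) = 0.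
    by apply/funext => vs; exact: mulr0.
  rewrite crossv0r; apply/funext => vs; exact: mulr0.
rewrite (nablaV_pure_behead h cs Vp ec); congr precomp.
have alt x : x \in r -> alternating_multilinear (x.2 (gone G)).
  by move=> /hr[_]; exact: Omega_alternating.
have := cross_counit sX (gsgn 1 (h (b :: s))) (triv T a p) alt ec.
rewrite (crossE sG sX) !gsgn1E => ->.
rewrite -sumrN -big_split /=; apply: eq_bigr => x _.
rewrite (crossE sG sX) cup_phi_P // crossvDr opprD addrA.
rewrite -[(counit x.2 *: gsgn 1 (h (b :: s))) _]/(counit x.2 *: gsgn 1 (h (b :: s)) _).
rewrite gsgn1E subrr add0r -scaleN1r -[- cov_wedge _ _]scaleN1r crossvZr.
by rewrite scalerA mulrNN mulr1 scale1r.
Qed.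

(** All the faces but the first one, and the exterior derivative, are computed in
    one trivialization and agree term by term. *)
Lemma D_nablaV_pure w h : Omega w -> cech U h ->
  cech_D V (nablaV_pure w h) = nablaV T (d_twist U (phi_P T) w h).
Proof.
move=> hw ch; have hw' := Omega_gsgn hw.
have [[r [hr er]] ec] := coprodP hw'; rewrite er in ec.
have dE : nablaV T (d_twist U (phi_P T) w h) =
    - (\sum_(x <- r) nablaV_pure x.1 (cup U (phi_P T x.2) h)) +
    (nablaV_pure (extd setT w) h + nablaV_pure (gsgn 1 w) (cech_D U h)).
  rewrite /d_twist (cap_sum h er) addrC -scaleN1r nablaV_linear scaleN1r.
  rewrite /d_tens -[extd setT w \ot h]scale1r nablaV_linear scale1r !nablaV_tens.
  congr (- _ + _).
  by rewrite -(big_map (fun x => (x.1, cup U (phi_P T x.2) h)) xpredT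
    (fun x => x.1 \ot x.2)) nablaV_sum big_map.
rewrite dE; apply/funext => s; apply/funext => p.
have -> : (- (\sum_(x <- r) nablaV_pure x.1 (cup U (phi_P T x.2) h)) +
    (nablaV_pure (extd setT w) h + nablaV_pure (gsgn 1 w) (cech_D U h))) s p =
    - (\sum_(x <- r) nablaV_pure x.1 (cup U (phi_P T x.2) h) s p) +
    (nablaV_pure (extd setT w) h s p + nablaV_pure (gsgn 1 w) (cech_D U h) s p).
  congr (- _ + _); elim: (r) => [|x r' IH]; first by rewrite !big_nil.
  by rewrite !big_cons -IH.
have [Vp|nVp] := pselect (inter V s p); last first.
  by rewrite cech_D_out // !nablaV_pure_out // !addr0 big1 ?oppr0 // => x _; rewrite nablaV_pure_out.
case: (boolP (chain s)) => cs; last first.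
  rewrite big1 => [|x _]; last by rewrite nablaV_pure_nochain.
  rewrite cech_D_nochain ?nablaV_pure_nochain // oppr0 add0r.
  exact/esym/addr0.
case: s cs Vp => // a s cs Vp.
have [eq2 Uq] := inter_triv Vp (mem_head a s).
set q := triv T a p in eq2 Uq *.
rewrite cech_D_at // extd_nablaV_pure // !nablaV_pure_at // -/q.
rewrite (eq_bigr (fun x => precomp (tmap (triv T a) p)
  (crossv (x.1 q.1) (cup U (phi_P T x.2) h (a :: s) q.2)))); last first.
  by move=> x _; rewrite nablaV_pure_at.
rewrite -precomp_sum cech_D_at // gsgn1E.
rewrite /= !big_ord_recl !expr0 !scale1r.
have d0 : del 0 (a :: s) = s by rewrite /del take0 drop1.
rewrite !d0 (nablaV_pure_first_face ch hr ec cs Vp) -/q.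
rewrite (eq_bigr (fun i : 'I_(size s) => precomp (tmap (triv T a) p)
  ((-1) ^+ lift ord0 i *: crossv (grade (w q.1)) (grade (h (del (lift ord0 i) (a :: s)) q.2)))));
  last first.
  move=> i _; have Vp' := inter_del (i := lift ord0 i) Vp.
  have cs' : chain (del (lift ord0 i) (a :: s)) by exact: chain_del.
  by rewrite grade_nablaV_pure.
rewrite -precomp_sum !crossvDr crossv_sumr.
rewrite (eq_bigr (fun i : 'I_(size s) =>
  (-1) ^+ lift ord0 i *: crossv (grade (w q.1)) (grade (h (del (lift ord0 i) (a :: s)) q.2))));
  last by move=> i _.
rewrite [in RHS](eq_bigr (fun i : 'I_(size s) =>
  (-1) ^+ lift ord0 i *: crossv (grade (w q.1)) (grade (h (del (lift ord0 i) (a :: s)) q.2))));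
  last by move=> i _; rewrite crossvZr.
have pD f g : precomp (tmap (triv T a) p) f + precomp (tmap (triv T a) p) g =
  precomp (tmap (triv T a) p) (f + g) by [].
have pN f : - precomp (tmap (triv T a) p) f = precomp (tmap (triv T a) p) (- f) by [].
rewrite pN !pD; congr precomp.
set e1 := crossv _ _; set e2 := crossv _ _; set e3 := crossv _ _.
set S := \sum_(i < size s) _; set C := \sum_(x <- r) _.
rewrite [RHS]addrC -!addrA; do 3 congr (_ + _).
by rewrite addrC.
Qed.

Lemma twisted_d_twist w h : Omega w -> cech U h ->
  twisted U (d_twist U (phi_P T) w h).
Proof.
move=> hw ch; have hw' := Omega_gsgn hw.
have [[r [hr er]] _] := coprodP hw'.
rewrite /d_twist (cap_sum h er) /twisted -sumrN.
apply: tens_spanD; first apply: tens_spanD.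
- by apply: tens_span_tens => //; exact: Omega_d.
- by apply: tens_span_tens => //; exact: cech_cech_D.
apply: tens_span_sum => x /hr[h1 h2]; rewrite -scaleN1r -tensZl.
apply: tens_span_tens; first exact: OmegaZ.
by apply: cech_cup => //; exact: cech_phi_P.
Qed.

(** On V_a = G x U_a the tangent map of the trivialization is onto, so that the
    values of the image on tangent vectors determine those of cross, and these
    determine the tensor. *)
Lemma nablaV_inj : {in twisted U &, injective (nablaV T)}.
Proof.
move=> t t'; rewrite !inE => ht ht' e; apply/eqP; rewrite -subr_eq0; apply/eqP.
have h : twisted U (t - t').
  rewrite addrC -scaleN1r; apply: tens_spanD => //.
  by apply: tens_spanZ ht' => v; exact: OmegaZ.
have e0 : nablaV T (t - t') = 0 by rewrite addrC -scaleN1r nablaV_linear e scaleN1r addNr.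
case: h e0 => r [hr ->]; rewrite nablaV_sum => e0.
apply: (@tens_sum_eq0 R _ _ (G * seq 'rV[R]_m)%type (fun i w => w i.1 i.2)) => //.
  by move=> v hv; apply/funext => g; apply/funext => vs; exact: (hv (g, vs)).
move=> [g vs] /=; apply/funext => s; apply/funext => x; apply/funext => us.
have evE : (\sum_(y <- r) y.1 g vs *: y.2) s x us = \sum_(y <- r) y.1 g vs * y.2 s x us.
  elim: (r) => [|y r' IH]; first by rewrite !big_nil.
  by rewrite !big_cons -IH.
rewrite evE.
case: (boolP (chain s)) => cs; last first.
  by rewrite big_seq big1 // => y /hr[_ cy]; rewrite (cech_nochain cy cs) mulr0.
have [Ux|Ux] := pselect (inter U s x); last first.
  by rewrite big_seq big1 // => y /hr[_ cy]; rewrite (cech_out cy Ux) mulr0.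
case: s cs Ux evE => // a s cs Ux _.
have Ua : U a x by apply: Ux; exact: mem_head.
pose q : GX := (g, x); pose p := trivV T a q.
have pq : triv T a p = q by exact: trivVK.
have pX : bproj p = x by exact: trivV_proj.
have Vp : inter V (a :: s) p by move=> b bs; rewrite /pcover /= pX; exact: Ux.
pose W : set GX := setT `*` U a.
have oW : open W by apply: open_prod => //; exact: openT.
have sV : smooth_map W (trivV T a) by apply: smooth_map_sub (trivV_smooth T a) => z [].
have sid := smooth_map_id sGX oW.
have Wq : W q by [].
have tt z : tmap (triv T a) p (tmap (trivV T a) q z) = z.
  rewrite -(tmap_comp z sGX sP sGX oW (open_pcover a) sV (triv_smooth T a) Wq); last first.
    by rewrite /pcover /= -/p pX.
  rewrite -(tmap_local sGX sGX (f := id) oW sid Wq) ?tmap_id //.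
  by move=> z' [_ Uz]; rewrite /= trivVK.
have ev : \sum_(y <- r) nablaV_pure y.1 y.2 (a :: s) p = 0.
  transitivity ((\sum_(y <- r) nablaV_pure y.1 y.2) (a :: s) p); last by rewrite e0.
  elim: (r) => [|y r' IH]; first by rewrite !big_nil.
  by rewrite !big_cons IH.
(* The vectors of zs are carried to P, where the hypothesis is evaluated. *)
pose zs := [seq rowl n v | v <- vs] ++ [seq rowr m u | u <- us].
have evs : \sum_(y <- r) nablaV_pure y.1 y.2 (a :: s) p [seq tmap (trivV T a) q z | z <- zs] = 0.
  transitivity ((\sum_(y <- r) nablaV_pure y.1 y.2 (a :: s) p) [seq tmap (trivV T a) q z | z <- zs]).
    elim: (r) => [|y r' IH]; first by rewrite !big_nil.
    by rewrite !big_cons IH.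
  by rewrite ev.
rewrite -[RHS]evs; apply: eq_big_seq => y /hr[hy cy].
rewrite nablaV_pure_at // /precomp pq -map_comp.
have -> : [seq (tmap (triv T a) p \o tmap (trivV T a) q) z | z <- zs] = zs.
  by rewrite -[RHS]map_id; apply: eq_map => z; exact: tt.
rewrite crossv_split //; first exact: Omega_alternating.
by case: (cech_smooth (a :: s) cy) => + _; exact.
Qed.

Lemma cech_D_0 (t : seq A) p : cech_D V (0 : cochain P A) t p = 0.
Proof.
have [Vp|nVp] := pselect (inter V t p); last by rewrite cech_D_out.
case: (boolP (chain t)) => ct; last by rewrite cech_D_nochain_at // extd0.
rewrite cech_D_at // extd0 add0r big1 // => i _.
have -> : grade ((0 : cochain P A) (del i t) p) = 0.
  by apply/funext => vs; exact: mulr0.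
exact: scaler0.
Qed.

Lemma cech_D_nablaV (r : seq (dform G * cochain X A)) :
  (forall x, x \in r -> Omega x.1 /\ cech U x.2) ->
  cech_D V (nablaV T (\sum_(x <- r) x.1 \ot x.2)) =
  nablaV T (\sum_(x <- r) d_twist U (phi_P T) x.1 x.2).
Proof.
have nab0 : nablaV T 0 = 0.
  by have := nablaV_linear (-1) 0 0; rewrite scaler0 addr0 scaleN1r addNr.
elim: r => [|x r IH] r_in.
  by rewrite !big_nil nab0; apply/funext => t; apply/funext => p; exact: cech_D_0.
have [hx cx] := r_in x (mem_head _ _).
have r_in' y : y \in r -> Omega y.1 /\ cech U y.2.
  by move=> yr; apply: r_in; rewrite in_cons yr orbT.
rewrite !big_cons -[x.1 \ot x.2]scale1r nablaV_linear scale1r.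
rewrite -[d_twist U _ x.1 x.2]scale1r nablaV_linear scale1r -IH // nablaV_tens.
rewrite -(D_nablaV_pure hx cx); apply: (cech_D_add sP); first by move=> t; exact: smooth_nablaV_pure.
move=> t; rewrite nablaV_sum.
have -> : (\sum_(y <- r) nablaV_pure y.1 y.2) t = \sum_(y <- r) nablaV_pure y.1 y.2 t.
  elim: (r) => [|y r' IH']; first by rewrite !big_nil.
  by rewrite !big_cons -IH'.
apply: (smooth_form_sum sP) => [|y yr]; first exact: oV.
by have [hy cy] := r_in' y yr; exact: smooth_nablaV_pure.
Qed.

End TwistedDifferential.

Theorem theorem11 (R : realType) (m n k : nat) (G : alg_group R m)
    (X : charted R n) (X_closed : is_closed_manifold X)
    (P : principal_bundle k G X)
    (d : Order.disp_t) (A : finOrderType d) (U : A -> set X)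
    (U_cover : is_open_cover U) (T : trivialization P U)
    (s : seq (dform G * cochain X A))
    (s_in : forall x, x \in s -> Omega x.1 /\ cech U x.2) :
  d_P T (\sum_(x <- s) x.1 \ot x.2) =
  \sum_(x <- s) d_twist U (phi_P T) x.1 x.2.
Proof.
have sX : smooth_atlas X by apply: manifold_atlas; case: X_closed.
have oU := U_cover.1.
rewrite /d_P (cech_D_nablaV sX oU T s_in) /nabla pinvKV //.
  exact: (nablaV_inj sX oU).
rewrite inE; apply: tens_span_sum => x /s_in[hx cx].
exact: (twisted_d_twist sX oU).
Qed.
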